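(* There exists a constant $C_1>0$ such that for every closed connected Riemann surface $(S,j)$ and every non-constant $J$-holomorphic curve $v:S\to M$ with $E_{symp}(v)<+\infty$, one has $$E(v)\leq C_1\,E_{symp}(v).$$
   Context: Setting. $(M,\omega)$ is a closed smooth symplectic manifold of dimension $2N$, $J$ is an almost complex structure compatible with $\omega$, and $p\in M$ is a fixed point. $J$ is integrable near $p$; moreover there are a neighborhood $V$ of $p$, an $\epsilon>0$ and a coordinate chart (diffeomorphism) $\varphi:V\to B(0,\epsilon)=\{z\in\mathbb{C}^N : |z|<\epsilon\}$ with $\varphi(p)=0$, $\varphi^*i=J$ and $\varphi^*\omega_0=\omega$, where $\omega_0=\sum_{k=1}^N dx_k\wedge dy_k$; such a chart is fixed. Identify $V\setminus\{p\}\cong B(0,\epsilon)\setminus\{0\}$ with $W:=(-\infty,\log\epsilon)\times S^{2N-1}$ via $z\mapsto(\log|z|,z/|z|)$, with coordinates $(r,\Theta)$ on $W$. Let $\lambda=\sum_{k=1}^N (x_k\,dy_k-y_k\,dx_k)|_{S^{2N-1}}$, extended to $W$ by pull-back under $(r,\Theta)\mapsto\Theta$. Energies. For a Riemann surface $(\Sigma,j)$ that is a closed Riemann surface with finitely many points (punctures) removed, and a $J$-holomorphic curve $v:\Sigma\to M\setminus\{p\}$ (i.e. $J\circ Tv=Tv\circ j$), set $E_{symp}(v)=\int_\Sigma v^*\omega$, $E_{d\lambda}(v)=\int_{v^{-1}(W)}v^*d\lambda$, and $E_\lambda(v)=\sup_{\phi\in\mathcal{C}}\int_{v^{-1}(W)}v^*(\phi(r)\,dr\wedge\lambda)$,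 where $\mathcal{C}=\{\phi\in C_c^\infty((-\infty,\log\epsilon),[0,1]) : \int_{-\infty}^{\log\epsilon}\phi(x)\,dx=1\}$. The Hofer's energy is $E(v)=E_{symp}(v)+E_{d\lambda}(v)+E_\lambda(v)$. For a non-constant $J$-holomorphic curve $v:S\to M$ from a closed connected Riemann surface $(S,j)$, the set $v^{-1}(p)$ is finite, $E_{symp}(v)=\int_S v^*\omega$, and the Hofer's energy is defined as $E(v):=E(v|_{S\setminus v^{-1}(p)})$, where the restriction is viewed as a curve in $M\setminus\{p\}$. *)

(* Defs.v *)
From mathcomp Require Import all_boot all_order all_algebra.
From mathcomp Require Import all_classical all_reals all_analysis.
Import Order.TTheory GRing.Theory Num.Theory.
Import numFieldNormedType.Exports.

Set Implicit Arguments.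
Unset Strict Implicit.
Unset Printing Implicit Defensive.

Local Open Scope classical_set_scope.
Local Open Scope ring_scope.

Section Smooth.
Context {R : realType} {V W : normedModType R}.

Fixpoint Ck_on (k : nat) (U : set V) (f : V -> W) : Prop :=
  if k is k'.+1 then
    (forall x, U x -> differentiable f x) /\
    (forall v, Ck_on k' U (fun x => 'D_v f x))
  else forall x, U x -> {for x, continuous f}.

(* Intended for open U only. *)
Definition smooth_on (U : set V) (f : V -> W) : Prop :=
  forall k, Ck_on k U f.

End Smooth.

(* A linear map is a matrix acting on the right of row vectors (as in
   [jacobian]); a bilinear form B is the matrix such that
   B(u, w) = u *m B *m w^T; a covector a is the row such that a(u) = u *m a^T. *)

Section Linear.
Context {R : realType}.

Definition pull (m n : nat) (A : 'M[R]_(m, n)) (B : 'M[R]_n) : 'M[R]_m :=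
  A *m B *m A^T.

Definition wedge (n : nat) (a b : 'rV[R]_n) : 'M[R]_n := a^T *m b - b^T *m a.

(* C^N is R^(N + N), z = x + iy being row_mx x y. *)
Definition stdJ (N : nat) : 'M[R]_(N + N) := block_mx 0 1%:M (- 1%:M) 0.

Definition coord_x (N : nat) (k : 'I_N) : 'rV[R]_(N + N) :=
  delta_mx 0 (lshift N k).
Definition coord_y (N : nat) (k : 'I_N) : 'rV[R]_(N + N) :=
  delta_mx 0 (rshift N k).

Definition stdOmega (N : nat) : 'M[R]_(N + N) :=
  \sum_(k < N) wedge (coord_x k) (coord_y k).

(* [enorm] is the Euclidean norm; the norm of the library is the sup norm. *)
Definition enorm (n : nat) (z : 'rV[R]_n) : R :=
  Num.sqrt (\sum_i z 0 i ^+ 2).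

End Linear.

Section Cylinder.
Context {R : realType} {N : nat}.
Local Notation E := 'rV[R]_(N + N).

Definition dext0 (f : E -> R) (z : E) : E :=
  \row_i 'D_(delta_mx 0 i) f z.
Definition dext1 (a : E -> E) (z : E) : 'M[R]_(N + N) :=
  \matrix_(i, j) ('D_(delta_mx 0 i) (fun y => a y 0 j) z
                - 'D_(delta_mx 0 j) (fun y => a y 0 i) z).

(* The coordinates (r, Theta), with values in ]-oo, ln eps[ and the sphere. *)
Definition cyl_r (z : E) : R := ln (enorm z).
Definition cyl_Theta (z : E) : E := (enorm z)^-1 *: z.

Definition lambda0 (w : E) : E :=
  \sum_(k < N) (w 0 (lshift N k) *: coord_y k - w 0 (rshift N k) *: coord_x k).

(* The pull-back of lambda0 under cyl_Theta. *)
Definition lambda (z : E) : E :=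
  lambda0 (cyl_Theta z) *m (jacobian cyl_Theta z)^T.

Definition dlambda : E -> 'M[R]_(N + N) := dext1 lambda.

Definition phi_dr_lambda (f : R -> R) (z : E) : 'M[R]_(N + N) :=
  f (cyl_r z) *: wedge (dext0 cyl_r z) (lambda z).

(* The class C of test functions on ]-oo, ln eps[, extended by 0 to R. *)
Definition test_fun (eps : R) (f : R -> R) : Prop :=
  [/\ smooth_on [set: R] f,
      compact (closure [set x | f x != 0]),
      closure [set x | f x != 0] `<=` `]-oo, ln eps[,
      (forall x, 0 <= f x <= 1) &
      (\int[@lebesgue_measure R]_(x in `]-oo, ln eps[) (f x)%:E = 1)%E].

End Cylinder.

Record chart (R : realType) (T : topologicalType) (n : nat) := Chart {
  cmap :> T -> 'rV[R]_n ;
  cinv : 'rV[R]_n -> T ;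
  dom : set T ;
  dom_open : open dom ;
  img_open : open (cmap @` dom) ;
  cmapK : forall x, dom x -> cinv (cmap x) = x ;
  cmap_cont : forall x, dom x -> {for x, continuous cmap} ;
  cinv_cont : forall y, (cmap @` dom) y -> {for y, continuous cinv} }.

Definition trans_dom (R : realType) (T : topologicalType) (n : nat)
    (c d : chart R T n) : set 'rV[R]_n := c @` (dom c `&` dom d).

Definition trans (R : realType) (T : topologicalType) (n : nat)
    (c d : chart R T n) : 'rV[R]_n -> 'rV[R]_n := d \o cinv c.

(* The tangent space at x is 'rV_n, a tangent vector being represented by its
   components in the preferred chart [chart_at x]. *)
Record manifold (R : realType) (n : nat) := Manifold {
  carrier :> topologicalType ;
  atlas : set (chart R carrier n) ;
  chart_at : carrier -> chart R carrier n ;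
  chart_at_atlas : forall x, atlas (chart_at x) ;
  chart_at_dom : forall x, dom (chart_at x) x ;
  atlas_smooth : forall c d, atlas c -> atlas d ->
    smooth_on (trans_dom c d) (trans c d) }.

Definition closed_manifold (R : realType) (n : nat) (M : manifold R n) : Prop :=
  hausdorff_space M /\ compact [set: M].

(* Membership in the maximal atlas. *)
Definition smooth_chart (R : realType) (n : nat) (M : manifold R n)
    (c : chart R M n) : Prop :=
  forall d, atlas d ->
    smooth_on (trans_dom c d) (trans c d) /\
    smooth_on (trans_dom d c) (trans d c).

(* The differential at x of a chart c around x, as a map from T_x M to R^n. *)
Definition dchart (R : realType) (n : nat) (M : manifold R n)
    (c : chart R M n) (x : M) : 'M[R]_n :=
  jacobian (trans (chart_at x) c) (chart_at x x).

(* The differential at c x of cinv c, as a map from R^n to T_x M. *)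
Definition dchart_inv (R : realType) (n : nat) (M : manifold R n)
    (c : chart R M n) (x : M) : 'M[R]_n :=
  jacobian (trans c (chart_at x)) (c x).

Definition smooth_map (R : realType) (m n : nat)
    (S : manifold R m) (M : manifold R n) (v : S -> M) : Prop :=
  continuous v /\
  forall (c : chart R S m) (d : chart R M n), atlas c -> atlas d ->
    smooth_on (c @` (dom c `&` v @^-1` dom d)) (d \o v \o cinv c).

Definition tangent_map (R : realType) (m n : nat)
    (S : manifold R m) (M : manifold R n) (v : S -> M) (s : S) : 'M[R]_(m, n) :=
  jacobian (chart_at (v s) \o v \o cinv (chart_at s)) (chart_at s s).

(* 2-forms and endomorphism fields are given by their matrices in T_x M. *)

Section Tensors.
Context {R : realType} {n : nat} {M : manifold R n}.

Definition local_form (alpha : M -> 'M[R]_n) (c : chart R M n)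
    (y : 'rV[R]_n) : 'M[R]_n :=
  pull (dchart_inv c (cinv c y)) (alpha (cinv c y)).

Definition local_endo (J : M -> 'M[R]_n) (c : chart R M n)
    (y : 'rV[R]_n) : 'M[R]_n :=
  dchart_inv c (cinv c y) *m J (cinv c y) *m dchart c (cinv c y).

Definition smooth_form (alpha : M -> 'M[R]_n) : Prop :=
  (forall x, (alpha x)^T = - alpha x) /\
  forall c, atlas c -> smooth_on (c @` dom c) (local_form alpha c).

Definition closed_form (alpha : M -> 'M[R]_n) : Prop :=
  forall c, atlas c -> forall y, (c @` dom c) y -> forall i j k : 'I_n,
    let a i j := fun z => local_form alpha c z i j in
    let D i := fun g : 'rV[R]_n -> R => 'D_(delta_mx 0 i) g y in
    D i (a j k) + D j (a k i) + D k (a i j) = 0.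

Definition symplectic (omega : M -> 'M[R]_n) : Prop :=
  [/\ smooth_form omega, closed_form omega &
      forall x, omega x \in unitmx].

Definition almost_complex (J : M -> 'M[R]_n) : Prop :=
  (forall x, J x *m J x = - 1%:M) /\
  forall c, atlas c -> smooth_on (c @` dom c) (local_endo J c).

Definition compatible (omega J : M -> 'M[R]_n) : Prop :=
  (forall x, pull (J x) (omega x) = omega x) /\
  forall x (u : 'rV[R]_n), u != 0 -> 0 < (u *m omega x *m (u *m J x)^T) 0 0.

End Tensors.

Definition pullback (R : realType) (m n : nat)
    (S : manifold R m) (M : manifold R n) (v : S -> M) (alpha : M -> 'M[R]_n)
    (s : S) : 'M[R]_m :=
  pull (tangent_map v s) (alpha (v s)).

(* The pull-back c^* beta of a form on an open set of R^n; only meaningful on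
   dom c. *)
Definition chart_pullback (R : realType) (n : nat) (M : manifold R n)
    (c : chart R M n) (beta : 'rV[R]_n -> 'M[R]_n) (x : M) : 'M[R]_n :=
  pull (dchart c x) (beta (c x)).

(* phi is a chart from V = dom phi onto B(0, eps), with phi p = 0,
   phi^* i = J and phi^* omega_0 = omega. *)
Definition flat_chart (R : realType) (N : nat) (M : manifold R (N + N))
    (omega J : M -> 'M[R]_(N + N)) (p : M) (eps : R)
    (phi : chart R M (N + N)) : Prop :=
  [/\ smooth_chart phi,
      dom phi p /\ phi p = 0,
      phi @` dom phi = [set z | enorm z < eps],
      (forall x, dom phi x -> J x *m dchart phi x = dchart phi x *m stdJ N) &
      (forall x, dom phi x ->
         chart_pullback phi (fun=> stdOmega N) x = omega x)].

(* The transition maps satisfy the Cauchy-Riemann equations. *)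
Definition riemann_surface (R : realType) (S : manifold R (1 + 1)) : Prop :=
  forall c d : chart R S (1 + 1), atlas c -> atlas d ->
  forall y, trans_dom c d y ->
    stdJ 1 *m jacobian (trans c d) y = jacobian (trans c d) y *m stdJ 1.

(* The complex structure j; it has the same expression in all charts of a
   Riemann surface. *)
Definition surface_j (R : realType) (S : manifold R (1 + 1)) (s : S)
  : 'M[R]_(1 + 1) := stdJ 1.

Definition J_holomorphic (R : realType) (n : nat)
    (S : manifold R (1 + 1)) (M : manifold R n) (J : M -> 'M[R]_n)
    (v : S -> M) : Prop :=
  smooth_map v /\
  forall s, tangent_map v s *m J (v s) = surface_j s *m tangent_map v s.

Section Integration.
Context {R : realType} {S : manifold R (1 + 1)}.

Definition plane (q : R * R) : 'rV[R]_(1 + 1) := row_mx q.1%:M q.2%:M.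

(* The integral over A, a subset of dom c, with the orientation of c. *)
Definition chart_integral (c : chart R S (1 + 1)) (A : set S)
    (alpha : S -> 'M[R]_(1 + 1)) : \bar R :=
  (\int[@lebesgue_measure R \x @lebesgue_measure R]_(q in
        [set q | (c @` A) (plane q)])
     (local_form alpha c (plane q) ord0 ord_max)%:E)%E.

(* The value does not depend on the finite cover: the charts of a Riemann
   surface are positively oriented.  A finite cover exists when S is compact. *)
Definition surface_integral (A : set S) (alpha : S -> 'M[R]_(1 + 1)) : \bar R :=
  xget 0%E [set I | exists (k : nat) (c : nat -> chart R S (1 + 1)),
    [/\ forall i, (i < k)%N -> atlas (c i),
        [set: S] `<=` \bigcup_(i in [set i | (i < k)%N]) dom (c i) &
        I = (\sum_(i < k)
               chart_integral (c i) (A `&` seqDU (fun i => dom (c i)) i)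
                 alpha)%E]].

End Integration.

(* Sigma is the complement of finitely many points in the closed surface S; the
   curve is the restriction of v to Sigma. *)

Section Energies.
Context {R : realType} {N : nat} {M : manifold R (N + N)}.
Context {S : manifold R (1 + 1)}.
Variables (omega : M -> 'M[R]_(N + N)) (p : M) (eps : R).
Variables (phi : chart R M (N + N)) (Sigma : set S) (v : S -> M).

Definition E_symp : \bar R := surface_integral Sigma (pullback v omega).

(* v^-1(W), where W is identified with V \ {p}. *)
Definition cyl_part : set S := Sigma `&` v @^-1` (dom phi `\ p).

Definition E_dlambda : \bar R :=
  surface_integral cyl_part (pullback v (chart_pullback phi dlambda)).

Definition E_lambda : \bar R :=
  ereal_sup [set surface_integral cyl_part
               (pullback v (chart_pullback phi (phi_dr_lambda f)))
            | f in test_fun eps].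

Definition hofer_energy : \bar R := (E_symp + E_dlambda + E_lambda)%E.

End Energies.

(* Main.v *)
(* Put s = |z|^2 and r = ln |z|.  Along a J-holomorphic curve the forms
   omega_0, dr /\ lambda and dlambda have nonnegative densities w, P and Q with
   w = s (P + Q / 2).  For a function G of r that vanishes to the order of s at
   the origin and has bounded support, G lambda = (G / s) lambda_0 extends over
   the punctures, so Stokes' theorem gives that the integral of G Q + G_r P is
   0.  Take G = eta - Phi with eta = 1 - max(1 - s / a, 0)^2, a = eps^2 / 2, and
   Phi the primitive of a test function f, so that eta = Phi = 1 near the end
   r = ln eps.  As eta <= 2 s / a and eta_r <= 4 s / a,
     int (f P + Phi Q) = int (eta_r P + eta Q) <= (4 / a) int w.
   The supremum over f bounds E_lambda; letting Phi increase to 1 bounds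
   E_dlambda, by monotone convergence.  Hence C1 = 1 + 8 / a.

   Surface integrals are computed in charts, so this needs the change of
   variables formula for conformal maps of the plane; two measures are compared
   on boxes by bisection, using that a conformal map is close to a similarity
   on small boxes. *)
From HB Require Import structures.
Require Import Defs.
From mathcomp Require Import all_boot all_order all_algebra.
From mathcomp Require Import all_classical all_reals all_analysis.
From mathcomp Require Import measurable_realfun ring lra.
Import Order.TTheory GRing.Theory Num.Theory.
Import numFieldNormedType.Exports.
Set Implicit Arguments.
Unset Strict Implicit.
Unset Printing Implicit Defensive.
Local Open Scope classical_set_scope.
Local Open Scope ring_scope.

(** * Lebesgue measure in the plane and conformal changes of variables *)

(** The obstacle is the singularity of the cylinder forms over the points of [v^-1(p)]. No discs are
    cut out there: Stokes' theorem is applied on all of [S] to [(G / s) lambda_0], where [G / s] is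
    a C^1 function of [s] across [s = 0]. The profile [eta] is chosen for this: [1 - (1 - s / a)^2]
    is divisible by [s], and it reaches the value 1 with slope 0 at [s = a]. One derivative is
    enough, because the other factor of each [df /\ dg] is a smooth coordinate of the curve. The
    comparison is pointwise: [(4 / a) w] minus the Stokes density is nonnegative on the whole
    surface, also at the punctures and outside the chart, and it dominates [f P + Phi Q] inside.
    Each of the two cylinder energies costs one constant [4 / a], and the symplectic one costs 1.

    The second obstacle is that [surface_integral] selects some finite cover by charts. Every
    evaluation of an energy therefore rests on independence of the cover, which is where the change
    of variables enters. *)

Notation plane2 R := (measurableTypeR R * measurableTypeR R)%type.
Notation leb R := (@lebesgue_measure R).
Notation leb2 R := ((leb R \x leb R)%E : {measure set (plane2 R) -> \bar R}).

Section PlaneMeasure.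
Context {R : realType}.
Implicit Types (A B : set (plane2 R)) (a b : R * R).

(** Half-open on both axes, so that cutting a box at a coordinate is an exact partition. *)
Definition box (x y l w : R) : set (plane2 R) :=
  `]x, x + l]%classic `*` `]y, y + w]%classic.

Lemma measurable_box x y l w : measurable (box x y l w).
Proof. by apply: measurableX; exact: measurable_itv. Qed.

Lemma leb2_box x y l w : 0 <= l -> 0 <= w -> leb2 R (box x y l w) = (l * w)%:E.
Proof.
move=> l0 w0.
have E z r : 0 <= r -> leb R `]z, z + r]%classic = r%:E.
  move=> r0; rewrite lebesgue_measure_itv/= lte_fin ltrDl.
  case: ltP => r1; first by rewrite -EFinD; congr (_%:E); ring.
  by congr (_%:E); apply/eqP; rewrite eq_le r0 r1.
have -> : leb2 R (box x y l w) =
    mule (leb R `]x, x + l]) (leb R `]y, y + w]).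
  by apply: product_measure1E; exact: measurable_itv.
by rewrite !E.
Qed.

(** The sigma-algebra of [plane2] is the product one, so an open set of the topology has to be
    exhibited as a countable union of rectangles, here those with rational corners. *)
Lemma open_measurable2 (O : set (R * R)) :
  open O -> measurable (O : set (plane2 R)).
Proof.
move=> oO.
pose B (q : rat * rat * rat * rat) : set (plane2 R) :=
  `]ratr q.1.1.1, ratr q.1.1.2[%classic `*` `]ratr q.1.2, ratr q.2[%classic.
have -> : O = \bigcup_(q in [set q | B q `<=` O]) B q.
  apply/seteqP; split=> [[x y] Oxy|z [q qO Bqz]]; last exact: qO.
  have /nbhs_ballP[e /= e0 eO] : nbhs (x, y) O by exact: open_nbhs_nbhs.
  have [a /itvP aI] : exists a : rat, ratr a \in `]x - e, x[.
    by apply: rat_in_itvoo; rewrite ltrBlDr ltrDl.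
  have [b /itvP bI] : exists a : rat, ratr a \in `]x, x + e[.
    by apply: rat_in_itvoo; rewrite ltrDl.
  have [c /itvP cI] : exists a : rat, ratr a \in `]y - e, y[.
    by apply: rat_in_itvoo; rewrite ltrBlDr ltrDl.
  have [d /itvP dI] : exists a : rat, ratr a \in `]y, y + e[.
    by apply: rat_in_itvoo; rewrite ltrDl.
  exists (a, b, c, d); last by rewrite /B/= !in_itv/= !(aI, bI, cI, dI).
  move=> [x' y']; rewrite /B/= !in_itv/= => -[/andP[ax bx] /andP[cy dy]].
  have := (aI, bI, cI, dI) => I; apply: eO.
  split; rewrite /= /ball/= ltr_norml.
    have : x - e < ratr a /\ ratr b < x + e by rewrite !I.
    lra.
  have : y - e < ratr c /\ ratr d < y + e by rewrite !I.
  lra.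
rewrite bigcup_mkcond; apply: countable_bigcupT_measurable => // q.
case: ifP => // _; apply: measurableX; exact: measurable_itv.
Qed.

End PlaneMeasure.

Section Linear.
Context {R : realType}.
Implicit Types (A B : set (plane2 R)).

Lemma measurable_affine (a c : R) : measurable_fun [set: measurableTypeR R] (fun x : measurableTypeR R => a * x + c : measurableTypeR R).
Proof.
apply: measurable_funD; last exact: measurable_cst.
by apply: measurable_funM; [exact: measurable_cst|exact: measurable_id].
Qed.

(** The rescaled pushforward of Lebesgue measure gives each interval []u, v]] its length, and
    Lebesgue measure is characterised by that. *)
Lemma leb_affine_pos (a c : R) (A : set (measurableTypeR R)) : 0 < a -> measurable A ->
  leb R A = (a%:E * leb R ((fun x => (a * x + c)%R) @^-1` A))%E.
Proof.
move=> a0 mA.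
pose f : measurableTypeR R -> measurableTypeR R := fun x => a * x + c.
have mf : measurable_fun setT f := measurable_affine a c.
pose F : {mfun measurableTypeR R >-> measurableTypeR R} :=
  HB.pack f (isMeasurableFun.Build _ _ _ _ _ mf).
pose m' := (mscale (NngNum (ltW a0)) (pushforward (leb R) F) :
    {measure set (measurableTypeR R) -> \bar R}).
have -> : leb R A = m' mf A.
  apply: lebesgue_measure_unique => // _ [[u v] /= _ <-].
  rewrite /m' /= /mscale/= /pushforward.
  have -> : F @^-1` `]u, v]%classic = `](u - c) / a, (v - c) / a]%classic.
    apply/seteqP; split => x /=; rewrite !in_itv/= /F/= /f ltr_pdivrMr// ler_pdivlMr//;
     by rewrite [x * a]mulrC ltrBlDr lerBrDr.
  rewrite !lebesgue_measure_itv/= !lte_fin ltr_pM2r ?invr_gt0// ltrD2r.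
  case: ifP => uv; last by rewrite mule0.
  rewrite -!EFinD -EFinM; congr (_%:E); field; exact: lt0r_neq0.
by [].
Qed.

(** A negative slope is a positive one followed by the reflection, which preserves Lebesgue
    measure. *)
Lemma leb_affine (a c : R) (A : set (measurableTypeR R)) : a != 0 -> measurable A ->
  leb R A = (`|a|%:E * leb R ((fun x => (a * x + c)%R) @^-1` A))%E.
Proof.
move=> a0 mA; have [a_gt0|a_le0] := ltP 0 a.
  by rewrite gtr0_norm//; exact: leb_affine_pos.
have a_lt0 : a < 0 by rewrite lt_neqAle a0.
rewrite ltr0_norm//.
have Na0 : 0 < - a by rewrite oppr_gt0.
rewrite (leb_affine_pos c Na0 mA); congr (_ * _)%E.
rewrite -[RHS]lebesgue_measureN.
  by rewrite /pushforward; congr (leb R _); apply/seteqP; split => x /=;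
    rewrite mulrN mulNr.
rewrite -[X in measurable X]setTI; exact: (measurable_affine a c).
Qed.

Lemma leb2_xsection A : leb2 R A = (\int[leb R]_x leb R (xsection A x))%E.
Proof. by []. Qed.

(** Tonelli for sets: the product measure built from the other family of sections agrees on
    rectangles, hence everywhere. *)
Lemma leb2_ysection A : measurable A ->
  leb2 R A = (\int[leb R]_y leb R (ysection A y))%E.
Proof.
move=> mA.
apply: (@product_measure_unique _ _ _ _ R (leb R) (leb R)
  (leb R \x^ leb R)%E) => // X Y mX mY.
by apply: product_measure2E.
Qed.

(** On each horizontal line the map is affine in one variable with slope [a]; the shear only shifts
    it by [t * y]. *)
Lemma leb2_shearx (a t : R) A : a != 0 -> measurable A ->
  leb2 R A = (`|a|%:E * leb2 R ((fun z => (a * z.1 + t * z.2, z.2)%R) @^-1` A))%E.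
Proof.
move=> a0 mA.
have mf : measurable_fun setT
    (fun z : plane2 R => (a * z.1 + t * z.2, z.2) : plane2 R).
  apply: measurable_fun_pair; last exact: measurable_snd.
  apply: measurable_funD; apply: measurable_funM;
    [exact: measurable_cst|exact: measurable_fst|exact: measurable_cst|exact: measurable_snd].
have mfA : measurable ((fun z : plane2 R => (a * z.1 + t * z.2, z.2) : plane2 R) @^-1` A).
  by rewrite -[X in measurable X]setTI; exact: mf.
rewrite !leb2_ysection// -ge0_integralZl//; last exact: measurable_fun_ysection.
apply: eq_integral => y _.
rewrite (leb_affine (t * y) a0); last exact: measurable_ysection.
by congr (_ * leb R _)%E; apply/seteqP; split => x /=; rewrite !ysectionP.
Qed.

Lemma leb2_sheary (a t : R) A : a != 0 -> measurable A ->
  leb2 R A = (`|a|%:E * leb2 R ((fun z => (z.1, t * z.1 + a * z.2)%R) @^-1` A))%E.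
Proof.
move=> a0 mA.
have mf : measurable_fun setT
    (fun z : plane2 R => (z.1, t * z.1 + a * z.2) : plane2 R).
  apply: measurable_fun_pair; first exact: measurable_fst.
  apply: measurable_funD; apply: measurable_funM;
    [exact: measurable_cst|exact: measurable_fst|exact: measurable_cst|exact: measurable_snd].
have mfA : measurable ((fun z : plane2 R => (z.1, t * z.1 + a * z.2) : plane2 R) @^-1` A).
  by rewrite -[X in measurable X]setTI; exact: mf.
rewrite !leb2_xsection// -ge0_integralZl//; last exact: measurable_fun_xsection.
apply: eq_integral => y _.
rewrite (leb_affine (t * y) a0); last exact: measurable_xsection.
by congr (_ * leb R _)%E; apply/seteqP; split => x /=; rewrite !xsectionP addrC.
Qed.

(* Multiplication by [p + iq]. *)
Definition conf (p q : R) (z : R * R) : R * R :=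
  (p * z.1 - q * z.2, q * z.1 + p * z.2).

Lemma measurable_conf p q : measurable_fun setT (conf p q : plane2 R -> plane2 R).
Proof.
apply: measurable_fun_pair.
  apply: measurable_funB; apply: measurable_funM;
    [exact: measurable_cst|exact: measurable_fst|exact: measurable_cst|exact: measurable_snd].
apply: measurable_funD; apply: measurable_funM;
    [exact: measurable_cst|exact: measurable_fst|exact: measurable_cst|exact: measurable_snd].
Qed.

(** Multiplication by [p + iq] is a product of two triangular maps, one along each axis, with
    diagonal entries [p] and [(p^2 + q^2) / p]. The factorisation divides by [p]. *)
Lemma leb2_conf0 p q A : p != 0 -> measurable A ->
  leb2 R A = ((p ^+ 2 + q ^+ 2)%:E * leb2 R (conf p q @^-1` A))%E.
Proof.
move=> p0 mA.
have pq0 : (p ^+ 2 + q ^+ 2) / p != 0.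
  by rewrite mulf_neq0 ?invr_eq0// gt_eqF// ltr_wpDr ?sqr_ge0// exprn_even_gt0.
rewrite (leb2_sheary (q / p) pq0 mA).
rewrite (leb2_shearx (- q) p0); last first.
  rewrite -[X in measurable X]setTI.
  have mf : measurable_fun setT (fun z : plane2 R => (z.1, (q / p) * z.1 + ((p ^+ 2 + q ^+ 2) / p) * z.2) : plane2 R).
    apply: measurable_fun_pair; first exact: measurable_fst.
    apply: measurable_funD; apply: measurable_funM;
    [exact: measurable_cst|exact: measurable_fst|exact: measurable_cst|exact: measurable_snd].
  exact: mf.
have E : `|(p ^+ 2 + q ^+ 2) / p| * `|p| = p ^+ 2 + q ^+ 2.
  by rewrite -normrM divfK// ger0_norm// addr_ge0// sqr_ge0.
rewrite muleA -EFinM [in LHS]E.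
congr (_ * leb2 R _)%E; apply/seteqP; split => -[x y] /=; rewrite /conf/=.
  rewrite (_ : q / p * _ + _ = q * x + p * y) ?mulNr//; by field.
rewrite (_ : q / p * _ + _ = q * x + p * y) ?mulNr//; by field.
Qed.

Lemma leb2_conf p q A : p ^+ 2 + q ^+ 2 != 0 -> measurable A ->
  leb2 R A = ((p ^+ 2 + q ^+ 2)%:E * leb2 R (conf p q @^-1` A))%E.
Proof.
have [->|p0] := eqVneq p 0; last by move=> _; exact: leb2_conf0.
rewrite expr0n add0r sqrf_eq0 => q0 mA.
(* For [p = 0], write [iq = (1 + i) (q / 2 + i q / 2)]: both factors have a nonzero real part. *)
rewrite (@leb2_conf0 1 1) ?oner_eq0//.
rewrite (@leb2_conf0 (q / 2) (q / 2)); last 2 first.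
- by rewrite mulf_neq0// invr_eq0 pnatr_eq0.
- by rewrite -[X in measurable X]setTI; exact: measurable_conf.
rewrite muleA -EFinM; congr (_%:E * leb2 R _)%E; first by field.
by apply/seteqP; split => -[x y] /=; rewrite /conf/=; congr (A (_, _)); field.
Qed.

End Linear.

(** * Comparing two measures on boxes by bisection *)

Section Bisection.
Context {R : realType}.

Lemma half_interval (x0 l x t : R) : 0 < t -> 0 < l -> x0 <= x ->
  x + t * l <= x0 + l ->
  [/\ 0 < t / 2 * l, t * l = t / 2 * l + t / 2 * l, x + t / 2 * l <= x0 + l,
      x0 <= x + t / 2 * l & x + t / 2 * l + t / 2 * l <= x0 + l].
Proof.
move=> t0 l0; have E : t * l = t / 2 * l + t / 2 * l by field.
have : 0 < t / 2 * l by rewrite mulr_gt0// divr_gt0.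
rewrite E; move: (t / 2 * l) => u u0 h1 h2; split; lra.
Qed.

(** [D x y t] plays the excess of one measure over another on the box with corner [(x, y)] and sides
    [t * l], [t * w]. A bound proportional to the area [t^2] is inherited from a box by at least one
    of its four quarters. *)
Lemma bisection (D : R -> R -> R -> R) (x0 y0 l w : R) :
  0 < l -> 0 < w ->
  (forall x y t, 0 < t -> x0 <= x -> x + t * l <= x0 + l ->
     y0 <= y -> y + t * w <= y0 + w ->
     D x y t <= D x y (t / 2) + D (x + t / 2 * l) y (t / 2)
       + D x (y + t / 2 * w) (t / 2) + D (x + t / 2 * l) (y + t / 2 * w) (t / 2)) ->
  (forall a b k, x0 <= a <= x0 + l -> y0 <= b <= y0 + w -> 0 < k ->
     exists2 d, 0 < d & forall x y t, 0 < t < d ->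
       x <= a <= x + t * l -> y <= b <= y + t * w ->
       x0 <= x -> x + t * l <= x0 + l -> y0 <= y -> y + t * w <= y0 + w ->
       D x y t <= k * t ^+ 2) ->
  D x0 y0 1 <= 0.
Proof.
move=> l0 w0 Dsub Dloc; rewrite leNgt; apply/negP => D0.
(* Half of the excess, so that [k * t ^+ 2 < D x y t] is strict for the starting box [t = 1]. *)
pose k := D x0 y0 1 / 2.
have k0 : 0 < k by rewrite divr_gt0.
pose good (s : R * R * R) := [/\ 0 < s.2,
  x0 <= s.1.1 /\ s.1.1 + s.2 * l <= x0 + l,
  y0 <= s.1.2 /\ s.1.2 + s.2 * w <= y0 + w &
  k * s.2 ^+ 2 < D s.1.1 s.1.2 s.2].
pose nest (s s' : R * R * R) := [/\ s'.2 = s.2 / 2,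
  s.1.1 <= s'.1.1 /\ s'.1.1 + s'.2 * l <= s.1.1 + s.2 * l &
  s.1.2 <= s'.1.2 /\ s'.1.2 + s'.2 * w <= s.1.2 + s.2 * w].
have step s : exists s', good s -> good s' /\ nest s s'.
  have [gs|ngs] := pselect (good s); last by exists s.
  case: s gs => [[x y] t] [/= t0 [x0x xl] [y0y yw] kD].
  have := Dsub x y t t0 x0x xl y0y yw.
  set D1 := D x y (t / 2); set D2 := D _ y (t / 2).
  set D3 := D x _ (t / 2); set D4 := D _ _ (t / 2) => DD.
  have t20 : 0 < t / 2 by rewrite divr_gt0.
  have [tl El l1 l2 l3] := half_interval t0 l0 x0x xl.
  have [tw Ew w1 w2 w3] := half_interval t0 w0 y0y yw.
  have : [\/ k * (t / 2) ^+ 2 < D1, k * (t / 2) ^+ 2 < D2,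
             k * (t / 2) ^+ 2 < D3 | k * (t / 2) ^+ 2 < D4].
    have E : k * t ^+ 2 = 4 * (k * (t / 2) ^+ 2) by field.
    have [h1|h1] := ltP (k * (t / 2) ^+ 2) D1; first by apply: Or41.
    have [h2|h2] := ltP (k * (t / 2) ^+ 2) D2; first by apply: Or42.
    have [h3|h3] := ltP (k * (t / 2) ^+ 2) D3; first by apply: Or43.
    apply: Or44; lra.
  case=> kDi;
    [exists (x, y, t / 2)|exists (x + t / 2 * l, y, t / 2)|
     exists (x, y + t / 2 * w, t / 2)|exists (x + t / 2 * l, y + t / 2 * w, t / 2)];
    move=> _; split; split => //=; split; rewrite ?lerDl ?El ?Ew ?addrA ?lerD2l ?lerDl ?(ltW tl) ?(ltW tw) ?lexx //.
have [f Hf] := choice step.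
pose s n := iter n f (x0, y0, 1).
have gs n : good (s n).
  elim: n => [|n IH]; last by have [] := Hf _ IH.
  split => //=; [by rewrite mul1r|by rewrite mul1r|].
  by rewrite expr1n mulr1 /k; lra.
have ns n : nest (s n) (s n.+1) by have [] := Hf _ (gs n).
have t2 n : (s n).2 = 2^-1 ^+ n.
  elim: n => [//|n IH]; have [-> _ _] := ns n.
  by rewrite IH exprSr.
pose u n := (s n).1.1; pose v n := (s n).1.2.
(* Lower ends increase and upper ends decrease, so the supremum of the lower ends lies in every
   interval. Applied to both coordinates, this gives the common point of the nested boxes. *)
have mono (z : nat -> R) (r : R) : 0 <= r -> (forall n, z n <= z n.+1) ->
    (forall n, z n.+1 + (s n.+1).2 * r <= z n + (s n).2 * r) ->
    exists a, forall n, z n <= a <= z n + (s n).2 * r.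
  move=> r0 z1 z2.
  have zm n m : z n <= z (n + m)%N.
    by elim: m => [|m IH]; rewrite ?addn0// addnS (le_trans IH).
  have zM n m : z (n + m)%N + (s (n + m)%N).2 * r <= z n + (s n).2 * r.
    by elim: m => [|m IH]; rewrite ?addn0// addnS (le_trans _ IH).
  have zz n m : z n <= z m + (s m).2 * r.
    have zp i : 0 <= (s i).2 * r by rewrite mulr_ge0// t2 exprn_ge0// invr_ge0.
    have [nm|/ltnW mn] := leqP n m.
      by rewrite -(subnKC nm) (le_trans (zm n (m - n)%N))// lerDl.
    rewrite -(subnKC mn) (le_trans _ (zM m (n - m)%N))// lerDl.
    by rewrite subnKC.
  exists (sup (range z)) => n; apply/andP; split.
    apply: ub_le_sup; last by exists n.
    by exists (z 0%N + (s 0%N).2 * r) => _ [m _ <-].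
  apply: ge_sup; first by exists (z 0%N), 0%N.
  by move=> _ [m _ <-].
have [a aP] := mono u l (ltW l0) (fun n => let: And3 _ (conj h _) _ := ns n in h)
  (fun n => let: And3 _ (conj _ h) _ := ns n in h).
have [b bP] := mono v w (ltW w0) (fun n => let: And3 _ _ (conj h _) := ns n in h)
  (fun n => let: And3 _ _ (conj _ h) := ns n in h).
have := aP 0%N; rewrite /u/= mul1r => a0.
have := bP 0%N; rewrite /v/= mul1r => b0.
have [d d0 dP] := Dloc a b k a0 b0 k0.
have [n nd] : exists n, (2^-1 : R) ^+ n < d.
  have : (fun n => (2^-1 : R) ^+ n) @ \oo --> (0 : R).
    by apply: cvg_expr; rewrite ger0_norm ?invr_ge0// invf_lt1// ltr1n.
  move/cvgrPdist_lt => /(_ _ d0) [n _ /(_ n (leqnn n))].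
  rewrite /= sub0r normrN ger0_norm ?exprn_ge0 ?invr_ge0// => h; by exists n.
have [tn0 [? ?] [? ?]] := gs n.
apply/negP; rewrite -leNgt; apply: dP => //.
- by rewrite tn0 t2.
- exact: aP.
- exact: bP.
Qed.

Lemma box_splitx (m : {measure set (plane2 R) -> \bar R}) (x y l1 l2 w : R) :
  0 <= l1 -> 0 <= l2 ->
  m (box x y (l1 + l2) w) = (m (box x y l1 w) + m (box (x + l1) y l2 w))%E.
Proof.
move=> l10 l20; rewrite -measureU; try exact: measurable_box.
  congr (m _); apply/seteqP; split => -[u v]; rewrite /box /= !in_itv/=.
    move=> [/andP[u1 u2] vI].
    have [u3|u3] := leP u (x + l1).
      by left; split => //; apply/andP; split.
    by right; split => //; apply/andP; split => //; lra.
  by move=> [|] [/andP[u1 u2] vI]; split => //; apply/andP; split; lra.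
rewrite -subset0 => -[u v] []; rewrite /box /= !in_itv/=.
by move=> [/andP[_ u2] _] [/andP[u3 _] _]; lra.
Qed.

Lemma box_splity (m : {measure set (plane2 R) -> \bar R}) (x y l w1 w2 : R) :
  0 <= w1 -> 0 <= w2 ->
  m (box x y l (w1 + w2)) = (m (box x y l w1) + m (box x (y + w1) l w2))%E.
Proof.
move=> w10 w20; rewrite -measureU; try exact: measurable_box.
  congr (m _); apply/seteqP; split => -[u v]; rewrite /box /= !in_itv/=.
    move=> [uI /andP[u1 u2]].
    have [u3|u3] := leP v (y + w1).
      by left; split => //; apply/andP; split.
    by right; split => //; apply/andP; split => //; lra.
  by move=> [|] [uI /andP[u1 u2]]; split => //; apply/andP; split; lra.
rewrite -subset0 => -[u v] []; rewrite /box /= !in_itv/=.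
by move=> [_ /andP[_ u2]] [_ /andP[u3 _]]; lra.
Qed.

(* Halving a box keeps its shape, so nested boxes shrink to a point where the
   local comparison contradicts the assumed excess. *)
Lemma measure_le_box (m1 m2 : {measure set (plane2 R) -> \bar R})
    (x0 y0 l w : R) : 0 < l -> 0 < w ->
  (m1 (box x0 y0 l w) < +oo)%E -> (m2 (box x0 y0 l w) < +oo)%E ->
  (forall a b k, x0 <= a <= x0 + l -> y0 <= b <= y0 + w -> 0 < k ->
     exists2 d, 0 < d & forall x y t, 0 < t < d ->
       x <= a <= x + t * l -> y <= b <= y + t * w ->
       box x y (t * l) (t * w) `<=` box x0 y0 l w ->
       (m1 (box x y (t * l) (t * w)) <=
        m2 (box x y (t * l) (t * w)) + (k * t ^+ 2)%:E)%E) ->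
  (m1 (box x0 y0 l w) <= m2 (box x0 y0 l w))%E.
Proof.
move=> l0 w0 fin1 fin2 loc.
pose B x y t := box x y (t * l) (t * w).
pose D x y t := fine (m1 (B x y t)) - fine (m2 (B x y t)).
pose inside x y t := [/\ 0 < t, x0 <= x, x + t * l <= x0 + l,
     y0 <= y & y + t * w <= y0 + w].
have Bsub x y t : inside x y t -> B x y t `<=` box x0 y0 l w.
  move=> [t0 h1 h2 h3 h4] [u v] [/=]; rewrite !in_itv/= => /andP[u1 u2] /andP[v1 v2].
  split; rewrite /= in_itv/=; apply/andP; split; lra.
have mB x y t : measurable (B x y t) by exact: measurable_box.
have fin (m : {measure set (plane2 R) -> \bar R}) x y t :
    (m (box x0 y0 l w) < +oo)%E -> inside x y t -> m (B x y t) \is a fin_num.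
  move=> mf ins; rewrite ge0_fin_numE// (le_lt_trans _ mf)//.
  by rewrite le_measure// ?inE//; [exact: measurable_box|exact: Bsub].
have add (m : {measure set (plane2 R) -> \bar R}) x y t :
    (m (box x0 y0 l w) < +oo)%E -> inside x y t ->
    fine (m (B x y t)) = fine (m (B x y (t / 2))) + fine (m (B (x + t / 2 * l) y (t / 2)))
     + fine (m (B x (y + t / 2 * w) (t / 2)))
     + fine (m (B (x + t / 2 * l) (y + t / 2 * w) (t / 2))).
  move=> mf [t0 h1 h2 h3 h4].
  have [tl El l1 l2 l3] := half_interval t0 l0 h1 h2.
  have [tw Ew w1 w2 w3] := half_interval t0 w0 h3 h4.
  have t20 : 0 < t / 2 by rewrite divr_gt0.
  have f1 : m (B x y (t / 2)) \is a fin_num by apply: fin.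
  have f2 : m (B (x + t / 2 * l) y (t / 2)) \is a fin_num by apply: fin.
  have f3 : m (B x (y + t / 2 * w) (t / 2)) \is a fin_num by apply: fin.
  have f4 : m (B (x + t / 2 * l) (y + t / 2 * w) (t / 2)) \is a fin_num.
    by apply: fin.
  rewrite {1}/B El Ew box_splity ?ltW// !box_splitx ?ltW//.
  by rewrite !fineD ?fin_numD ?f1 ?f2 ?f3 ?f4// !addrA.
suff : D x0 y0 1 <= 0.
  have := fin m1 x0 y0 1 fin1; have := fin m2 x0 y0 1 fin2.
  rewrite /D /B !mul1r => f2 f1 D0.
  have ins : inside x0 y0 1 by split; rewrite ?mul1r.
  by rewrite -[leLHS]fineK ?f1// -[leRHS]fineK ?f2// lee_fin -subr_le0.
apply: (@bisection D x0 y0 l w) => // [x y t t0 h1 h2 h3 h4|a b k aI bI k0].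
  have ins : inside x y t by split.
  rewrite /D (add m1)// (add m2)//; lra.
have [d d0 dP] := loc a b k aI bI k0; exists d => // x y t tI xI yI h1 h2 h3 h4.
have t0 : 0 < t by case/andP: tI.
have ins : inside x y t by split.
have := dP x y t tI xI yI (Bsub x y t ins).
rewrite -/(B x y t) -[X in (X <= _)%E]fineK ?fin// -[X in (_ <= X + _)%E]fineK ?fin//.
by rewrite -EFinD lee_fin /D lerBlDl.
Qed.
End Bisection.

(** * Images of small boxes under maps close to a similarity *)

Section LocalComparison.
Context {R : realType}.
Implicit Types (A B : set (plane2 R)).

(** Bundling the integral as a measure makes the uniqueness and additivity theorems for measures
    available for it. *)
Lemma measure_of_density (G : plane2 R -> \bar R) :
  measurable_fun setT G -> (forall z, 0 <= G z)%E ->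
  exists m : {measure set (plane2 R) -> \bar R},
    forall A, m A = (\int[leb2 R]_(z in A) G z)%E.
Proof.
move=> mG G0.
pose nu A := (\int[leb2 R]_(z in A) G z)%E.
have nu0 : nu set0 = 0%E by rewrite /nu integral_set0.
have nu_ge0 A : (0 <= nu A)%E by apply: integral_ge0.
have nu_sa : semi_sigma_additive nu.
  move=> F mF tF mUF.
  rewrite /nu ge0_integral_bigcup//; last exact: measurable_funS mG.
  by apply: is_cvg_ereal_nneg_natsum_cond => n _ _; exact: nu_ge0.
pose m : {measure set (plane2 R) -> \bar R} :=
  HB.pack nu (isMeasure.Build _ _ _ nu nu0 nu_ge0 nu_sa).
by exists m.
Qed.

Lemma measure_of_pushforward (m : {measure set (plane2 R) -> \bar R})
    (f : plane2 R -> plane2 R) : measurable_fun setT f ->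
  exists m' : {measure set (plane2 R) -> \bar R},
    forall A, m' A = m (f @^-1` A).
Proof.
move=> mf.
pose F : {mfun plane2 R >-> plane2 R} :=
  HB.pack f (isMeasurableFun.Build _ _ _ _ _ mf).
pose m' := (pushforward m F : {measure set (plane2 R) -> \bar R}).
by exists (m' mf).
Qed.

(** Uniqueness of measures needs a generating family closed under intersection. A rectangle is the
    intersection of two strips, and a strip over a half-open interval is a countable union of
    half-open rectangles. *)
Lemma ocitv_box_sigma : (measurable : set (set (plane2 R))) =
  <<s [set A `*` B | A in @ocitv R & B in @ocitv R] >>.
Proof.
set G := [set A `*` B | A in _ & B in _].
apply/seteqP; split; last first.
  apply: smallest_sub; first exact: sigma_algebra_measurable.
  move=> _ [A [[a b]] _ <- [B [[c d]] _ <- <-]].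
  by apply: measurableX; exact: measurable_itv.
have sG : sigma_algebra setT <<s G >> := smallest_sigma_algebra setT G.
have [sG0 sGC sGU] := sG.
pose I n : set R := `](- n%:R), n%:R]%classic.
have IT : \bigcup_n I n = setT.
  apply/seteqP; split => // x _; exists (Num.bound x) => //.
  by rewrite /I/= in_itv/= ltrNl unstable.ltrNbound ltW ?unstable.ltr_bound.
have sub1 (A : set (measurableTypeR R)) : measurable A -> <<s G >> (A `*` setT).
  move: A; apply: smallest_sub; first split.
  - by rewrite set0X.
  - move=> A /= sA; have -> : (setT `\` A) `*` setT = setT `\` (A `*` setT) :> set (R * R).
      apply/seteqP; split => -[x y] /=; first by move=> [[_ nA] _]; split => // -[].
      by move=> [_ nA]; split => //; split => // Ax; apply: nA.
    exact: sGC.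
  - move=> F sF; rewrite /= setX_bigcupl; exact: sGU.
  - move=> A oA /=; rewrite -IT setX_bigcupr; apply: sGU => n.
    apply: sub_sigma_algebra; exists A => //; exists (I n) => //.
    by exists (- n%:R, n%:R).
have sub2 (A : set (measurableTypeR R)) : measurable A -> <<s G >> (setT `*` A).
  move: A; apply: smallest_sub; first split.
  - by rewrite /= setX0.
  - move=> A /= sA; have -> : setT `*` (setT `\` A) = setT `\` (setT `*` A) :> set (R * R).
      apply/seteqP; split => -[x y] /=; first by move=> [_ [_ nA]]; split => // -[].
      by move=> [_ nA]; split => //; split => // Ax; apply: nA.
    exact: sGC.
  - move=> F sF; rewrite /= setX_bigcupr; exact: sGU.
  - move=> A oA /=; rewrite -IT setX_bigcupl; apply: sGU => n.
    apply: sub_sigma_algebra; exists (I n) => //; last by exists A.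
    by exists (- n%:R, n%:R).
rewrite measurable_prod_measurableType; apply: smallest_sub => //.
move=> _ [A mA [B mB <-]].
have -> : A `*` B = (A `*` setT) `&` (setT `*` B).
  by rewrite -setXI setIT setTI.
pose ST := g_sigma_algebraType G.
have := @measurableI _ ST (A `*` setT) (setT `*` B).
apply; [exact: sub1|exact: sub2].
Qed.

Definition N1 (z : R * R) : R := `|z.1| + `|z.2|.

Lemma near_N1 (P : R * R -> Prop) (a : R * R) : (\forall z \near a, P z) <->
  exists2 d, 0 < d & forall z, N1 (z - a) < d -> P z.
Proof.
split=> [/nbhs_ballP[d /= d0 dP]|[d d0 dP]].
  exists d => // z zd; apply: dP.
  rewrite /N1/= in zd.
  split; rewrite /ball/= distrC; apply: le_lt_trans zd;
  [rewrite lerDl//|rewrite lerDr//].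
apply/nbhs_ballP; exists (d / 2); rewrite /= ?divr_gt0// => z [].
rewrite /ball/= ![`|_ - z.1|]distrC ![`|_ - z.2|]distrC => z1 z2.
by apply: dP; rewrite /N1 [ltRHS](_ : d = d / 2 + d / 2) ?ltrD//; field.
Qed.

Section LocalImage.
Variables (U V : set (R * R)) (h k : R * R -> R * R) (a : R * R) (p q : R).
Hypothesis (hU : forall z, U z -> V (h z)) (kV : forall z, V z -> U (k z)).
Hypothesis (hK : forall z, U z -> k (h z) = z) (kK : forall z, V z -> h (k z) = z).
Let J := p ^+ 2 + q ^+ 2.
Hypothesis J0 : 0 < J.
Let s z := a + conf (p / J) (- q / J) (z - h a).
Let t w := h a + conf p q (w - a).
Hypothesis Hh : forall e, 0 < e -> \forall z \near a, N1 (s (h z) - z) <= e * N1 (z - a).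
Hypothesis Hk : forall e, 0 < e ->
  \forall w \near a, V (t w) /\ N1 (k (t w) - w) <= e * N1 (w - a).

Let ts z : t (s z) = z.
Proof.
rewrite /t /s; case: z (h a) (a) => [z1 z2] [c1 c2] [a1 a2]; rewrite /conf /=.
have := lt0r_neq0 J0; rewrite /J => J1.
by congr (_, _) => /=; field.
Qed.

(** [s] is the inverse of the affine tangent map [t] of [h] at [a]. Closeness of [s \o h] to the
    identity bounds the image from outside. For the inner bound the inverse [k] supplies preimages
    directly: [k z = k (t (s z))] is close to [s z], so it stays in the box. *)
Lemma local_image (l w e : R) : 0 < l -> 0 < w -> 0 < e ->
  exists2 d, 0 < d & forall x y r, 0 < r < d ->
    x <= a.1 <= x + r * l -> y <= a.2 <= y + r * w -> box x y (r * l) (r * w) `<=` U ->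
    h @` box x y (r * l) (r * w) `<=`
      s @^-1` box (x - e * r) (y - e * r) (r * (l + 2 * e)) (r * (w + 2 * e)) /\
    s @^-1` box (x + e * r) (y + e * r) (r * (l - 2 * e)) (r * (w - 2 * e)) `<=`
      h @` box x y (r * l) (r * w).
Proof.
move=> l0 w0 e0.
have lw0 : 0 < l + w by rewrite addr_gt0.
have e'0 : 0 < e / (l + w) by rewrite divr_gt0.
have /near_N1[d1 d10 d1P] := Hh e'0.
have /near_N1[d2 d20 d2P] := Hk e'0.
(* A box of scale [r] around [a] has [N1]-radius at most [r * (l + w)]; with the tolerance
   [e / (l + w)] the displacement is at most [e * r]. *)
exists (Num.min d1 d2 / (l + w)).
  by rewrite divr_gt0// lt_min d10.
move=> x y r /andP[r0 rd] /andP[xa ax] /andP[ya ay] bU.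
have rlw : r * (l + w) < d1 /\ r * (l + w) < d2.
  by move: rd; rewrite ltr_pdivlMr// lt_min => /andP[].
have er : e * r = e / (l + w) * (r * (l + w)) by field; exact: lt0r_neq0.
have er0 : 0 < e * r by rewrite mulr_gt0.
have bound z : box x y (r * l) (r * w) z -> N1 (z - a) <= r * (l + w).
  case: z => z1 z2; rewrite /box/= !in_itv/= => -[/andP[x1 x2] /andP[y1 y2]].
  rewrite /N1/= mulrDr lerD// ler_norml; apply/andP; split; lra.
have coord (z z' : R * R) : N1 (z - z') <= e * r ->
    z'.1 - e * r <= z.1 <= z'.1 + e * r /\ z'.2 - e * r <= z.2 <= z'.2 + e * r.
  rewrite /N1/= => zz.
  have : `|z.1 - z'.1| <= e * r by rewrite (le_trans _ zz)// lerDl.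
  have : `|z.2 - z'.2| <= e * r by rewrite (le_trans _ zz)// lerDr.
  rewrite !ler_norml => /andP[? ?] /andP[? ?].
  split; apply/andP; split; lra.
have El : r * (l + 2 * e) = r * l + e * r + e * r by ring.
have Ew : r * (w + 2 * e) = r * w + e * r + e * r by ring.
have El' : r * (l - 2 * e) = r * l - e * r - e * r by ring.
have Ew' : r * (w - 2 * e) = r * w - e * r - e * r by ring.
rewrite El Ew El' Ew'; move: (r * l) (r * w) => rl rw in bU ax ay bound El Ew El' Ew' *.
split=> [_ [z bz <-]|z].
  have zb := bound z bz.
  have /coord : N1 (s (h z) - z) <= e * r.
    rewrite er (le_trans (d1P _ _))//; first by rewrite (le_lt_trans zb)//; case: rlw.
    by rewrite ler_wpM2l// ltW.
  move: bz; rewrite /box/= !in_itv/=.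
  case: (s (h z)) => s1 s2; case: z {zb} => z1 z2 /=.
  move=> [/andP[x1 x2] /andP[y1 y2]] [/andP[x3 x4] /andP[y3 y4]].
  split; apply/andP; split; lra.
move=> bz.
have bz' : box x y rl rw (s z).
  move: bz; rewrite /box/= !in_itv/=; case: (s z) => s1 s2 /=.
  move=> [/andP[x1 x2] /andP[y1 y2]].
  split; apply/andP; split; lra.
have zb := bound _ bz'.
have [Vz] : V (t (s z)) /\ N1 (k (t (s z)) - s z) <= e / (l + w) * N1 (s z - a).
  by apply: d2P; rewrite (le_lt_trans zb)//; case: rlw.
rewrite ts in Vz * => kz.
have /coord : N1 (k z - s z) <= e * r.
  by rewrite er (le_trans kz)// ler_wpM2l// ltW.
move=> kzs; exists (k z); last exact: kK.
move: bz kzs; rewrite /box/= !in_itv/=.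
case: (k z) => s1 s2; case: (s z) => z1 z2 /=.
move=> [/andP[x1 x2] /andP[y1 y2]] [/andP[x3 x4] /andP[y3 y4]].
split; apply/andP; split; lra.
Qed.

Lemma leb2_translate (v : R * R) A : measurable A ->
  leb2 R ((fun z => (z + v)%R) @^-1` A) = leb2 R A.
Proof.
move=> mA.
have mt (v1 v2 : R) : measurable_fun setT (fun z : plane2 R => (z.1 + v1, z.2 + v2) : plane2 R).
  apply: measurable_fun_pair; apply: measurable_funD;
  [exact: measurable_fst|exact: measurable_cst|exact: measurable_snd|exact: measurable_cst].
have mt' v1 v2 B : measurable B -> measurable ((fun z : plane2 R => (z.1 + v1, z.2 + v2) : plane2 R) @^-1` B).
  by move=> mB; rewrite -[X in measurable X]setTI; exact: mt.
transitivity (leb2 R ((fun z : plane2 R => (z.1 + 0, z.2 + v.2) : plane2 R) @^-1` A)).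
  rewrite !leb2_ysection; last 2 first.
  - exact: mt'.
  - by have := mt' v.1 v.2 _ mA.
  apply: eq_integral => y _.
  set B := ysection A (y + v.2) : set (measurableTypeR R).
  have mB : measurable B by exact: measurable_ysection.
  transitivity (leb R B); last first.
    by congr (leb R _); apply/seteqP; split => x; rewrite /B !ysectionP/= addr0.
  rewrite (leb_affine v.1 (oner_neq0 R) mB) normr1 mul1e.
  by congr (leb R _); apply/seteqP; split => x; rewrite /B /preimage/= !ysectionP/= mul1r.
rewrite !leb2_xsection.
apply: eq_integral => x _.
have mB : measurable (xsection A x : set (measurableTypeR R)) by exact: measurable_xsection.
rewrite (leb_affine v.2 (oner_neq0 R) mB) normr1 mul1e.
by congr (leb R _); apply/seteqP; split => y; rewrite /preimage/= !xsectionP/= mul1r addr0.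
Qed.

(** [s] is a similarity with area factor [J^-1], up to translations. *)
Lemma leb2_preimage_s A : measurable A -> measurable (s @^-1` A) /\
  leb2 R (s @^-1` A) = (J%:E * leb2 R A)%E.
Proof.
move=> mA.
have mt (v : R * R) : measurable_fun setT (fun z : plane2 R => (z + v)%R : plane2 R).
  apply: measurable_fun_pair; apply: measurable_funD;
  [exact: measurable_fst|exact: measurable_cst|exact: measurable_snd|exact: measurable_cst].
have mt' v B : measurable B -> measurable ((fun z : plane2 R => (z + v)%R : plane2 R) @^-1` B).
  by move=> mB; rewrite -[X in measurable X]setTI; exact: mt.
have mA1 : measurable ((fun z : plane2 R => (z + a)%R : plane2 R) @^-1` A) by exact: mt'.
have mA2 : measurable (conf (p / J) (- q / J) @^-1` ((fun z : plane2 R => (z + a)%R : plane2 R) @^-1` A)).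
  by rewrite -[X in measurable X]setTI; exact: measurable_conf.
have -> : s @^-1` A = (fun z => (z + (- h a))%R) @^-1`
    (conf (p / J) (- q / J) @^-1` ((fun z => (z + a)%R) @^-1` A)).
  by apply/seteqP; split => z /=; rewrite /s addrC.
have E : (p / J) ^+ 2 + (- q / J) ^+ 2 = J^-1.
  by have := lt0r_neq0 J0; rewrite /J => J1; field.
split; first exact: mt'.
rewrite leb2_translate// -(leb2_translate a mA).
rewrite (@leb2_conf _ (p / J) (- q / J) ((fun z => (z + a)%R) @^-1` A))//; last first.
  by rewrite E invr_eq0 lt0r_neq0.
by rewrite E muleA -EFinM divff ?mul1e// lt0r_neq0.
Qed.
End LocalImage.
End LocalComparison.

Section LocalDensity.
Context {R : realType}.
Implicit Types (A B : set (plane2 R)).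

(* [h] and its inverse [k] are differentiable at [a] and [h a], with
   derivatives the multiplication by [p + iq] and its inverse. *)
Definition conf_tangent (V : set (R * R)) (h k : R * R -> R * R) (a : R * R)
    (p q : R) : Prop :=
  [/\ 0 < p ^+ 2 + q ^+ 2,
    forall e, 0 < e -> \forall z \near a,
      N1 (a + conf (p / (p ^+ 2 + q ^+ 2)) (- q / (p ^+ 2 + q ^+ 2)) (h z - h a) - z)
        <= e * N1 (z - a) &
    forall e, 0 < e -> \forall w \near a,
      let t := h a + conf p q (w - a) in V t /\ N1 (k t - w) <= e * N1 (w - a)].

(** By [local_image] the image of a small box lies between two boxes transported by the tangent
    similarity, whose areas carry the factor [p^2 + q^2], and [F \o h] is almost constant there. *)
Lemma local_density (U V : set (R * R)) (h k : R * R -> R * R) (F : R * R -> R)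
    (a : R * R) (p q l w : R) :
  (forall z, U z -> V (h z)) -> (forall z, V z -> h (k z) = z) ->
  conf_tangent V h k a p q ->
  (forall B, measurable B -> B `<=` U -> measurable (h @` B : set (plane2 R))) ->
  {for a, continuous (F \o h)} ->
  (forall z, V z -> 0 <= F z) ->
  measurable (V : set (plane2 R)) -> measurable_fun (V : set (plane2 R)) F ->
  U a -> 0 < l -> 0 < w -> forall e, 0 < e -> exists2 d, 0 < d &
  forall x y r, 0 < r < d -> x <= a.1 <= x + r * l -> y <= a.2 <= y + r * w ->
    box x y (r * l) (r * w) `<=` U ->
    (((F (h a) * (p ^+ 2 + q ^+ 2) * l * w - e) * r ^+ 2)%:E <=
     \int[leb2 R]_(z in h @` box x y (r * l) (r * w)) (F z)%:E <=
     ((F (h a) * (p ^+ 2 + q ^+ 2) * l * w + e) * r ^+ 2)%:E)%E.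
Proof.
move=> hU kK [J0 Hh Hk] mh Fc F0 mV mF Ua l0 w0 e e0.
set J := p ^+ 2 + q ^+ 2 in J0 Hh Hk *; set c := F (h a).
have c0 : 0 <= c by apply: F0; exact: hU.
(* A single [u] bounds the oscillation of [F \o h] and the widening of the box. Both error bounds
   hold at [u = 0] with slack [e], hence for small positive [u] by continuity. *)
have [u [u0 ul uw uP1 uP2]] : exists u, [/\ 0 < u, 2 * u < l, 2 * u < w,
    (c + u) * (J * ((l + 2 * u) * (w + 2 * u))) <= c * J * l * w + e &
    c * J * l * w - e <= (c - u) * (J * ((l - 2 * u) * (w - 2 * u)))].
  have cD (b d : R) : (fun u : R => b + d * u) @ (0:R) --> b + d * 0.
    by apply: cvgD; [exact: cvg_cst|apply: cvgM; [exact: cvg_cst|exact: cvg_id]].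
  have cP (s : R) : (fun u : R => (c + s * u) * (J * ((l + (s * 2) * u) * (w + (s * 2) * u))))
      @ (0:R) --> (c + s * 0) * (J * ((l + (s * 2) * 0) * (w + (s * 2) * 0))).
    apply: cvgM; first exact: cD.
    apply: cvgM; [exact: cvg_cst|].
    by apply: cvgM; exact: cD.
  have : \forall u \near (0:R)^'+, [/\ 0 < u, 2 * u < l, 2 * u < w,
    (c + u) * (J * ((l + 2 * u) * (w + 2 * u))) <= c * J * l * w + e &
    c * J * l * w - e <= (c - u) * (J * ((l - 2 * u) * (w - 2 * u)))].
    have /cvgrPdist_le/(_ e e0) h1 := cP 1.
    have /cvgrPdist_le/(_ e e0) h2 := cP (- 1).
    near=> u; split.
    - by [].
    - rewrite mulrC -ltr_pdivlMr//; near: u; apply: nbhs_right_lt; exact: divr_gt0.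
    - rewrite mulrC -ltr_pdivlMr//; near: u; apply: nbhs_right_lt; exact: divr_gt0.
    - have : `|(c + 1 * 0) * (J * ((l + (1 * 2) * 0) * (w + (1 * 2) * 0))) -
         (c + 1 * u) * (J * ((l + (1 * 2) * u) * (w + (1 * 2) * u)))| <= e.
        by near: u; exact: cvg_at_right_filter h1.
      rewrite !(mul1r, mulr0, addr0) ler_norml => /andP[+ _]; lra.
    - have : `|(c + -1 * 0) * (J * ((l + (-1 * 2) * 0) * (w + (-1 * 2) * 0))) -
         (c + -1 * u) * (J * ((l + (-1 * 2) * u) * (w + (-1 * 2) * u)))| <= e.
        by near: u; exact: cvg_at_right_filter h2.
      rewrite !(mul1r, mulr0, addr0, mulN1r, mulNr) ler_norml => /andP[_]; lra.
  by move=> /filter_ex.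
have [d1 d10 d1P] := @local_image _ U V h k a p q kK J0 Hh Hk l w u l0 w0 u0.
have /near_N1[d2 d20 d2P] : \forall z \near a, `|F (h z) - c| <= u.
  move/cvgrPdist_le : Fc => /(_ _ u0); apply: filterS => z /=.
  by rewrite distrC.
have lw0 : 0 < l + w by rewrite addr_gt0.
exists (Num.min d1 (d2 / (l + w))); first by rewrite lt_min d10 divr_gt0.
move=> x y r /andP[r0]; rewrite lt_min => /andP[rd1 rd2] xa ya bU.
set B := box _ _ _ _ in bU *.
have mB : measurable B by exact: measurable_box.
have mhB : measurable (h @` B : set (plane2 R)) by exact: mh.
have hBV : h @` B `<=` V by move=> _ [z Bz <-]; apply: hU; exact: bU.
have Fb z : (h @` B) z -> c - u <= F z <= c + u.
  move=> [z' Bz <-]; have : `|F (h z') - c| <= u.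
    apply: d2P; move: rd2; rewrite ltr_pdivlMr//; apply: le_lt_trans.
    move: Bz xa ya; rewrite /B /box/= !in_itv/= /N1; case: z' => z1 z2 /=.
    move=> [/andP[x1 x2] /andP[y1 y2]] /andP[xa ax] /andP[ya ay].
    rewrite mulrDr lerD// ler_norml; apply/andP; split; lra.
  by rewrite ler_norml => /andP[? ?]; apply/andP; split; lra.
have mFB : measurable_fun (h @` B) (EFin \o F).
  by apply/measurable_EFinP; exact: (measurable_funS mV hBV mF).
have [sub1 sub2] := d1P x y r (introT andP (conj r0 rd1)) xa ya bU.
have rr : 0 <= r ^+ 2 by exact: sqr_ge0.
have l2u : 0 < l - 2 * u by rewrite subr_gt0.
have w2u : 0 < w - 2 * u by rewrite subr_gt0.
set s := fun z => _ in sub1 sub2.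
apply/andP; split.
  (* If [c <= u], the constant [c - u] is not a positive minorant, but then the claimed lower bound
     is nonpositive and the integral of [F] is not. *)
  have [cu|cu] := leP c u.
    apply: (@le_trans _ _ 0%E).
      rewrite lee_fin mulr_le0_ge0// (le_trans uP2)// mulr_le0_ge0 ?subr_le0//.
      by rewrite !mulr_ge0// ltW.
    by apply: integral_ge0 => z /hBV Vz; rewrite lee_fin F0.
  apply: (@le_trans _ _ (\int[leb2 R]_(z in h @` B) (c - u)%:E)%E); last first.
    apply: ge0_le_integral => //.
    - by move=> z _; rewrite lee_fin subr_ge0 ltW.
    - by move=> z /Fb /andP[h1 _]; rewrite lee_fin.
  rewrite integral_cst//.
  have [ms E] := leb2_preimage_s h a J0
    (measurable_box (x + u * r) (y + u * r) (r * (l - 2 * u)) (r * (w - 2 * u))).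
  rewrite leb2_box ?mulr_ge0 ?ltW// in E.
  have h1 := le_measure (leb2 R) (mem_set ms) (mem_set mhB) sub2.
  have h2 : ((J * (r * (l - 2 * u) * (r * (w - 2 * u))))%:E <= leb2 R (h @` B))%E.
    apply: le_trans h1; rewrite le_eqVlt; apply/orP; left; apply/eqP.
    by rewrite EFinM; exact: (esym E).
  apply: le_trans (lee_wpmul2l _ h2); last by rewrite lee_fin subr_ge0 ltW.
  rewrite -!EFinM lee_fin.
  apply: le_trans (ler_wpM2r rr uP2) _.
  rewrite le_eqVlt; apply/orP; left; apply/eqP; rewrite -/J; ring.
apply: (@le_trans _ _ (\int[leb2 R]_(z in h @` B) (c + u)%:E)%E).
  apply: ge0_le_integral => //.
  - by move=> z /hBV Vz; rewrite lee_fin F0.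
  - by move=> z /Fb /andP[_ h1]; rewrite lee_fin.
rewrite integral_cst//.
have [ms E] := leb2_preimage_s h a J0
  (measurable_box (x - u * r) (y - u * r) (r * (l + 2 * u)) (r * (w + 2 * u))).
rewrite leb2_box ?mulr_ge0 ?addr_ge0 ?mulr_ge0 ?(ltW l0) ?(ltW w0) ?(ltW u0) ?(ltW r0)// in E.
have h1 := le_measure (leb2 R) (mem_set mhB) (mem_set ms) sub1.
have h2 : (leb2 R (h @` B) <= (J * (r * (l + 2 * u) * (r * (w + 2 * u))))%:E)%E.
  apply: (le_trans h1); rewrite le_eqVlt; apply/orP; left; apply/eqP.
  by rewrite EFinM; exact: E.
apply: (le_trans (lee_wpmul2l _ h2)); first by rewrite lee_fin addr_ge0// ltW.
rewrite -!EFinM lee_fin.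
apply: le_trans (ler_wpM2r rr uP1).
rewrite le_eqVlt; apply/orP; left; apply/eqP; rewrite -/J; ring.
Unshelve. all: by end_near.
Qed.

End LocalDensity.

(** * From boxes to all Borel subsets of an open set *)

Section BoxCover.
Context {R : realType}.
Implicit Types (A B : set (plane2 R)).

Lemma local_box_cover (U : set (R * R)) : open U ->
  exists x y l w : nat -> R,
    (forall n, 0 < l n /\ 0 < w n) /\
    (forall z, U z -> exists n, box (x n) (y n) (l n) (w n) z /\
      forall u v, x n <= u <= x n + l n -> y n <= v <= y n + w n -> U (u, v)).
Proof.
move=> oU.
pose Q n : rat * rat * rat * rat := odflt (0, 0, 0, 0) (unpickle n).
(* Nonpositive sides, including the default of [unpickle], are replaced by 1, so that every index
   names a genuine box. *)
pose side (r : rat) : R := if (0 < r)%R then ratr r else 1.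
have side0 r : 0 < side r by rewrite /side; case: ifP => // r0; rewrite ltr0q.
exists (fun n => ratr (Q n).1.1.1), (fun n => ratr (Q n).1.1.2),
  (fun n => side (Q n).1.2), (fun n => side (Q n).2); split => // -[z1 z2] Uz.
have /near_N1[d d0 dP] : \forall z \near (z1, z2), U z by exact: open_nbhs_nbhs.
have d8 : 0 < d / 8 by rewrite divr_gt0.
(* A corner within [d / 8] below the point and a side between [d / 8] and [d / 4]: the box contains
   the point, and its closure stays within [d / 4] in each coordinate. *)
have [a aI] : exists a : rat, ratr a \in `]z1 - d / 8, z1[.
  by apply: rat_in_itvoo; rewrite ltrBlDr ltrDl.
have [b bI] : exists a : rat, ratr a \in `]z2 - d / 8, z2[.
  by apply: rat_in_itvoo; rewrite ltrBlDr ltrDl.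
have [c cI] : exists a : rat, ratr a \in `]d / 8, d / 4[.
  by apply: rat_in_itvoo; lra.
move: aI bI cI; rewrite !in_itv/= => /andP[a1 a2] /andP[b1 b2] /andP[c1 c2].
have c0 : (0 < c)%R by rewrite -(ltr0q R) (lt_trans d8).
exists (pickle (a, b, c, c)); rewrite /Q pickleK/= /side c0; split.
  by rewrite /box/= !in_itv/=; split; apply/andP; split; lra.
move=> u v /andP[u1 u2] /andP[v1 v2]; apply: dP; rewrite /N1/=.
have h1 : `|u - z1| <= d / 4 by rewrite ler_norml; apply/andP; split; lra.
have h2 : `|v - z2| <= d / 4 by rewrite ler_norml; apply/andP; split; lra.
apply: le_lt_trans (lerD h1 h2) _; lra.
Qed.

(** Inside one box contained in [U] the measures are finite and uniqueness applies to their
    restrictions; a general set is cut into countably many disjoint parts of such boxes. *)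
Lemma measure_eq_on_open (m1 m2 : {measure set (plane2 R) -> \bar R})
    (U : set (R * R)) : open U ->
  (forall x y l w, 0 < l -> 0 < w ->
    (forall u v, x <= u <= x + l -> y <= v <= y + w -> U (u, v)) ->
    (m1 (box x y l w) < +oo)%E /\ m1 (box x y l w) = m2 (box x y l w)) ->
  forall B, measurable B -> B `<=` U -> m1 B = m2 B.
Proof.
move=> oU eqbox.
have eq1 x y l w : 0 < l -> 0 < w ->
    (forall u v, x <= u <= x + l -> y <= v <= y + w -> U (u, v)) ->
    forall B, measurable B -> m1 (B `&` box x y l w) = m2 (B `&` box x y l w).
  move=> l0 w0 bU B mB.
  have mb := measurable_box x y l w.
  have [fin1 _] := eqbox x y l w l0 w0 bU.
  pose G : set (set (plane2 R)) := [set A `*` B | A in @ocitv R & B in @ocitv R].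
  pose g n : set (plane2 R) := `]-n%:R, n%:R]%classic `*` `]-n%:R, n%:R]%classic.
  apply: (measure_unique G g ocitv_box_sigma _ _ _ (mrestr m1 mb) (mrestr m2 mb) _ _ B mB).
  - move=> _ _ [A1 oA1 [B1 oB1 <-]] [A2 oA2 [B2 oB2 <-]].
    rewrite -setXI; exists (A1 `&` A2); first exact: ocitvI.
    by exists (B1 `&` B2) => //; exact: ocitvI.
  - move=> n.
    have oI : ocitv (`]-n%:R, n%:R]%classic : set R) by exists (- n%:R, n%:R).
    by exists `]-n%:R, n%:R]%classic => //; exists `]-n%:R, n%:R]%classic.
  - apply/seteqP; split => // -[u v] _.
    exists (maxn (Num.bound u) (Num.bound v)) => //; rewrite /g/= !in_itv/=.
    have hu := @unstable.ltr_norm_bound R u; have hv := @unstable.ltr_norm_bound R v.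
    have hu' : `|u| < (maxn (Num.bound u) (Num.bound v))%:R.
      by rewrite (lt_le_trans hu)// ler_nat leq_maxl.
    have hv' : `|v| < (maxn (Num.bound u) (Num.bound v))%:R.
      by rewrite (lt_le_trans hv)// ler_nat leq_maxr.
    move: hu' hv'; rewrite !ltr_norml => /andP[-> h1] /andP[-> h2].
    by rewrite !ltW.
  - move=> _ [_ [[a b] _ <-] [_ [[c d] _ <-] <-]] /=; rewrite /mrestr.
    (* A generator meets the box in another half-open box or not at all, so the hypothesis on boxes
       in [U] decides the equality on generators. *)
    pose a' := Num.max a x; pose b' := Num.min b (x + l).
    pose c' := Num.max c y; pose d' := Num.min d (y + w).
    have -> : `]a, b]%classic `*` `]c, d]%classic `&` box x y l w =
        `]a', b']%classic `*` `]c', d']%classic.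
      apply/seteqP; split => -[u v]; rewrite /box/= !in_itv/= !gt_max !le_min.
        by move=> [[/andP[-> ->] /andP[-> ->]] [/andP[-> ->] /andP[-> ->]]].
      by move=> [/andP[/andP[-> ->] /andP[-> ->]] /andP[/andP[-> ->] /andP[-> ->]]].
    have [ab|ab] := ltP a' b'; last first.
      by rewrite set_itv_ge ?bnd_simp -?leNgt// set0X !measure0.
    have [cd|cd] := ltP c' d'; last first.
      by rewrite (@set_itv_ge _ _ (BRight c')) ?bnd_simp -?leNgt// setX0 !measure0.
    have -> : `]a', b']%classic `*` `]c', d']%classic = box a' c' (b' - a') (d' - c').
      by rewrite /box !subrKC.
    have [] := eqbox a' c' (b' - a') (d' - c'); rewrite ?subr_gt0// !subrKC.
    move=> u v /andP[u1 u2] /andP[v1 v2]; apply: bU.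
      move: u1 u2; rewrite /a' /b' ge_max le_min => /andP[_ ->] /andP[_ ->] //.
    by move: v1 v2; rewrite /c' /d' ge_max le_min => /andP[_ ->] /andP[_ ->].
  - move=> n; rewrite /mrestr; apply: le_lt_trans fin1; apply: le_measure.
    + rewrite inE; apply: measurableI => //; apply: measurableX; exact: measurable_itv.
    + by rewrite inE.
    + by [].
move=> B mB BU.
have [x [y [l [w [lw xyP]]]]] := local_box_cover oU.
(* Boxes of the enumeration that leave [U] are replaced by the empty set. *)
pose inU n := `[< forall u v, x n <= u <= x n + l n -> y n <= v <= y n + w n -> U (u, v) >].
pose C n : set (plane2 R) := if inU n then box (x n) (y n) (l n) (w n) else set0.
have mC n : measurable (C n).
  by rewrite /C; case: ifP => // _; exact: measurable_box.
pose D n := B `&` seqDU C n.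
have mD n : measurable (D n).
  by apply: measurableI => //; apply: measurableD => //; exact: bigsetU_measurable.
have -> : B = \bigcup_n D n.
  rewrite /D -setI_bigcupr -seqDU_bigcup_eq; apply/esym/setIidl => z Bz.
  have [n [bz nU]] := xyP z (BU z Bz); exists n => //.
  by rewrite /C /inU; case: asboolP.
have tD : trivIset setT D by apply: trivIset_setIl; exact: trivIset_seqDU.
rewrite !measure_bigcup//; apply: eq_eseriesr => n _.
rewrite /D; have [Un|Un] := boolP (inU n); last first.
  rewrite (_ : seqDU C n = set0); first by rewrite setI0 !measure0.
  by rewrite /seqDU/= /C (negbTE Un) set0D.
have -> : B `&` seqDU C n = (B `&` seqDU C n) `&` box (x n) (y n) (l n) (w n).
  by apply/esym/setIidl => z [_ [+ _]]; rewrite /C Un.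
by have [l0 w0] := lw n; apply: (eq1 _ _ _ _ l0 w0 (asboolW Un)); exact: mD.
Qed.

End BoxCover.

(** * Conformal change of variables for nonnegative integrands *)

Section ChangeOfVariables.
Context {R : realType}.
Implicit Types (A B : set (plane2 R)).

Lemma continuous_measurable2 (O : set (R * R)) (f : R * R -> R) : open O ->
  (forall x, O x -> {for x, continuous f}) ->
  measurable_fun (O : set (plane2 R)) f.
Proof.
move=> oO fc; apply: (measurability _ (RGenOInfty.measurableE R)) => //.
move=> _ [_ [a ->] <-]; apply: open_measurable2.
rewrite openE => z [Oz fz].
apply: filterI; first exact: open_nbhs_nbhs.
by apply: (fc z Oz); apply: open_nbhs_nbhs; split => //; exact: interval_open.
Qed.

(** A chart transition is controlled only on an open set; set to zero elsewhere it becomes a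
    measurable map of the whole plane, along which measures can be pushed forward. *)
Lemma measurable_patch2 (O : set (R * R)) (f : R * R -> R * R) : open O ->
  (forall x, O x -> {for x, continuous f}) ->
  measurable_fun setT
    ((fun z => (((fst \o f) \_ O) z, ((snd \o f) \_ O) z)) : plane2 R -> plane2 R).
Proof.
move=> oO fc.
have mO : measurable (O : set (plane2 R)) by exact: open_measurable2.
have pm (g : R * R -> R) : continuous g ->
    measurable_fun setT ((g \o f : plane2 R -> R) \_ O).
  move=> gc; suff h : measurable_fun (O : set (plane2 R)) (g \o f).
    exact: (measurable_restrictT _ mO).1 h.
  apply: continuous_measurable2 => // x Ox.
  by apply: continuous_comp; [exact: fc|exact: gc].
apply: measurable_fun_pair; apply: pm => z; [exact: cvg_fst|exact: cvg_snd].
Qed.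

Lemma bounded_on_box (f : R * R -> R) (x y l w : R) : 0 < l -> 0 < w ->
  (forall u v, x <= u <= x + l -> y <= v <= y + w -> {for (u, v), continuous f}) ->
  exists M, 0 < M /\ forall z, box x y l w z -> `|f z| <= M.
Proof.
move=> l0 w0 fc.
pose K : set (R * R) := `[x, x + l]%classic `*` `[y, y + w]%classic.
have cK : compact K by apply: compact_setX; exact: segment_compact.
have K0 : K !=set0.
  by exists (x, y); rewrite /K/= !in_itv/= !lexx !lerDl !ltW.
have gc : {within K, continuous (fun z => `|f z|)}.
  apply: continuous_in_subspaceT => -[u v]; rewrite inE /K/= !in_itv/= => -[uI vI].
  by apply: continuous_comp; [exact: fc|exact: norm_continuous].
have [c Kc cM] := compact_EVT_max K0 cK gc.
exists (`|f c| + 1); split; first by rewrite ltr_wpDl.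
move=> [u v]; rewrite /box/= !in_itv/= => -[/andP[u1 u2] /andP[v1 v2]].
apply: le_trans (_ : `|f c| <= _); last by rewrite lerDl.
by apply: cM; rewrite inE /K/= !in_itv/= (ltW u1) (ltW v1) u2 v2.
Qed.

(** With the identity as [h], [local_density] also estimates the integral of the transformed density
    over a small box, so both sides of the formula are treated by one lemma. *)
Lemma conf_tangent_id (U : set (R * R)) a : open U -> U a ->
  conf_tangent U id id a 1 0.
Proof.
move=> oU Ua; have E : (1 : R) ^+ 2 + 0 ^+ 2 = 1 by rewrite expr1n expr0n addr0.
split; rewrite ?E//= => e e0.
- apply/near_N1; exists 1 => // z _; rewrite /N1 /conf/= divr1 oppr0 mul0r !mul1r !mul0r subr0 add0r.
  by rewrite !subrKC !subrr normr0 addr0 mulr_ge0 ?addr_ge0 ?(ltW e0) ?normr_ge0 //.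
- have : \forall w \near a, U w by exact: open_nbhs_nbhs.
  apply: filterS => w Uw.
  have -> : a + conf 1 0 (w - a) = w.
    case: w a {Ua Uw} => [w1 w2] [a1 a2]; rewrite /conf/=.
    by congr (_, _) => /=; ring.
  split => //; rewrite subrr /N1/= normr0 addr0 mulr_ge0 ?addr_ge0 ?(ltW e0) ?normr_ge0 //.
Qed.

(** Both sides are measures in [B] with the same local density [F (h z) * (p z ^+ 2 + q z ^+ 2)] on
    small boxes; comparison by bisection in both directions makes them equal on boxes, hence on
    Borel sets. *)
Theorem conformal_change_of_variables (U V : set (R * R)) (h k : R * R -> R * R)
    (p q F : R * R -> R) : open U -> open V ->
  (forall z, U z -> V (h z)) -> (forall z, V z -> U (k z)) ->
  (forall z, U z -> k (h z) = z) -> (forall z, V z -> h (k z) = z) ->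
  (forall z, U z -> conf_tangent V h k z (p z) (q z)) ->
  (forall z, U z -> {for z, continuous h}) ->
  (forall z, V z -> {for z, continuous k}) ->
  (forall z, U z -> {for z, continuous (fun z => p z ^+ 2 + q z ^+ 2)}) ->
  (forall z, V z -> {for z, continuous F}) ->
  (forall z, V z -> 0 <= F z) ->
  forall B, measurable B -> B `<=` U ->
  (\int[leb2 R]_(z in h @` B) (F z)%:E =
   \int[leb2 R]_(z in B) (F (h z) * (p z ^+ 2 + q z ^+ 2))%:E)%E.
Proof.
move=> oU oV hU kV hK kK hk hc kc Jc Fc F0.
pose G z := F (h z) * (p z ^+ 2 + q z ^+ 2).
have Gc z : U z -> {for z, continuous G}.
  move=> Uz; apply: cvgM; last exact: Jc.
  by apply: continuous_comp; [exact: hc|apply: Fc; exact: hU].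
have G0 z : U z -> 0 <= G z.
  move=> Uz; apply: mulr_ge0; first by apply: F0; exact: hU.
  by apply: addr_ge0; exact: sqr_ge0.
have mU : measurable (U : set (plane2 R)) by exact: open_measurable2.
have mV : measurable (V : set (plane2 R)) by exact: open_measurable2.
have mF : measurable_fun (V : set (plane2 R)) F by exact: continuous_measurable2.
have mG : measurable_fun (U : set (plane2 R)) G by exact: continuous_measurable2.
have ext (O : set (plane2 R)) (f : plane2 R -> R) : measurable O ->
    measurable_fun O f -> (forall z, O z -> 0 <= f z) ->
    exists m : {measure set (plane2 R) -> \bar R},
      forall A, m A = (\int[leb2 R]_(z in A `&` O) (f z)%:E)%E.
  move=> mO mf f0.
  have [||m mE] := @measure_of_density R ((EFin \o f) \_ O).
  - suff H : measurable_fun O (EFin \o f) by exact: (measurable_restrictT _ mO).1 H.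
    exact/measurable_EFinP.
  - by move=> z; rewrite /patch; case: ifP => //; rewrite inE lee_fin => /f0.
  by exists m => A; rewrite mE -integral_mkcondr.
have [m1' m1'E] := ext V F mV mF F0.
have [m2 m2E] := ext U G mU mG G0.
have mk := measurable_patch2 oV kc; set k' := fun z => _ in mk.
have [m1 m1E'] := measure_of_pushforward m1' mk.
(* Images under [h] are preimages under the patched inverse. This gives their measurability and
   presents the left side as a pushforward. *)
have pre B : B `<=` U -> k' @^-1` B `&` V = h @` B.
  move=> BU; apply/seteqP; split => [z []|_ [z Bz <-]].
    rewrite /k'/patch/= => + Vz; rewrite mem_set// -surjective_pairing => Bk.
    by exists (k z) => //; exact: kK.
  split; last by apply: hU; exact: BU.
  rewrite /k'/patch/= mem_set; last by apply: hU; exact: BU.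
  by rewrite -surjective_pairing hK//; exact: BU.
have mh B : measurable B -> B `<=` U -> measurable (h @` B : set (plane2 R)).
  move=> mB BU; rewrite -pre//; apply: measurableI => //.
  by rewrite -[X in measurable X]setTI; exact: mk.
have m1E B : B `<=` U -> m1 B = (\int[leb2 R]_(z in h @` B) (F z)%:E)%E.
  by move=> BU; rewrite m1E' m1'E pre.
have m2E' B : B `<=` U -> m2 B = (\int[leb2 R]_(z in B) (G z)%:E)%E.
  by move=> BU; rewrite m2E setIidl.
suff eqU : forall B, measurable B -> B `<=` U -> m1 B = m2 B.
  by move=> B mB BU; rewrite -m1E// eqU// m2E'.
apply: measure_eq_on_open => // x y l w l0 w0 KU.
set Q := box x y l w.
have mQ : measurable Q by exact: measurable_box.
have QU : Q `<=` U.
  move=> [u v]; rewrite /Q /box/= !in_itv/= => -[/andP[u1 u2] /andP[v1 v2]].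
  by apply: KU; apply/andP; split => //; exact: ltW.
have bnd (m : R) (f : plane2 R -> R) A : measurable A -> measurable_fun A f ->
    (forall z, A z -> 0 <= f z <= m) -> (leb2 R A < +oo)%E ->
    (\int[leb2 R]_(z in A) (f z)%:E < +oo)%E.
  move=> mA mf fm Aoo.
  apply: le_lt_trans (_ : \int[leb2 R]_(z in A) m%:E < _)%E.
    apply: ge0_le_integral => //.
    - by move=> z /fm /andP[? _]; rewrite lee_fin.
    - exact/measurable_EFinP.
    - by move=> z /fm /andP[_ ?]; rewrite lee_fin.
  rewrite integral_cst//; case: (leP 0 m) => m0; first by rewrite lte_mul_pinfty.
  apply: le_lt_trans (_ : 0 < _)%E => //; apply: mule_le0_ge0 => //.
  by rewrite lee_fin ltW.
have Qoo : (leb2 R Q < +oo)%E by rewrite leb2_box ?ltW// ltry.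
have [MG [MG0 MGP]] : exists M, 0 < M /\ forall z, Q z -> `|G z| <= M.
  by apply: bounded_on_box => // u v uI vI; apply: Gc; exact: KU.
have [MF [MF0 MFP]] : exists M, 0 < M /\ forall z, Q z -> `|F (h z)| <= M.
  apply: (@bounded_on_box (F \o h)) => // u v uI vI.
  by apply: continuous_comp; [apply: hc|apply: Fc; apply: hU]; exact: KU.
have bc (g : R * R -> R) : continuous g ->
    exists M, 0 < M /\ forall z, Q z -> `|g (h z)| <= M.
  move=> gc; apply: (@bounded_on_box (g \o h) x y l w l0 w0) => u v uI vI.
  by apply: continuous_comp; [apply: hc; exact: KU|exact: gc].
have [M1 [M10 M1P]] := bc fst (fun z => cvg_fst).
have [M2 [M20 M2P]] := bc snd (fun z => cvg_snd).
(* The image of the box is bounded because [h] is continuous on the closed box; the finiteness of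
   the first measure follows. *)
have hQoo : (leb2 R (h @` Q) < +oo)%E.
  apply: (@le_lt_trans _ _ (leb2 R (box (- M1 - 1) (- M2 - 1) (M1 + M1 + 1) (M2 + M2 + 1)))).
    apply: le_measure; rewrite ?inE; [exact: mh|exact: measurable_box|].
    move=> _ [z Qz <-]; move: (M1P z Qz) (M2P z Qz).
    rewrite !ler_norml /box/= !in_itv/= => /andP[? ?] /andP[? ?].
    split; apply/andP; split; lra.
  by rewrite leb2_box ?ltry// !addr_ge0// ltW.
have fin1 : (m1 Q < +oo)%E.
  rewrite m1E//; apply: (@bnd MF) => //.
  - exact: mh.
  - by apply: measurable_funS mF => // _ [z Qz <-]; apply: hU; exact: QU.
  - move=> _ [z Qz <-]; apply/andP; split; first by apply: F0; apply: hU; exact: QU.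
    by rewrite (le_trans (ler_norm _))// MFP.
have fin2 : (m2 Q < +oo)%E.
  rewrite m2E'//; apply: (@bnd MG) => //.
  - exact: measurable_funS mG.
  - move=> z Qz; apply/andP; split; first by apply: G0; exact: QU.
    by rewrite (le_trans (ler_norm _))// MGP.
have loc a b e : x <= a <= x + l -> y <= b <= y + w -> 0 < e ->
    exists2 d, 0 < d & forall x' y' r, 0 < r < d ->
      x' <= a <= x' + r * l -> y' <= b <= y' + r * w ->
      box x' y' (r * l) (r * w) `<=` Q ->
    ((m1 (box x' y' (r * l) (r * w)) <= m2 (box x' y' (r * l) (r * w)) + (e * r ^+ 2)%:E) /\
    (m2 (box x' y' (r * l) (r * w)) <= m1 (box x' y' (r * l) (r * w)) + (e * r ^+ 2)%:E))%E.
  move=> aI bI e0; have Uab := KU a b aI bI.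
  have e20 : 0 < e / 2 by rewrite divr_gt0.
  have Fhc : {for (a, b), continuous (F \o h)}.
    by apply: continuous_comp; [apply: hc|apply: Fc; apply: hU].
  have [d1 d10 d1P] := local_density hU kK (hk _ Uab) mh Fhc F0 mV mF Uab l0 w0 e20.
  have mid B : measurable B -> B `<=` U -> measurable (id @` B : set (plane2 R)).
    by rewrite image_id.
  have [d2 d20 d2P] := @local_density R U U id id G (a, b) 1 0 l w (fun z h => h)
    (fun z _ => erefl) (conf_tangent_id oU Uab) mid (Gc _ Uab) G0 mU mG Uab l0 w0 _ e20.
  exists (Num.min d1 d2); first by rewrite lt_min d10.
  move=> x' y' r /andP[r0]; rewrite lt_min => /andP[rd1 rd2] ax bx bQ.
  have bU : box x' y' (r * l) (r * w) `<=` U by exact: subset_trans QU.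
  have := d1P x' y' r (introT andP (conj r0 rd1)) ax bx bU.
  have := d2P x' y' r (introT andP (conj r0 rd2)) ax bx bU.
  rewrite image_id m1E// m2E'// /= expr1n expr0n addr0 mulr1.
  rewrite -[F (h (a, b)) * _]/(G (a, b)).
  set I2 := integral _ _ _; set I1 := integral _ _ _.
  have e2 (c : R) : (c + e / 2) * r ^+ 2 = (c - e / 2) * r ^+ 2 + e * r ^+ 2 by field.
  move=> /andP[h1 h2] /andP[h3 h4].
  rewrite !e2 !EFinD in h2 h4; split.
    by apply: le_trans h4 _; rewrite leeD2r.
  by apply: le_trans h2 _; rewrite leeD2r.
split => //; apply/eqP; rewrite eq_le; apply/andP; split; apply: measure_le_box => //.
  move=> a b e aI bI e0; have [d d0 dP] := loc a b e aI bI e0.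
  by exists d => // x' y' r rd ax bx bQ; have [] := dP x' y' r rd ax bx bQ.
move=> a b e aI bI e0; have [d d0 dP] := loc a b e aI bI e0.
by exists d => // x' y' r rd ax bx bQ; have [] := dP x' y' r rd ax bx bQ.
Qed.

End ChangeOfVariables.

(** * Functions of class C^k *)

Section Calculus.
Context {R : realType} {V : normedModType R}.

Lemma is_derive_line (W : normedModType R) (g : V -> W) (b v : V) (x : R) :
  derivable g (b + x *: v) v ->
  is_derive x 1 (fun x => g (b + x *: v)) ('D_v g (b + x *: v)).
Proof.
have E (h : R) : h^-1 *: (g (b + (h *: 1 + x) *: v) - g (b + x *: v)) =
    h^-1 *: (g (h *: v + (b + x *: v)) - g (b + x *: v)).
  by congr (_ *: (g _ - _)); rewrite scalerDl [h *: 1]mulr1 addrCA.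
move=> dg; apply: DeriveDef.
  by rewrite /derivable /=; under eq_fun do rewrite E.
by rewrite /derive /=; under eq_fun do rewrite E.
Qed.

Lemma diff_eps (W : normedModType R) (f : V -> W) (x : V) (e : R) :
  differentiable f x -> 0 < e ->
  \forall y \near x, `|f y - f x - 'd f x (y - x)| <= e * `|y - x|.
Proof.
move=> /diff_locally/eqaddoP/(_ _) h e0; have := h e e0.
rewrite [X in _ -> X](near_shift 0); apply: filterS => y /=.
by rewrite subr0 addrK opprD addrA.
Qed.

Lemma differentiable_eps (W : normedModType R) (f : V -> W) (df : {linear V -> W})
    (x : V) : continuous df ->
  (forall e, 0 < e -> \forall y \near x, `|f y - f x - df (y - x)| <= e * `|y - x|) ->
  differentiable f x.
Proof.
move=> dfc h.
have E : f \o shift x = cst (f x) + df +o_ 0 id.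
  apply/eqaddoP => e e0; have := h e e0.
  rewrite [X in X -> _](near_shift 0); apply: filterS => y /=.
  by rewrite subr0 addrK opprD addrA.
by apply/diff_locallyP; rewrite (diff_unique dfc E).
Qed.

Lemma near_eq_differentiable (W : normedModType R) (f g : V -> W) (x : V) :
  {near x, f =1 g} -> differentiable f x -> differentiable g x.
Proof.
move=> fg df; apply: (@differentiable_eps _ _ ('d f x)).
  exact: diff_continuous.
have fgx : f x = g x := nbhs_singleton fg.
move=> e e0; have := diff_eps df e0; apply: filterS2 fg => y.
by rewrite fgx => ->.
Qed.

Lemma near_open (U : set V) (P : V -> Prop) (x : V) : open U -> U x ->
  (forall y, U y -> P y) -> \forall y \near x, P y.
Proof. by move=> oU Ux UP; apply: filterS UP _; exact: open_nbhs_nbhs. Qed.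

Lemma near_eq_continuous (W : normedModType R) (f g : V -> W) (x : V) :
  {near x, f =1 g} -> {for x, continuous f} -> {for x, continuous g}.
Proof.
move=> fg fc; have fgx : f x = g x := nbhs_singleton fg.
rewrite /prop_for /continuous_at -fgx.
by apply: cvg_trans fc; apply: near_eq_cvg; apply: filterS fg => y ->.
Qed.

(** [Ck_on] differentiates functions defined everywhere; on an open set the derivatives depend only
    on the values there. *)
Lemma Ck_on_eq (W : normedModType R) k (U : set V) (f g : V -> W) : open U ->
  (forall x, U x -> f x = g x) -> Ck_on k U f -> Ck_on k U g.
Proof.
move=> oU; elim: k f g => [|k IH] f g fg /=.
  by move=> fc x Ux; apply: near_eq_continuous (fc x Ux); exact: near_open Ux fg.
move=> [df ck]; split=> [x Ux|v].
  by apply: near_eq_differentiable (df x Ux); exact: near_open Ux fg.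
by apply: IH (ck v) => x Ux; apply: near_eq_derive; exact: near_open Ux fg.
Qed.

Lemma Ck_onS_diff (W : normedModType R) k (U : set V) (f : V -> W) :
  Ck_on k.+1 U f -> forall x, U x -> differentiable f x.
Proof. by move=> /= [df _]. Qed.

Lemma Ck_onS_derive (W : normedModType R) k (U : set V) (f : V -> W) v :
  Ck_on k.+1 U f -> Ck_on k U ('D_v f).
Proof. by move=> /= [_]. Qed.

Lemma Ck_on_sub (W : normedModType R) k (U U' : set V) (f : V -> W) :
  U' `<=` U -> Ck_on k U f -> Ck_on k U' f.
Proof.
move=> UU; elim: k f => [|k IH] f /=; first by move=> h x /UU; exact: h.
by move=> [df ck]; split=> [x /UU|v]; [exact: df|exact: IH].
Qed.

Lemma Ck_on_pred (W : normedModType R) k (U : set V) (f : V -> W) :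
  Ck_on k.+1 U f -> Ck_on k U f.
Proof.
elim: k f => [|k IH] f /=.
  by move=> [df _] x Ux; apply: differentiable_continuous; exact: df.
by move=> [df ck]; split => // v; apply: IH; exact: ck.
Qed.

Lemma Ck_on_local (W : normedModType R) k (U : set V) (f : V -> W) :
  (forall x, U x -> exists2 U', U' x & Ck_on k U' f) -> Ck_on k U f.
Proof.
elim: k f => [|k IH] f h /=.
  by move=> x Ux; have [U' U'x] := h x Ux; apply.
split=> [x Ux|v].
  by have [U' U'x [df _]] := h x Ux; exact: df.
apply: IH => x Ux; have [U' U'x [_ ck]] := h x Ux; exists U' => //.
exact: ck.
Qed.

Lemma Ck_on_cst (W : normedModType R) k (U : set V) (c : W) : Ck_on k U (cst c).
Proof.
elim: k c => [|k IH] c /=; first by move=> x _; exact: cst_continuous.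
split=> [x _|v]; first exact: differentiable_cst.
have -> : 'D_v (cst c : V -> W) = cst 0 by apply/funext => x; rewrite derive_cst.
exact: IH.
Qed.

Lemma Ck_on_add (W : normedModType R) k (U : set V) (f g : V -> W) : open U ->
  Ck_on k U f -> Ck_on k U g -> Ck_on k U (f \+ g).
Proof.
move=> oU; elim: k f g => [|k IH] f g /=.
  by move=> fc gc x Ux; apply: cvgD; [exact: fc|exact: gc].
move=> [df cf] [dg cg]; split=> [x Ux|v].
  by apply: differentiableD; [exact: df|exact: dg].
apply: Ck_on_eq (IH _ _ (cf v) (cg v)) => // x Ux /=.
by rewrite deriveD//; apply: diff_derivable; [exact: df|exact: dg].
Qed.

Lemma Ck_on_mul k (U : set V) (f g : V -> R) : open U ->
  Ck_on k U f -> Ck_on k U g -> Ck_on k U (f \* g).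
Proof.
move=> oU; elim: k f g => [|k IH] f g.
  by move=> fc gc x Ux; apply: cvgM; [exact: fc|exact: gc].
move=> Cf Cg; have [df cf] := Cf; have [dg cg] := Cg; split=> [x Ux|v].
  by apply: differentiableM; [exact: df|exact: dg].
apply: (@Ck_on_eq _ _ _ (('D_v f \* g) \+ (f \* 'D_v g))) => // [x Ux /=|].
  rewrite deriveM; last 2 first.
  - by apply: diff_derivable; exact: df.
  - by apply: diff_derivable; exact: dg.
  by rewrite addrC; congr (_ + _); rewrite [LHS]mulrC.
exact: (Ck_on_add oU (IH _ _ (cf v) (Ck_on_pred Cg))
  (IH _ _ (Ck_on_pred Cf) (cg v))).
Qed.

Lemma Ck_on_sum (W : normedModType R) k (U : set V) (I : Type) (s : seq I) (f : I -> V -> W) :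
  open U -> (forall i, Ck_on k U (f i)) -> Ck_on k U (fun x => \sum_(i <- s) f i x).
Proof.
move=> oU h; elim: s => [|i s IH].
  by under eq_fun do rewrite big_nil; exact: Ck_on_cst.
by under eq_fun do rewrite big_cons; exact: (Ck_on_add oU (h i) IH).
Qed.

Lemma derive_comp_rV m (f : 'rV[R]_m -> R) (h : V -> 'rV[R]_m) (x v : V) :
  differentiable h x -> differentiable f (h x) ->
  'D_v (f \o h) x = \sum_i 'D_(delta_mx 0 i) f (h x) * ('D_v h x) 0 i.
Proof.
move=> dh df; rewrite deriveE; last exact: differentiable_comp.
rewrite diff_comp//= -(deriveE v dh) {1}(row_sum_delta ('D_v h x)) linear_sum.
by apply: eq_bigr => i _; rewrite (deriveE _ df) linearZ mulrC.
Qed.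

Lemma derive_coord m (h : V -> 'rV[R]_m) (x v : V) i : differentiable h x ->
  'D_v (fun y => h y 0 i) x = ('D_v h x) 0 i.
Proof.
move=> dh; rewrite derive_mx ?mxE//; exact: diff_derivable.
Qed.

Lemma Ck_on_coord m k (U : set V) (h : V -> 'rV[R]_m) i : open U ->
  Ck_on k U h -> Ck_on k U (fun y => h y 0 i).
Proof.
move=> oU; elim: k h => [|k IH] h /=.
  move=> hc x Ux; apply: (@continuous_comp _ _ _ h (fun z : 'rV[R]_m => z 0 i)).
    exact: hc.
  exact: coord_continuous.
move=> [dh ch]; split=> [x Ux|v].
  apply: (@differentiable_comp _ _ _ _ h (fun z : 'rV[R]_m => z 0 i)); first exact: dh.
  exact: differentiable_coord.
by apply: (Ck_on_eq oU _ (IH _ (ch v))) => x Ux; rewrite derive_coord//; exact: dh.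
Qed.

(** Induction on [k]: a derivative of the composite is a sum of products of ['D f \o h] with
    coordinates of ['D h], each one order less regular. *)
Lemma Ck_on_comp m k (U : set V) (U' : set 'rV[R]_m) (f : 'rV[R]_m -> R)
    (h : V -> 'rV[R]_m) : open U -> (forall x, U x -> U' (h x)) ->
  Ck_on k U h -> Ck_on k U' f -> Ck_on k U (f \o h).
Proof.
move=> oU hU; elim: k f => [|k IH] f.
  by move=> hc fc x Ux; apply: continuous_comp; [exact: hc|apply: fc; exact: hU].
move=> Ch [df cf]; have [dh ch] := Ch; split=> [x Ux|v].
  by apply: differentiable_comp; [exact: dh|apply: df; exact: hU].
apply: (@Ck_on_eq _ _ _ (fun x => \sum_i 'D_(delta_mx 0 i) f (h x) * ('D_v h x) 0 i)) => //.
  by move=> x Ux; rewrite derive_comp_rV//; [exact: dh|apply: df; exact: hU].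
apply: Ck_on_sum => // i.
apply: (@Ck_on_mul _ _ ('D_(delta_mx 0 i) f \o h) (fun x => ('D_v h x) 0 i)) => //.
  by apply: IH; [exact: Ck_on_pred|exact: cf].
by apply: Ck_on_coord => //; exact: ch.
Qed.

(** The outer functions are the cut-offs and the inverse, known through an explicit continuous
    derivative; a squared positive part has no second derivative at its kink, so the order is 1. *)
Lemma C1_comp_real (U : set V) (f : V -> R) (g g' : R -> R) : open U ->
  Ck_on 1 U f -> (forall x, U x -> is_derive (f x) 1 g (g' (f x))) ->
  (forall x, U x -> {for f x, continuous g'}) -> Ck_on 1 U (g \o f).
Proof.
move=> oU [df cf] gd g'c.
have dg x : U x -> differentiable g (f x).
  by move=> /gd h; apply/derivable1_diffP; exact: ex_derive.
split=> [x Ux|v]; first by apply: differentiable_comp; [exact: df|exact: dg].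
apply: (@Ck_on_eq _ _ _ (fun x => g' (f x) * 'D_v f x)) => //.
  move=> x Ux; rewrite [RHS]deriveE; last exact: (differentiable_comp (df x Ux) (dg x Ux)).
  rewrite (diff_comp (df x Ux) (dg x Ux)).
  rewrite /= -(deriveE v (df x Ux)) -[X in 'd g _ X]mulr1 [RHS]linearZ /=.
  by rewrite -deriveE ?(@derive_val _ _ _ _ _ _ _ (gd x Ux)) 1?mulrC//; exact: dg.
move=> x Ux; apply: cvgM; last exact: cf.
by apply: continuous_comp; [apply: differentiable_continuous; exact: df|exact: g'c].
Qed.

(* The second difference quotient of [g] at [a] equals a mixed derivative near
   [a], for both orders of differentiation. *)
Lemma second_difference (g : V -> R) (a v w : V) (d : R) : 0 < d ->
  (forall s t, 0 <= s <= d -> 0 <= t <= d ->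
     derivable g (a + s *: v + t *: w) v /\
     derivable ('D_v g) (a + s *: v + t *: w) w) ->
  exists s t, [/\ 0 < s < d, 0 < t < d &
    g (a + d *: v + d *: w) - g (a + d *: v) - g (a + d *: w) + g a =
    d ^+ 2 * 'D_w ('D_v g) (a + s *: v + t *: w)].
Proof.
move=> d0 H.
have dI : 0 <= d <= d by rewrite lexx ltW.
have d0I : 0 <= (0 : R) <= d by rewrite lexx ltW.
(* The increment of [g] across [d *: w], as a function of the step along [v]. The mean value theorem
   is used on it and then on ['D_v g] along [w]. *)
pose f s := g (a + d *: w + s *: v) - g (a + s *: v).
pose f' s := 'D_v g (a + d *: w + s *: v) - 'D_v g (a + s *: v).
have df s : 0 <= s <= d -> is_derive s 1 f (f' s).
  move=> sd; apply: is_deriveB.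
    by apply: is_derive_line; rewrite addrAC; exact: (H s d sd dI).1.
  apply: is_derive_line; have [+ _] := H s 0 sd d0I.
  by rewrite scale0r addr0.
have cont (h h' : R -> R) : (forall s, 0 <= s <= d -> is_derive s 1 h (h' s)) ->
    {within `[0, d], continuous h}.
  move=> dh; apply: derivable_within_continuous => s; rewrite in_itv/= => sd.
  exact: (@ex_derive _ _ _ _ _ _ _ (dh s sd)).
have oc (s : R) : s \in `]0, d[ -> 0 <= s <= d.
  by rewrite in_itv/= => /andP[s0 s1]; rewrite !ltW.
have [s sI fs] := MVT d0 (fun s sI => df s (oc s sI)) (cont f f' df).
pose k t := 'D_v g (a + s *: v + t *: w).
have dk t : 0 <= t <= d -> is_derive t 1 k ('D_w ('D_v g) (a + s *: v + t *: w)).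
  by move=> td; apply: is_derive_line; apply: (H s t (oc s sI) td).2.
have [t tI kt] := MVT d0 (fun s sI => dk s (oc s sI)) (cont k _ dk).
exists s, t; rewrite !in_itv/= in sI tI; split => //.
move: fs kt; rewrite /f /f' /k !scale0r !addr0 !subr0.
rewrite [a + d *: w + d *: v]addrAC [a + d *: w + s *: v]addrAC => fs kt.
rewrite expr2 -mulrA [d * 'D_w _ _]mulrC -kt mulrC -fs.
by rewrite opprB addrA addrAC -addrA addrC [RHS]addrC; ring.
Qed.

Lemma ler_dist_half (x y z e : R) :
  `|x - z| <= e / 2 -> `|y - z| <= e / 2 -> `|x - y| <= e.
Proof. by rewrite !ler_norml => /andP[? ?] /andP[? ?]; apply/andP; split; lra. Qed.

(** Schwarz's theorem, which is the identity [d (dg) = 0] behind Stokes. The second difference is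
    symmetric in [v] and [w], so the mixed derivatives take equal values at two points near [a], and
    continuity carries this to [a]. *)
Lemma derive_swap (U : set V) (g : V -> R) (a v w : V) : open U ->
  Ck_on 2 U g -> U a -> 'D_w ('D_v g) a = 'D_v ('D_w g) a.
Proof.
move=> oU [dg cg] Ua; apply/eqP; rewrite -subr_eq0 -normr_le0.
apply/ler_addgt0Pl => e e0; rewrite addr0.
have e20 : 0 < e / 2 by rewrite divr_gt0.
have [dv cv] := cg v; have [dw cw] := cg w.
have near_line (P : V -> Prop) : (\forall y \near a, P y) ->
    exists2 r, 0 < r & forall d, 0 <= d <= r -> forall s t, 0 <= s <= d -> 0 <= t <= d ->
      P (a + s *: v + t *: w).
  move=> /nbhs_ballP[r /= r0 rP].
  have vw0 : 0 < `|v| + `|w| + 1 by rewrite ltr_wpDl// addr_ge0.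
  exists (r / 2 / (`|v| + `|w| + 1)); first by rewrite !divr_gt0.
  move=> d /andP[d0 dr] s t /andP[s0 sd] /andP[t0 td]; apply: rP.
  rewrite -ball_normE /= opprD addrA opprD addrA subrr sub0r -opprD normrN.
  apply: (le_lt_trans (ler_normD _ _)); rewrite !normrZ (ger0_norm s0) (ger0_norm t0).
  apply: (@le_lt_trans _ _ (r / 2)); last by rewrite ltr_pdivrMr// ltr_pMr// ltr1n.
  apply: (@le_trans _ _ (d * (`|v| + `|w| + 1))); last by rewrite -ler_pdivlMr.
  rewrite !mulrDr mulr1; apply: ler_wpDr => //; apply: lerD; exact: ler_wpM2r.
pose A : V -> R := 'D_w ('D_v g); pose B : V -> R := 'D_v ('D_w g).
have Ac : {for a, continuous A} := cv w a Ua.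
have Bc : {for a, continuous B} := cw v a Ua.
have P1 : \forall y \near a, [/\ U y, `|A a - A y| <= e / 2 & `|B a - B y| <= e / 2].
  move: A B Ac Bc => A B /cvgrPdist_le/(_ _ e20) h1 /cvgrPdist_le/(_ _ e20) h2.
  have h3 : \forall y \near a, U y by exact: (near_open oU Ua (fun y h => h)).
  by near=> y; split; near: y; [exact: h3|exact: h1|exact: h2].
have [d d0 dP] := near_line _ P1.
have dI : 0 <= d <= d by rewrite lexx ltW.
have H1 s t : 0 <= s <= d -> 0 <= t <= d ->
     derivable g (a + s *: v + t *: w) v /\ derivable ('D_v g) (a + s *: v + t *: w) w.
  move=> sd td; have [Uy _ _] := dP d dI s t sd td.
  by split; apply: diff_derivable; [exact: dg|exact: dv].
have H2 s t : 0 <= s <= d -> 0 <= t <= d ->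
     derivable g (a + s *: w + t *: v) w /\ derivable ('D_w g) (a + s *: w + t *: v) v.
  move=> sd td; have [Uy _ _] := dP d dI t s td sd; rewrite addrAC.
  by split; apply: diff_derivable; [exact: dg|exact: dw].
have lt_le (s : R) : 0 < s < d -> 0 <= s <= d by move=> /andP[? ?]; rewrite !ltW.
have [s [t [sd td E1]]] := second_difference d0 H1.
have [s' [t' [sd' td' E2]]] := second_difference d0 H2.
rewrite -/(A a) -/(B a).
have [_ b1 _] := dP d dI s t (lt_le _ sd) (lt_le _ td).
have [_ _ b2] := dP d dI t' s' (lt_le _ td') (lt_le _ sd').
(* Both sides times [d ^+ 2] are the same second difference, written in the two orders. *)
have E : A (a + s *: v + t *: w) = B (a + s' *: w + t' *: v).
  have d20 : d ^+ 2 != 0 by rewrite expf_neq0// lt0r_neq0.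
  apply: (mulfI d20); apply: (etrans (esym E1)); apply: etrans E2.
  by rewrite [a + d *: w + d *: v]addrAC [X in X + _]addrAC.
rewrite addrAC -E in b2.
exact: ler_dist_half b1 b2.
Unshelve. all: by end_near.
Qed.

End Calculus.

Lemma is_derive_inv (R : realType) (x : R) : x != 0 ->
  is_derive x (1 : R) (fun x => x^-1) (- x ^- 2).
Proof. by move=> x0; apply: is_derive_eq (is_deriveV x0 (is_derive_id _ _)) _; exact: mulr1. Qed.

Lemma Ck_on_coordinate (R : realType) n k i :
  Ck_on k setT (fun z : 'rV[R]_n => z 0 i).
Proof.
apply: (@Ck_on_coord _ _ _ k setT id i openT).
case: k => [|k]; first by move=> x _; exact: cvg_id.
split; first by [].
move=> v; rewrite (_ : (fun x => 'D_v id x) = cst v); first exact: Ck_on_cst.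
by apply/funext => x; rewrite derive_id.
Qed.

(** * Stokes' theorem in the plane *)

Section PlanarStokes.
Context {R : realType}.
Local Notation E2 := 'rV[R]_(1 + 1).
Local Notation e0 := (delta_mx 0 ord0 : E2).
Local Notation e1 := (delta_mx 0 ord_max : E2).

Definition unplane (y : E2) : R * R := (y 0 ord0, y 0 ord_max).

Lemma planeE (q : R * R) : plane q = q.1 *: e0 + q.2 *: e1.
Proof.
apply/rowP => i; rewrite !mxE; case: splitP => j; rewrite ord1 => Ej.
  by rewrite !mxE -!val_eqE /= Ej/= mulr1 mulr0 addr0 mulr1n.
by rewrite !mxE -!val_eqE /= Ej/= mulr0 mulr1 add0r mulr1n.
Qed.

Lemma planeK : cancel (@plane R) unplane.
Proof.
move=> [x y]; rewrite /unplane planeE !mxE -!val_eqE /=.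
by rewrite !mulr1 !mulr0 addr0 add0r.
Qed.

Lemma unplaneK : cancel unplane (@plane R).
Proof.
move=> y; apply/rowP => i; rewrite planeE /unplane !mxE -!val_eqE /=.
case: i => -[|[|//]] i2 /=; rewrite !mulr1 !mulr0 ?addr0 ?add0r;
  by congr (y _ _); apply/val_inj.
Qed.

Lemma plane0 (q : R * R) : plane q 0 ord0 = q.1.
Proof. by rewrite -[in RHS](planeK q). Qed.

Lemma plane1 (q : R * R) : plane q 0 ord_max = q.2.
Proof. by rewrite -[in RHS](planeK q). Qed.

Lemma plane_continuous : continuous (@plane R).
Proof.
move=> q; rewrite (_ : @plane R = fun q => q.1 *: e0 + q.2 *: e1); last first.
  by apply/funext => z; rewrite planeE.
by apply: cvgD; apply: cvgZr_tmp; [exact: cvg_fst|exact: cvg_snd].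
Qed.

Lemma unplane_continuous : continuous unplane.
Proof.
move=> y; exact: (cvg_pair (@coord_continuous R 1 (1 + 1) 0 ord0 y)
  (@coord_continuous R 1 (1 + 1) 0 ord_max y)).
Qed.

(** The derivative vanishes where [g] is locally zero, so the fundamental theorem on [[- L, L]]
    computes the whole integral from two zero boundary values. *)
Lemma integral_derivative_R (g : R -> R) (g' : R -> R) (L : R) : 0 < L ->
  (forall x : R, is_derive x (1 : R) g (g' x)) -> continuous g' ->
  (forall x, L <= `|x| -> g x = 0) ->
  (\int[leb R]_x (g' x)%:E = 0)%E.
Proof.
move=> L0 dg g'c g0.
have gc : continuous g.
  move=> x; apply: differentiable_continuous; apply/derivable1_diffP.
  exact: (@ex_derive _ _ _ _ _ _ _ (dg x)).
have g'0 x : ~ (`[- L, L]%classic x) -> g' x = 0.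
  rewrite /= in_itv/= => /negP; rewrite -ler_norml -ltNge => xL.
  rewrite -(@derive_val _ _ _ _ _ _ _ (dg x)) -(derive_cst (0 : R) x 1).
  apply: near_eq_derive.
  have : \forall y \near x, L < `|y|.
    exact: (cvgr_gt _ (@norm_continuous R R x) _ xL).
  by apply: filterS => y /ltW; exact: g0.
pose D : set R := `[- L, L]%classic.
transitivity (\int[leb R]_(x in D) (g' x)%:E)%E.
  rewrite [RHS]integral_mkcond; apply: eq_integral => x _; rewrite /patch.
  by case: ifPn => // /negP; rewrite inE => /g'0 ->.
rewrite (@continuous_FTC2 _ g' g).
- by rewrite !g0 ?normrN ?gtr0_norm// subee.
- by rewrite gtrN.
- by apply: continuous_subspaceT.
- split => [x _||]; first exact: (@ex_derive _ _ _ _ _ _ _ (dg x)).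
    by apply: cvg_at_right_filter; exact: gc.
  by apply: cvg_at_left_filter; exact: gc.
- by move=> x _; rewrite derive1E (@derive_val _ _ _ _ _ _ _ (dg x)).
Qed.

Lemma integrable_compact_support (f : R * R -> R) (L : R) : 0 < L ->
  continuous f -> (forall q, f q != 0 -> `|q.1| < L /\ `|q.2| < L) ->
  (leb2 R).-integrable setT (EFin \o (f : plane2 R -> R)).
Proof.
move=> L0 fc f0.
pose K := box (- L) (- L) (L + L) (L + L) : set (plane2 R).
have mK : measurable K by exact: measurable_box.
have mf : measurable_fun setT (f : plane2 R -> R).
  by apply: (@continuous_measurable2 R setT _ openT) => x _; exact: fc.
have -> : EFin \o (f : plane2 R -> R) = (EFin \o (f : plane2 R -> R)) \_ K.
  apply/funext => q; rewrite /patch; case: ifPn => //= /negP; rewrite inE => nK.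
  congr (_%:E); apply/eqP; apply: contra_notT nK => /f0.
  rewrite !ltr_norml => -[/andP[q1 q2] /andP[q3 q4]].
  by rewrite /K /box/= !in_itv/= !addKr q1 q3 !ltW.
apply/(integrable_mkcond _ mK); apply: measurable_bounded_integrable => //.
- by rewrite leb2_box ?ltry// addr_ge0// ltW.
- exact: measurable_funS mf.
- have LL : 0 < L + L by rewrite addr_gt0.
  have [M [M0 MP]] := @bounded_on_box R f (- L) (- L) _ _ LL LL (fun u v _ _ => fc (u, v)).
  exists M; split; first exact: num_real.
  by move=> x Mx z Kz; apply: (le_trans (MP z Kz)); exact: ltW.
Qed.

(** Fubini, integrating first along the direction of the derivative, which the boolean selects. *)
Lemma integral_partial (F : E2 -> R) (L : R) (i : bool) : 0 < L ->
  Ck_on 1 setT F -> (forall q, F (plane q) != 0 -> `|q.1| < L /\ `|q.2| < L) ->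
  let f (q : R * R) : R := 'D_(if i then e0 else e1) F (plane q) in
  (leb2 R).-integrable setT (EFin \o (f : plane2 R -> R)) /\
  (\int[leb2 R]_q (f q)%:E = 0)%E.
Proof.
move=> L0 CF F0 f.
have dF y : differentiable F y by exact: (Ck_onS_diff CF).
have cF v : continuous ('D_v F) by move=> y; exact: (Ck_onS_derive v CF).
have fc : continuous f.
  move=> q; apply: (@continuous_comp _ _ _ (@plane R) ('D_(if i then e0 else e1) F)).
    exact: plane_continuous.
  exact: cF.
have F0' q : L <= Num.max `|q.1| `|q.2| -> F (plane q) = 0.
  move=> Lq; apply/eqP; apply: contraTT Lq => /F0[q1 q2].
  by rewrite -ltNge gt_max q1 q2.
(* The derivative is controlled only off the closed square of half-side [L], so the strict bounds
   are stated with [L + 1]. *)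
have f0 q : f q != 0 -> `|q.1| < L + 1 /\ `|q.2| < L + 1.
  move=> fq; suff : ~ (L < Num.max `|q.1| `|q.2|).
    move/negP; rewrite -leNgt ge_max => /andP[? ?].
    by rewrite !ltr_pwDr.
  move=> Lq; move: fq; apply/negP; rewrite negbK; apply/eqP.
  rewrite /f -(derive_cst (0 : R) (plane q) (if i then e0 else e1)).
  apply: near_eq_derive.
  have mc : continuous (fun y : E2 => Num.max `|(unplane y).1| `|(unplane y).2|).
    move=> y; apply: (@continuous_comp _ _ _ unplane (fun q => Num.max `|q.1| `|q.2|)).
      exact: unplane_continuous.
    by apply: continuous_max => /=; apply: continuous_comp;
      [exact: cvg_fst|exact: norm_continuous|exact: cvg_snd|exact: norm_continuous].
  have : \forall y \near plane q, L < Num.max `|(unplane y).1| `|(unplane y).2|.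
    by apply: (cvgr_gt _ (mc (plane q))); rewrite planeK.
  by apply: filterS => y /ltW Ly; rewrite -(unplaneK y) F0'.
have L10 : 0 < L + 1 by rewrite addr_gt0.
have intf := integrable_compact_support L10 fc f0.
split => //.
have line b v x : is_derive (x : R) 1 (fun x => F (b + x *: v)) ('D_v F (b + x *: v)).
  by apply: is_derive_line; apply: diff_derivable; exact: dF.
have dc b v : continuous (fun x : R => 'D_v F (b + x *: v)).
  move=> x; apply: (@continuous_comp _ _ _ (fun x : R => b + x *: v) ('D_v F)); last exact: cF.
  by apply: cvgD; [exact: cvg_cst|apply: cvgZr_tmp; exact: cvg_id].
case: i @f fc f0 intf => f fc f0 intf.
  rewrite -(integral21_prod_meas1 intf) integral0_eq// => y _.
  rewrite /fubini_G /= /f.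
  under eq_integral do rewrite planeE /= addrC.
  apply: (@integral_derivative_R (fun x => F (y *: e1 + x *: e0)) _ L) => // x Lx.
  by rewrite addrC -(planeE (x, y)) F0'//= le_max Lx.
rewrite -(integral12_prod_meas1 intf) integral0_eq// => x _.
rewrite /fubini_F /= /f.
under eq_integral do rewrite planeE /=.
apply: (@integral_derivative_R (fun y => F (x *: e0 + y *: e1)) _ L) => // y Ly.
by rewrite -(planeE (x, y)) F0'//= le_max Ly orbT.
Qed.

Lemma integral_sub0 (a b : plane2 R -> R) :
  (leb2 R).-integrable setT (EFin \o a) -> (leb2 R).-integrable setT (EFin \o b) ->
  (\int[leb2 R]_q (a q)%:E = 0)%E -> (\int[leb2 R]_q (b q)%:E = 0)%E ->
  (\int[leb2 R]_q (a q - b q)%:E = 0)%E.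
Proof.
move=> ia ib a0 b0; under eq_integral do rewrite EFinB.
by rewrite (integralB measurableT ia ib) a0 b0 sube0.
Qed.

(** [df /\ dg = d (f dg)]: the integrand is a difference of two partial derivatives of compactly
    supported functions, the second derivatives of [g] cancelling. Only [f] is supported in [K]; [g]
    is regular on [O] alone. *)
Theorem planar_stokes (O K : set E2) (f g : E2 -> R) (L : R) : 0 < L ->
  open O -> closed K -> K `<=` O ->
  (forall y, K y -> `|y 0 ord0| < L /\ `|y 0 ord_max| < L) ->
  (forall y, ~ K y -> f y = 0) -> Ck_on 1 O f -> Ck_on 2 O g ->
  (\int[leb2 R]_q ('D_e0 f (plane q) * 'D_e1 g (plane q)
     - 'D_e1 f (plane q) * 'D_e0 g (plane q))%:E = 0)%E.
Proof.
move=> L0 oO cK KO KL f0 Cf Cg.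
have oK : open (~` K) by exact: closed_openC.
(* [f * 'D_v g] is regular near [K] as a product and vanishes off [K], so it is C^1 on the plane
   whatever [g] does outside [O]. *)
have Cfg v : Ck_on 1 setT (fun y => f y * 'D_v g y).
  apply: Ck_on_local => y _; have [Ky|nKy] := pselect (K y).
    exists O; first exact: KO.
    exact: (@Ck_on_mul R _ 1 O f ('D_v g) oO Cf (Ck_onS_derive v Cg)).
  exists (~` K) => //; apply: Ck_on_eq (Ck_on_cst 1 (~` K) (0 : R)) => // z nKz.
  by rewrite f0//= mul0r.
have supp v q : f (plane q) * 'D_v g (plane q) != 0 -> `|q.1| < L /\ `|q.2| < L.
  move=> h; have Kq : K (plane q).
    by apply: contrapT => /f0 h0; move: h; rewrite h0 mul0r eqxx.
  by have := KL _ Kq; rewrite plane0 plane1.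
have [int0 E0] := integral_partial true L0 (Cfg e1) (supp e1).
have [int1 E1] := integral_partial false L0 (Cfg e0) (supp e0).
rewrite -[RHS](integral_sub0 int0 int1 E0 E1).
apply: eq_integral => q _; congr (_%:E).
  have [Kq|nKq] := pselect (K (plane q)).
    have Oq := KO _ Kq; have df := Ck_onS_diff Cf; have dg := Ck_onS_diff Cg.
    have D v w : 'D_v (fun y => f y * 'D_w g y) (plane q) =
       'D_v f (plane q) * 'D_w g (plane q) + f (plane q) * 'D_v ('D_w g) (plane q).
      rewrite (@deriveM _ _ f ('D_w g)); last 2 first.
      - by apply: diff_derivable; exact: df.
      - by apply: diff_derivable; exact: (Ck_onS_diff (Ck_onS_derive w Cg)).
      by rewrite addrC; congr (_ + _); exact: mulrC.
    rewrite !D (derive_swap e0 e1 oO Cg Oq).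
    by move: ('D_e0 ('D_e1 g) _) => z; rewrite opprD addrACA subrr addr0.
  have z (h : E2 -> R) v : (forall y, ~ K y -> h y = 0) -> 'D_v h (plane q) = 0.
    move=> h0; rewrite -(derive_cst (0 : R) (plane q) v); apply: near_eq_derive.
    exact: near_open oK nKq h0.
  rewrite !(z f)// !(z (fun y => f y * _))// ?mul0r ?subrr// => y nKy;
    by rewrite f0// mul0r.
Qed.

End PlanarStokes.

(** * Charts and integration on Riemann surfaces *)

Section Jacobian.
Context {R : realType}.

Lemma jacobian_comp l m n (f : 'rV[R]_l -> 'rV[R]_m) (g : 'rV[R]_m -> 'rV[R]_n) x :
  differentiable f x -> differentiable g (f x) ->
  jacobian (g \o f) x = jacobian f x *m jacobian g (f x).
Proof.
move=> df dg; apply/row_matrixP => i; rewrite !rowE mulmxA.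
have dgf : differentiable (g \o f) x by exact: differentiable_comp.
rewrite -(deriveEjacobian _ dgf) -(deriveEjacobian _ df) -(deriveEjacobian _ dg).
by rewrite !deriveE// diff_comp.
Qed.

Lemma mul_jacobian m n (f : 'rV[R]_m -> 'rV[R]_n) x u : differentiable f x ->
  u *m jacobian f x = 'd f x u.
Proof. by move=> df; rewrite -(deriveEjacobian u df) (deriveE u df). Qed.

Lemma row_jacobian m n (f : 'rV[R]_m -> 'rV[R]_n) x i : differentiable f x ->
  row i (jacobian f x) = 'D_(delta_mx 0 i) f x.
Proof. by move=> df; rewrite rowE (deriveEjacobian _ df). Qed.

Lemma near_eq_jacobian m n (f g : 'rV[R]_m -> 'rV[R]_n) x :
  {near x, f =1 g} -> differentiable f x -> jacobian f x = jacobian g x.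
Proof.
move=> fg df; apply/row_matrixP => i.
have dg := near_eq_differentiable fg df.
apply: etrans (row_jacobian i df) _; apply: etrans _ (esym (row_jacobian i dg)).
exact: near_eq_derive.
Qed.

Lemma jacobian_id m (x : 'rV[R]_m) : jacobian id x = 1%:M.
Proof.
apply/row_matrixP => i; rewrite !rowE mulmx1 -deriveEjacobian//.
exact: derive_id.
Qed.

Lemma jacobianE m n (f : 'rV[R]_m -> 'rV[R]_n) x i j : differentiable f x ->
  jacobian f x i j = ('D_(delta_mx 0 i) f x) 0 j.
Proof.
by move=> df; rewrite -(row_jacobian i df) [RHS]mxE.
Qed.

(** Complex linearity, in the form in which [riemann_surface] provides the Cauchy-Riemann
    equations. *)
Definition conformal_mx (A : 'M[R]_(1 + 1)) : Prop :=
  stdJ 1 *m A = A *m stdJ 1.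

Lemma conformal_mxP (A : 'M[R]_(1 + 1)) : conformal_mx A ->
  A ord_max ord0 = - A ord0 ord_max /\ A ord_max ord_max = A ord0 ord0.
Proof.
have E : stdJ 1 = \matrix_(i < 1 + 1, j < 1 + 1)
   (if (nat_of_ord i == 0%N) && (nat_of_ord j == 1%N) then 1
    else if (nat_of_ord i == 1%N) && (nat_of_ord j == 0%N) then - 1 else 0) :> 'M[R]_(1+1).
  apply/matrixP => i j; rewrite /stdJ !mxE.
  case: splitP => i'; rewrite ord1 => Ei; rewrite !mxE; case: splitP => j'; rewrite ord1 => Ej;
    by rewrite !mxE /= Ei Ej /= ?mulr1n.
rewrite /conformal_mx E => /matrixP h.
have := h ord0 ord0; have := h ord0 ord_max.
rewrite !mxE !big_ord_recl !big_ord0 !mxE /=.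
rewrite !(mul0r, mul1r, mulr0, mulr1, add0r, addr0, mulN1r, mulrN1).
have -> : lift ord0 ord0 = ord_max :> 'I_(1 + 1) by apply/val_inj.
by move=> -> ->.
Qed.

Lemma stdJ_mul (N : nat) (u : 'rV[R]_(N + N)) k :
  (u *m stdJ N) 0 (lshift N k) = - u 0 (rshift N k) /\
  (u *m stdJ N) 0 (rshift N k) = u 0 (lshift N k).
Proof.
rewrite -{1 3}[u]hsubmxK /stdJ mul_row_block !mulmx0 add0r addr0 mulmx1 mulmxN mulmx1.
by rewrite row_mxEl row_mxEr !mxE.
Qed.

Lemma le_coord_norm n (y : 'rV[R]_n) i : `|y 0 i| <= `|y|.
Proof. 
rewrite /Num.norm/= mx_normrE.
exact: (@le_bigmax _ _ _ _ (fun ij => `|y ij.1 ij.2|) (0, i)).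
Qed.

Lemma norm_le_N1 (y : 'rV[R]_(1 + 1)) : `|y| <= N1 (unplane y).
Proof.
have [->|y0] := eqVneq y 0; first by rewrite normr0 addr_ge0.
have : `|y| != 0 by rewrite normr_eq0.
rewrite {1}/Num.norm/= => /mx_norm_neq0[[i j]] /= E; rewrite {1}/Num.norm/= E.
rewrite ord1 /N1 /unplane/=; case: j E => -[|[|//]] j2 _ /=.
  by rewrite (_ : Ordinal j2 = ord0) ?lerDl//; apply/val_inj.
by rewrite (_ : Ordinal j2 = ord_max) ?lerDr//; apply/val_inj.
Qed.

Lemma N1_le_norm (y : 'rV[R]_(1 + 1)) : N1 (unplane y) <= 2 * `|y|.
Proof.
rewrite /N1 /unplane/= mulr_natl mulr2n lerD//; exact: le_coord_norm.
Qed.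

Lemma unplaneB (x y : 'rV[R]_(1 + 1)) : unplane (x - y) = unplane x - unplane y.
Proof. by rewrite /unplane !mxE. Qed.

Lemma unplaneD (x y : 'rV[R]_(1 + 1)) : unplane (x + y) = unplane x + unplane y.
Proof. by rewrite /unplane !mxE. Qed.

Lemma unplane_mul (A : 'M[R]_(1 + 1)) (u : 'rV[R]_(1 + 1)) : conformal_mx A ->
  unplane (u *m A) = conf (A ord0 ord0) (A ord0 ord_max) (unplane u).
Proof.
move=> /conformal_mxP[E1 E2]; rewrite /unplane /conf/= !mxE !big_ord_recl !big_ord0.
have -> : lift ord0 ord0 = ord_max :> 'I_(1 + 1) by apply/val_inj.
rewrite E1 E2; congr (_, _); ring.
Qed.

Lemma conf_le (p q : R) z : N1 (conf p q z) <= (`|p| + `|q|) * N1 z.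
Proof.
rewrite /N1 /conf/= !mulrDl !mulrDr.
apply: (le_trans (lerD (ler_normB _ _) (ler_normD _ _))).
by rewrite !normrM; lra.
Qed.

Lemma conf_inv (p q : R) z : p ^+ 2 + q ^+ 2 != 0 ->
  conf (p / (p ^+ 2 + q ^+ 2)) (- q / (p ^+ 2 + q ^+ 2)) (conf p q z) = z.
Proof. by move=> h; case: z => x y; rewrite /conf/=; congr (_, _); field. Qed.

Lemma confB (p q : R) z z' : conf p q (z - z') = conf p q z - conf p q z'.
Proof. by case: z z' => x y [x' y']; rewrite /conf/=; congr (_, _) => /=; ring. Qed.

Lemma conformal_gt0 (A B : 'M[R]_(1 + 1)) : conformal_mx A -> A *m B = 1%:M ->
  0 < A ord0 ord0 ^+ 2 + A ord0 ord_max ^+ 2.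
Proof.
move=> _ AB; set p := A _ _; set q := A _ _.
rewrite lt_neqAle addr_ge0 ?sqr_ge0// andbT eq_sym; apply/eqP => pq.
have [p0 q0] : p = 0 /\ q = 0.
  split; apply/eqP; rewrite -sqrf_eq0; apply/eqP;
  have := sqr_ge0 p; have := sqr_ge0 q; lra.
have : (A *m B) ord0 ord0 = 1 by rewrite AB mxE.
rewrite mxE !big_ord_recl big_ord0 -/p p0.
have -> : lift ord0 ord0 = ord_max :> 'I_(1 + 1) by apply/val_inj.
by rewrite -/q q0 !mul0r !addr0 => /esym/eqP; rewrite oner_eq0.
Qed.

(** The tolerance [e / (2 * (C + 1))] absorbs an operator bound [C] and the factor 2 between [N1]
    and the sup norm; the added 1 keeps the quotient defined for [C = 0]. *)
Lemma scale_le (C e n : R) : 0 <= C -> 0 <= e -> 0 <= n ->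
  C * (2 * (e / (2 * (C + 1)) * n)) <= e * n /\
  2 * (e / (2 * (C + 1)) * (C * n)) <= e * n.
Proof.
move=> C0 e0 n0.
have C1 : C + 1 != 0 by rewrite gt_eqF// ltr_wpDl.
have h : e * n * (C / (C + 1)) <= e * n.
  by rewrite ler_piMr ?mulr_ge0// ler_pdivrMr ?mul1r ?ltr_wpDl// lerDl.
by split; apply: le_trans h; rewrite le_eqVlt; apply/orP; left; apply/eqP; field.
Qed.

(** The first estimate is the remainder of [h] multiplied by the inverse of its derivative; the
    second is the expansion of [k] at [h y], evaluated along the affine tangent map of [h]. *)
Lemma conf_tangent_diff (h k : 'rV[R]_(1 + 1) -> 'rV[R]_(1 + 1))
    (V : set (R * R)) (a : R * R) :
  let y := plane a in let A := jacobian h y in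
  open V -> V (unplane (h y)) ->
  differentiable h y -> differentiable k (h y) ->
  (\forall z \near y, k (h z) = z) -> conformal_mx A ->
  conf_tangent V (unplane \o h \o @plane R) (unplane \o k \o @plane R) a
    (A ord0 ord0) (A ord0 ord_max).
Proof.
move=> y A oV Vy dh dk kh cA; set p := A _ _; set q := A _ _.
have jk : A *m jacobian k (h y) = 1%:M.
  rewrite -jacobian_comp// -(jacobian_id y); apply/esym/near_eq_jacobian => //.
  by apply: filterS kh => z /= ->.
have dE (u : 'rV[R]_(1 + 1)) : 'd h y u = u *m A.
  exact/esym/mul_jacobian.
have dkE (u : 'rV[R]_(1 + 1)) : 'd k (h y) u = u *m jacobian k (h y).
  exact/esym/mul_jacobian.
have pq0 : 0 < p ^+ 2 + q ^+ 2 by exact: conformal_gt0 cA jk.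
have nearp (P : 'rV[R]_(1 + 1) -> Prop) : (\forall z \near y, P z) ->
    \forall z \near a, P (plane z).
  by move=> h0; apply: (@plane_continuous R a).
have pB z z' : plane z - plane z' = plane (z - z') :> 'rV[R]_(1+1).
  by rewrite !planeE /= !scalerBl opprD addrACA.
set J := p ^+ 2 + q ^+ 2 in pq0 *.
split => // e e0.
  set C := `|p / J| + `|- q / J|.
  have C0 : 0 < 2 * (C + 1) by rewrite mulr_gt0// ltr_wpDl// addr_ge0.
  have eC : 0 < e / (2 * (C + 1)) by rewrite divr_gt0.
  have /nearp := diff_eps dh eC; apply: filterS => z hz.
  have -> : a + conf (p / J) (- q / J) ((unplane \o h \o plane) z - (unplane \o h \o plane) a) - z =
     conf (p / J) (- q / J) (unplane (h (plane z) - h y - 'd h y (plane z - y))).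
    rewrite !unplaneB dE unplane_mul// unplaneB !planeK [in RHS]confB.
    by rewrite (conf_inv _ (lt0r_neq0 pq0)) opprB [a + _]addrC addrA.
  apply: (le_trans (conf_le _ _ _)); rewrite -/C.
  have h1 := le_trans (N1_le_norm _) (ler_wpM2l (ler0n R 2) hz).
  have C00 : 0 <= C by rewrite addr_ge0.
  apply: (le_trans (ler_wpM2l C00 h1)).
  have h2 := norm_le_N1 (plane z - y); rewrite unplaneB !planeK in h2.
  have n0 : 0 <= `|plane z - y| by [].
  apply: (@le_trans _ _ (e * `|plane z - y|)); last exact: (ler_wpM2l (ltW e0) h2).
  by have [] := scale_le C00 (ltW e0) n0.
set C := `|p| + `|q|.
have C0 : 0 < 2 * (C + 1) by rewrite mulr_gt0// ltr_wpDl// addr_ge0.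
have eC : 0 < e / (2 * (C + 1)) by rewrite divr_gt0.
pose t w := h y + (plane w - y) *m A.
have tE w : (unplane \o h \o plane) a + conf p q (w - a) = unplane (t w).
  by rewrite /t unplaneD unplane_mul// unplaneB !planeK.
have tc : (fun w => t w) @ a --> h y.
  have -> : h y = t a by rewrite /t subrr mul0mx addr0.
  apply: cvgD; first exact: cvg_cst.
  have : continuous (fun w : R * R => 'd h y (plane w - y)).
    move=> w; apply: (@continuous_comp _ _ _ (fun w => plane w - y) ('d h y)).
      by apply: cvgB; [exact: plane_continuous|exact: cvg_cst].
    exact: diff_continuous.
  by under eq_fun do rewrite dE; apply.
have nV : \forall w \near a, V (unplane (t w)).
  apply: (tc (fun b => V (unplane b))).
  by apply: (@unplane_continuous R (h y)); exact: open_nbhs_nbhs.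
have nk := tc _ (diff_eps dk eC).
near=> w; rewrite tE; split; first by near: w.
rewrite /= unplaneK.
have hw : `|k (t w) - k (h y) - 'd k (h y) (t w - h y)| <= e / (2 * (C + 1)) * `|t w - h y|.
  by near: w.
(* The derivative of [k] undoes that of [h], so the expansion of [k] reads [k (t w) = plane w] up to
   the remainder. *)
have E1 : 'd k (h y) (t w - h y) = plane w - y.
  by rewrite dkE /t [h y + _]addrC addrK -mulmxA jk mulmx1.
have E2 : k (h y) = y := nbhs_singleton kh.
rewrite E1 E2 opprB addrA subrK in hw.
have -> : unplane (k (t w)) - w = unplane (k (t w) - plane w) by rewrite unplaneB planeK.
apply: (le_trans (N1_le_norm _)).
have C00 : 0 <= C by rewrite addr_ge0.
have h2 : `|t w - h y| <= C * N1 (w - a).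
  apply: (le_trans (norm_le_N1 _)).
  by rewrite /t [h y + _]addrC addrK unplane_mul// unplaneB !planeK conf_le.
have h3 := le_trans hw (ler_wpM2l (ltW eC) h2).
have n0 : 0 <= N1 (w - a) by rewrite addr_ge0.
apply: (le_trans (ler_wpM2l (ler0n R 2) h3)).
by have [] := scale_le C00 (ltW e0) n0.
Unshelve. all: by end_near.
Qed.

End Jacobian.

Section Signed.
Context {R : realType}.

(** Applied to the positive and negative parts separately; the factor [p z ^+ 2 + q z ^+ 2] is
    nonnegative and passes through [Num.max]. *)
Lemma change_of_variables_signed (U V : set (R * R)) (h k : R * R -> R * R)
    (p q F : R * R -> R) : open U -> open V ->
  (forall z, U z -> V (h z)) -> (forall z, V z -> U (k z)) ->
  (forall z, U z -> k (h z) = z) -> (forall z, V z -> h (k z) = z) ->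
  (forall z, U z -> conf_tangent V h k z (p z) (q z)) ->
  (forall z, U z -> {for z, continuous h}) ->
  (forall z, V z -> {for z, continuous k}) ->
  (forall z, U z -> {for z, continuous (fun z => p z ^+ 2 + q z ^+ 2)}) ->
  (forall z, V z -> {for z, continuous F}) ->
  forall B : set (plane2 R), measurable B -> B `<=` U ->
  (\int[leb2 R]_(z in h @` B) (F z)%:E =
   \int[leb2 R]_(z in B) (F (h z) * (p z ^+ 2 + q z ^+ 2))%:E)%E.
Proof.
move=> oU oV hU kV hK kK hk hc kc Jc Fc B mB BU.
have J0 z : U z -> 0 <= p z ^+ 2 + q z ^+ 2 by move=> _; rewrite addr_ge0// sqr_ge0.
have cov (G : R * R -> R) : (forall z, V z -> {for z, continuous G}) -> (forall z, V z -> 0 <= G z) ->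
    (\int[leb2 R]_(z in h @` B) (G z)%:E =
     \int[leb2 R]_(z in B) (G (h z) * (p z ^+ 2 + q z ^+ 2))%:E)%E.
  by move=> Gc G0; exact: (conformal_change_of_variables oU oV hU kV hK kK hk).
rewrite [LHS]integralE [RHS]integralE; congr (_ - _)%E.
  transitivity (\int[leb2 R]_(z in h @` B) (Num.max (F z) 0)%:E)%E.
    by apply: eq_integral => z _; rewrite funeposE EFin_max.
  rewrite (cov (fun z => Num.max (F z) 0)).
  - apply: eq_integral => z; rewrite inE => Bz; rewrite funeposE -EFin_max; congr (_%:E).
    by rewrite maxr_pMl ?mul0r// J0//; exact: BU.
  - by move=> z Vz; apply: continuous_max; [exact: Fc|exact: cst_continuous].
  - by move=> z Vz; rewrite le_max lexx orbT.
transitivity (\int[leb2 R]_(z in h @` B) (Num.max (- F z) 0)%:E)%E.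
  by apply: eq_integral => z _; rewrite funenegE EFin_max EFinN.
rewrite (cov (fun z => Num.max (- F z) 0)).
- apply: eq_integral => z; rewrite inE => Bz; rewrite funenegE -EFinN -EFin_max; congr (_%:E).
  by rewrite maxr_pMl ?mul0r ?mulNr// J0//; exact: BU.
- move=> z Vz; apply: continuous_max; last exact: cst_continuous.
  by apply: continuousN; exact: Fc.
- by move=> z Vz; rewrite le_max lexx orbT.
Qed.
End Signed.

Section Charts.
Context {R : realType} {T : topologicalType} {n : nat}.
Implicit Types c d : chart R T n.

Lemma chart_imgP c y : (c @` dom c) y -> dom c (cinv c y) /\ c (cinv c y) = y.
Proof. by move=> [x dx <-]; rewrite cmapK. Qed.

Lemma chart_imgE c (A : set T) : A `<=` dom c ->
  c @` A = [set y | (c @` dom c) y /\ A (cinv c y)].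
Proof.
move=> Ac; apply/seteqP; split => [_ [x Ax <-]|y [/chart_imgP[dy cy] Ay]].
  by split; [exists x => //; exact: Ac|rewrite cmapK//; exact: Ac].
by exists (cinv c y).
Qed.

Lemma chart_img_open c (A : set T) : open A -> A `<=` dom c -> open (c @` A).
Proof.
move=> oA Ac; rewrite chart_imgE// openE => y [cy Ay].
apply: filterI; first by apply: open_nbhs_nbhs; split => //; exact: img_open.
by apply: (cinv_cont cy); apply: open_nbhs_nbhs.
Qed.

Lemma trans_dom_open c d : open (trans_dom c d).
Proof.
apply: chart_img_open; last by move=> ? [].
by apply: openI; exact: dom_open.
Qed.

Lemma trans_domP c d s : dom c s -> dom d s -> trans_dom c d (c s).
Proof. by move=> cs ds; exists s. Qed.

Lemma transE c d s : dom c s -> trans c d (c s) = d s.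
Proof. by move=> cs; rewrite /trans /= cmapK. Qed.

Lemma transK c d s : dom c s -> dom d s -> trans d c (trans c d (c s)) = c s.
Proof. by move=> cs ds; rewrite transE// transE. Qed.

(** Translates a property of nearby points of the manifold into one of nearby coordinates;
    expressions through different charts are compared in this way before being differentiated. *)
Lemma near_chart c (P : 'rV[R]_n -> Prop) s (A : set T) : open A -> A s -> dom c s ->
  (forall t, A t -> dom c t -> P (c t)) -> \forall y \near c s, P y.
Proof.
move=> oA As cs AP.
have oc : open (c @` (A `&` dom c)).
  by apply: chart_img_open; [apply: openI => //; exact: dom_open|move=> ? []].
have : nbhs (c s) (c @` (A `&` dom c)) by apply: open_nbhs_nbhs; split => //; exists s.
by apply: filterS => _ [t [At ct] <-]; exact: AP.
Qed.

End Charts.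

(** * Densities of 2-forms and change of chart *)

Section Surface.
Context {R : realType} {S : manifold R (1 + 1)}.
Hypothesis rS : riemann_surface S.
Local Notation E2 := 'rV[R]_(1 + 1).
Local Notation e0 := (delta_mx 0 ord0 : E2).
Local Notation e1 := (delta_mx 0 ord_max : E2).
Local Notation chartS := (chart R S (1 + 1)).

Lemma trans_smooth (c d : chartS) k : atlas c -> atlas d ->
  Ck_on k (trans_dom c d) (trans c d).
Proof. by move=> ac ad; exact: atlas_smooth. Qed.

Lemma trans_differentiable (c d : chartS) s : atlas c -> atlas d ->
  dom c s -> dom d s -> differentiable (trans c d) (c s).
Proof.
move=> ac ad cs ds; apply: (Ck_onS_diff (trans_smooth 1 ac ad)); exact: trans_domP.
Qed.

(* A density is the coefficient of a 2-form: it is multiplied by the jacobian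
   determinant of a change of chart. *)
Definition jac2 (c d : chartS) (s : S) : R :=
  let A := jacobian (trans c d) (c s) in A ord0 ord0 ^+ 2 + A ord0 ord_max ^+ 2.

Definition density (O : set S) (w : chartS -> E2 -> R) : Prop :=
  forall c d s, atlas c -> atlas d -> O s -> dom c s -> dom d s ->
    w c (c s) = jac2 c d s * w d (d s).

Definition density_cont (O : set S) (w : chartS -> E2 -> R) : Prop :=
  forall c s, atlas c -> O s -> dom c s -> {for c s, continuous (w c)}.

Definition cpre (c : chartS) (A : set S) : set (plane2 R) := [set q | (c @` A) (plane q)].

Definition chart_int (w : chartS -> E2 -> R) (c : chartS) (A : set S) : \bar R :=
  (\int[leb2 R]_(q in cpre c A) (w c (plane q))%:E)%E.

Lemma cpre_open (c : chartS) A : open A -> A `<=` dom c -> open (cpre c A : set (R * R)).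
Proof.
move=> oA Ac; apply: (open_comp (f := @plane R)).
  by move=> x _; exact: plane_continuous.
exact: chart_img_open.
Qed.

(** The transition map is conformal, and its area factor is exactly the one in the transformation
    rule of a density. *)
Lemma chart_int_change (O : set S) (w : chartS -> E2 -> R) (c d : chartS) (A : set S) :
  open O -> atlas c -> atlas d -> density O w -> density_cont O w ->
  A `<=` O `&` (dom c `&` dom d) -> measurable (cpre c A) -> chart_int w c A = chart_int w d A.
Proof.
move=> oO ac ad dw cw AO mA.
pose D := O `&` (dom c `&` dom d).
have oD : open D by apply: openI => //; apply: openI; exact: dom_open.
have Dc : D `<=` dom c by move=> ? [_ []].
have Dd : D `<=` dom d by move=> ? [_ []].
pose h := unplane \o trans c d \o @plane R; pose k := unplane \o trans d c \o @plane R.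
have hE q s : D s -> plane q = c s -> h q = unplane (d s).
  by move=> Ds E; rewrite /h/= E transE//; exact: Dc.
have kE q s : D s -> plane q = d s -> k q = unplane (c s).
  by move=> Ds E; rewrite /k/= E transE//; exact: Dd.
pose J q := jacobian (trans c d) (plane q).
pose p q := J q ord0 ord0; pose q' q := J q ord0 ord_max.
have diffc s : D s -> differentiable (trans c d) (c s).
  by move=> Ds; apply: trans_differentiable => //; [exact: Dc|exact: Dd].
have diffd s : D s -> differentiable (trans d c) (d s).
  by move=> Ds; apply: trans_differentiable => //; [exact: Dd|exact: Dc].
have cont (f : E2 -> E2) q : differentiable f (plane q) ->
    {for q, continuous (unplane \o f \o @plane R)}.
  move=> df; apply: (@continuous_comp _ _ _ (@plane R)); first exact: plane_continuous.
  apply: continuous_comp; last exact: unplane_continuous.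
  exact: differentiable_continuous.
rewrite /chart_int; have -> : cpre d A = h @` cpre c A.
  apply/seteqP; split => [q [s As sq]|_ [q [s As sq] <-]].
    exists (unplane (c s)); first by exists s => //; rewrite unplaneK.
    by rewrite (hE _ s) ?unplaneK ?sq ?planeK//; exact: AO.
  by exists s => //; rewrite (hE _ s) ?unplaneK//; exact: AO.
rewrite (@change_of_variables_signed _ (cpre c D) (cpre d D) h k p q').
- apply: eq_integral => q; rewrite inE => -[s As sq]; have Ds := AO s As.
  rewrite (hE q s)// unplaneK -sq (dw c d s)//; last 3 first.
  + by case: Ds.
  + exact: Dc.
  + exact: Dd.
  by congr (_%:E); rewrite mulrC /jac2 /p /q' /J sq.
- exact: cpre_open.
- exact: cpre_open.
- by move=> q [s Ds sq]; exists s => //; rewrite (hE _ s) ?unplaneK.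
- by move=> q [s Ds sq]; exists s => //; rewrite (kE _ s) ?unplaneK.
- by move=> q [s Ds sq]; rewrite (hE _ s) ?(kE _ s) ?unplaneK// sq planeK.
- by move=> q [s Ds sq]; rewrite (kE _ s) ?(hE _ s) ?unplaneK// sq planeK.
- move=> q [s Ds sq]; apply: conf_tangent_diff.
  + exact: cpre_open.
  + by exists s => //; rewrite unplaneK -sq transE//; exact: Dc.
  + by rewrite -sq; exact: diffc.
  + by rewrite -sq transE; [exact: diffd|exact: Dc].
  + rewrite -sq; apply: (near_chart oD Ds); first exact: Dc.
    by move=> t Dt _; rewrite transK//; [exact: Dc|exact: Dd].
  + rewrite -sq; apply: rS => //; apply: trans_domP; [exact: Dc|exact: Dd].
- by move=> q [s Ds sq]; apply: cont; rewrite -sq; exact: diffc.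
- by move=> q [s Ds sq]; apply: cont; rewrite -sq; exact: diffd.
- move=> q [s Ds sq].
  have jc j : {for q, continuous (fun q => J q ord0 j)}.
    apply: (@continuous_comp _ _ _ (@plane R) (fun y => jacobian (trans c d) y ord0 j)).
      exact: plane_continuous.
    apply: (@near_eq_continuous _ _ _ (fun y => ('D_e0 (trans c d) y) 0 j)).
      rewrite -sq; apply: (near_chart oD Ds); first exact: Dc.
      by move=> t Dt _; rewrite jacobianE//; exact: diffc.
    apply: (@continuous_comp _ _ _ ('D_e0 (trans c d)) (fun z : E2 => z 0 j)).
      have := Ck_onS_derive e0 (trans_smooth 1 ac ad); apply.
      by rewrite -sq; apply: trans_domP; [exact: Dc|exact: Dd].
    exact: coord_continuous.
  by apply: continuousD; [exact: (continuousM (jc ord0) (jc ord0))|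
    exact: (continuousM (jc ord_max) (jc ord_max))].
- move=> q [s Ds sq]; apply: (@continuous_comp _ _ _ (@plane R) (w d)).
    exact: plane_continuous.
  by rewrite -sq; apply: cw => //; [case: Ds|exact: Dd].
- by [].
- by move=> q [s As sq]; exists s => //; exact: AO.
Qed.

Definition dens (alpha : S -> 'M[R]_(1 + 1)) (c : chartS) (y : E2) : R :=
  local_form alpha c y ord0 ord_max.

Lemma pull_mul l m n (A : 'M[R]_(l, m)) (B : 'M[R]_(m, n)) (C : 'M[R]_n) :
  pull A (pull B C) = pull (A *m B) C.
Proof. by rewrite /pull trmx_mul !mulmxA. Qed.

(** Pulling back an antisymmetric 2 by 2 matrix multiplies its off-diagonal entry by the
    determinant, which is [a^2 + b^2] for a conformal matrix. *)
Lemma dens_density (alpha : S -> 'M[R]_(1 + 1)) :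
  (forall s, (alpha s)^T = - alpha s) -> density setT (dens alpha).
Proof.
move=> asym c d s ac ad _ cs ds; rewrite /dens /local_form !cmapK//.
pose e := chart_at s.
have ae : atlas e by exact: chart_at_atlas.
have es : dom e s by exact: chart_at_dom.
have E : dchart_inv c s = jacobian (trans c d) (c s) *m dchart_inv d s.
  rewrite /dchart_inv -/e -(transE d cs).
  rewrite -jacobian_comp.
  - apply/esym/near_eq_jacobian.
      apply: (@near_chart _ _ _ c _ s (dom d)) => //; first exact: dom_open.
      by move=> t dt ct; rewrite /= !transE.
    apply: differentiable_comp; first exact: trans_differentiable.
    by rewrite transE//; exact: trans_differentiable.
  - exact: trans_differentiable.
  - by rewrite transE//; exact: trans_differentiable.
have cA : conformal_mx (jacobian (trans c d) (c s)).
  by apply: rS => //; exact: trans_domP.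
rewrite /jac2 E; move: (jacobian _ _) (dchart_inv d s) cA => A D cA.
rewrite -pull_mul; set B := pull D _.
have BT : B^T = - B by rewrite /B /pull !trmx_mul trmxK asym mulNmx mulmxN mulmxA.
move: B BT => B BT.
have [E1 E2] := conformal_mxP cA.
have B10 : B ord_max ord0 = - B ord0 ord_max.
  by have /matrixP/(_ ord0 ord_max) := BT; rewrite !mxE.
have B00 : B ord0 ord0 = 0.
  have /matrixP/(_ ord0 ord0) := BT; rewrite !mxE => /eqP; rewrite -addr_eq0 -mulr2n mulrn_eq0 /=.
  by move/eqP.
have B11 : B ord_max ord_max = 0.
  have /matrixP/(_ ord_max ord_max) := BT; rewrite !mxE => /eqP; rewrite -addr_eq0 -mulr2n mulrn_eq0 /=.
  by move/eqP.
rewrite /pull !mxE !big_ord_recl !big_ord0 !mxE !big_ord_recl !big_ord0.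
have -> : lift ord0 ord0 = ord_max :> 'I_(1 + 1) by apply/val_inj.
rewrite E1 E2 B10 B00 B11; ring.
Qed.

End Surface.

(** * Independence of the integral from the cover *)

Section Cover.
Context {R : realType} {S : manifold R (1 + 1)}.
Hypothesis rS : riemann_surface S.
Local Notation E2 := 'rV[R]_(1 + 1).
Local Notation e0 := (delta_mx 0 ord0 : E2).
Local Notation e1 := (delta_mx 0 ord_max : E2).
Local Notation chartS := (chart R S (1 + 1)).

(* The coefficient of [df /\ dg] in the chart [c]. *)
Definition wed (f g : S -> R) (c : chartS) (y : E2) : R :=
  'D_e0 (f \o cinv c) y * 'D_e1 (g \o cinv c) y
  - 'D_e1 (f \o cinv c) y * 'D_e0 (g \o cinv c) y.

Definition chart_diff (O : set S) (f : S -> R) : Prop :=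
  forall c s, atlas c -> O s -> dom c s -> differentiable (f \o cinv c) (c s).

Lemma sum2E (F : 'I_(1 + 1) -> R) : \sum_i F i = F ord0 + F ord_max.
Proof.
rewrite !big_ord_recl big_ord0 addr0; congr (_ + F _); exact/val_inj.
Qed.

Lemma derive_conformal (F : E2 -> R) (h : E2 -> E2) (y : E2) :
  differentiable h y -> differentiable F (h y) -> conformal_mx (jacobian h y) ->
  let a := jacobian h y ord0 ord0 in let b := jacobian h y ord0 ord_max in
  'D_e0 (F \o h) y = a * 'D_e0 F (h y) + b * 'D_e1 F (h y) /\
  'D_e1 (F \o h) y = - b * 'D_e0 F (h y) + a * 'D_e1 F (h y).
Proof.
move=> dh dF /conformal_mxP[E1 E2] a b.
have E v : 'D_v (F \o h) y = 'D_e0 F (h y) * ('D_v h y) 0 ord0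
    + 'D_e1 F (h y) * ('D_v h y) 0 ord_max.
  apply: (etrans (derive_comp_rV v dh dF)).
  by rewrite sum2E.
split; apply: (etrans (E _)); rewrite -!(jacobianE _ _ dh) ?E1 ?E2 -/a -/b;
  by congr (_ + _); exact: mulrC.
Qed.

(** The two gradients are transformed by the same conformal matrix, whose determinant factors out of
    the wedge. *)
Lemma wed_density (O : set S) (f g : S -> R) : chart_diff O f -> chart_diff O g ->
  density O (wed f g).
Proof.
move=> df dg c d s ac ad Os cs ds.
have cA : conformal_mx (jacobian (trans c d) (c s)).
  by apply: rS => //; exact: trans_domP.
have dh := trans_differentiable ac ad cs ds.
have E (k : S -> R) v : 'D_v (k \o cinv c) (c s) = 'D_v ((k \o cinv d) \o trans c d) (c s).
  apply: near_eq_derive; apply: (@near_chart _ _ _ c _ s (dom d)) => //; first exact: dom_open.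
  by move=> t dt ct; rewrite /= transE// !cmapK.
have dk k : chart_diff O k -> differentiable (k \o cinv d) (trans c d (c s)).
  by move=> dk; rewrite transE//; exact: dk.
rewrite /wed !E /jac2.
have [-> ->] := derive_conformal dh (dk f df) cA.
have [-> ->] := derive_conformal dh (dk g dg) cA.
rewrite transE//; move: ('D_e0 _ _) ('D_e1 _ _) ('D_e0 _ _) ('D_e1 _ _) => f0 f1 g0 g1.
move: (jacobian _ _ _ _) (jacobian _ _ _ _) => a b; ring.
Qed.

(** Measurability is tested in charts, since [S] itself carries a topology and no sigma-algebra. *)
Definition borelS (A : set S) : Prop :=
  forall c : chartS, atlas c -> measurable (cpre c (A `&` dom c)).

Lemma cpreE (c : chartS) (A : set S) :
  cpre c (A `&` dom c) = cpre c (dom c) `&` [set q | A (cinv c (plane q))].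
Proof.
apply/seteqP; split => [q [s [As cs] sq]|q [[s cs sq] /= +]].
  by split; [exists s|rewrite /= -sq cmapK].
by rewrite -sq cmapK// => As; exists s.
Qed.

Lemma borel_open A : open A -> borelS A.
Proof.
move=> oA c ac; apply: open_measurable2; apply: cpre_open; last by move=> ? [].
by apply: openI => //; exact: dom_open.
Qed.

Lemma borelI A B : borelS A -> borelS B -> borelS (A `&` B).
Proof.
move=> bA bB c ac; have := measurableI _ _ (bA c ac) (bB c ac).
congr (measurable _); rewrite !cpreE; apply/seteqP; split => q.
  by move=> [[? ?] [? ?]].
by move=> [? [? ?]].
Qed.

Lemma borelD A B : borelS A -> borelS B -> borelS (A `\` B).
Proof.
move=> bA bB c ac; have := measurableD (bA c ac) (bB c ac).
congr (measurable _); rewrite !cpreE; apply/seteqP; split => q.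
  by move=> [[? ?] h]; split => //; split => // ?; apply: h.
by move=> [? [? h]]; split => // -[].
Qed.

Lemma borelU A B : borelS A -> borelS B -> borelS (A `|` B).
Proof.
move=> bA bB c ac; have := measurableU _ _ (bA c ac) (bB c ac).
congr (measurable _); rewrite !cpreE; apply/seteqP; split => q.
  by move=> [[? ?]|[? ?]]; split => //; [left|right].
by move=> [? [?|?]]; [left|right].
Qed.

Lemma borel_seqDU (A : nat -> set S) i : (forall i, borelS (A i)) -> borelS (seqDU A i).
Proof.
move=> bA; apply: borelD => //; elim: i => [|i IH].
  by rewrite big_ord0; apply: borel_open; exact: open0.
by rewrite big_ord_recr; exact: borelU.
Qed.

(** More general than the pieces in [surface_integral]: the [B j] may be smaller than the chart
    domains, which later allows pieces inside compact sets. *)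
Definition piecewise (m : nat) (d : nat -> chartS) (B : nat -> set S) : Prop :=
  [/\ forall j, (j < m)%N -> atlas (d j),
      forall j, (j < m)%N -> B j `<=` dom (d j),
      forall j, (j < m)%N -> borelS (B j),
      trivIset setT B &
      [set: S] `<=` \bigcup_(j in [set j | (j < m)%N]) B j].

Lemma cpre_measurable (c : chartS) A : atlas c -> borelS A -> A `<=` dom c ->
  measurable (cpre c A).
Proof. by move=> ac bA Ac; have := bA c ac; rewrite (setIidl Ac). Qed.

Lemma density_measurable (O : set S) w (c : chartS) (A : set S) : open O -> atlas c ->
  density_cont O w -> A `<=` O `&` dom c -> measurable (cpre c A) ->
  measurable_fun (cpre c A) (fun q => w c (plane q)).
Proof.
move=> oO ac cw AO mA.
have sub : cpre c A `<=` cpre c (O `&` dom c) by move=> q [s As sq]; exists s => //; exact: AO.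
have oc : open (cpre c (O `&` dom c) : set (R * R)).
  by apply: cpre_open; [apply: openI => //; exact: dom_open|move=> ? []].
apply: measurable_funS sub _; first exact: open_measurable2.
apply: continuous_measurable2 => // q [s [Os cs] sq].
apply: (@continuous_comp _ _ _ (@plane R) (w c)); first exact: plane_continuous.
by rewrite -sq; exact: cw.
Qed.

Lemma cpre_bigsetU (c : chartS) (A : set S) m d B : piecewise m d B ->
  cpre c A = \big[setU/set0]_(j < m) cpre c (A `&` B j).
Proof.
move=> [_ _ _ _ cov]; rewrite -(bigcup_mkord m (fun j => cpre c (A `&` B j))).
apply/seteqP; split => [q [s As sq]|q [j jm [s [As _] sq]]]; last by exists s.
by have [j jm Bs] := cov s I; exists j => //; exists s.
Qed.

Lemma cpre_trivIset (c : chartS) (A : set S) m d B : piecewise m d B -> A `<=` dom c ->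
  trivIset setT (fun j => cpre c (A `&` B j)).
Proof.
move=> [_ _ _ tB _] Ac i j _ _ [q [[s [As Bs] sq] [t [At Bt] tq]]].
apply: (tB i j) => //; exists s; split => //.
by have <- : t = s by rewrite -(cmapK (Ac _ As)) -(cmapK (Ac _ At)) sq tq.
Qed.

Lemma chart_int_split (O : set S) w (c : chartS) (A : set S) m d B : open O -> atlas c ->
  density_cont O w -> borelS A -> A `<=` O `&` dom c -> piecewise m d B ->
  chart_int w c A = (\sum_(j < m) chart_int w c (A `&` B j))%E.
Proof.
move=> oO ac cw bA AO P; have [_ _ bB _ _] := P.
have Ac : A `<=` dom c by move=> s /AO[].
have mA : measurable (cpre c A) by exact: cpre_measurable.
have E := cpre_bigsetU c A P.
have := @integral_bigsetU_EFin _ _ _ (leb2 R) _ (fun j : 'I_m => cpre c (A `&` B j))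
  (fun q => w c (plane q)) (index_enum _) _ (index_enum_uniq _) _ _.
rewrite -E; apply.
- move=> j; apply: cpre_measurable => //; first exact: borelI (bB _ _).
  by move=> s [/Ac].
- move=> i j _ _ h; apply/val_inj.
  exact: (cpre_trivIset P Ac I I h).
- by apply/measurable_EFinP; exact: density_measurable cw AO mA.
Qed.

(** Both sums are refined to the intersections of the pieces, where the chart may be changed. *)
Lemma chart_int_piecewise (O : set S) w (A : set S) m d B m' d' B' :
  open O -> density O w -> density_cont O w -> borelS A -> A `<=` O ->
  piecewise m d B -> piecewise m' d' B' ->
  (\sum_(j < m) chart_int w (d j) (A `&` B j) = \sum_(i < m') chart_int w (d' i) (A `&` B' i))%E.
Proof.
move=> oO dw cw bA AO P P'.
have [aP dP bP _ _] := P; have [aP' dP' bP' _ _] := P'.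
transitivity (\sum_(j < m) \sum_(i < m') chart_int w (d j) ((A `&` B j) `&` B' i))%E.
  apply: eq_bigr => j _; apply: (chart_int_split oO (aP _ _) cw _ _ P') => //.
    by apply: borelI => //; exact: bP.
  by move=> s [/AO As Bs]; split => //; exact: dP Bs.
rewrite exchange_big /=; apply: eq_bigr => i _.
transitivity (\sum_(j < m) chart_int w (d' i) ((A `&` B' i) `&` B j))%E.
  apply: eq_bigr => j _; rewrite setIAC; apply: (chart_int_change rS oO) => //.
  - exact: aP.
  - exact: aP'.
  - move=> s [[/AO As Bi] Bj]; split => //; split; [exact: dP Bj|exact: dP' Bi].
  - apply: cpre_measurable; first exact: aP.
      by apply: borelI; [apply: borelI => //; exact: bP'|exact: bP].
    by move=> s [_ Bj]; exact: dP Bj.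
apply/esym; apply: (chart_int_split oO (aP' _ _) cw _ _ P) => //.
  by apply: borelI => //; exact: bP'.
by move=> s [/AO As Bs]; split => //; exact: dP' Bs.
Qed.

Lemma piecewise_seqDU m d (U : nat -> set S) :
  (forall j, (j < m)%N -> atlas (d j)) -> (forall j, open (U j)) ->
  (forall j, (j < m)%N -> U j `<=` dom (d j)) ->
  [set: S] `<=` \bigcup_(j in [set j | (j < m)%N]) U j -> piecewise m d (seqDU U).
Proof.
move=> ad oU Ud cov; split => //.
- by move=> j jm s [/(Ud _ jm)].
- by move=> j _; apply: borel_seqDU => i; exact: borel_open.
- move=> s Ts; have [i im Ui] := cov s Ts.
  have [j [Uj jmin]] : exists j, U j s /\ forall l, (l < j)%N -> ~ U l s.
    have ex : exists i, `[< U i s >] by exists i; apply/asboolP.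
    exists (ex_minn ex); case: ex_minnP => j /asboolP Uj jmin; split => // l lj Ul.
    by have := jmin l (asboolT Ul); rewrite leqNgt lj.
  exists j; first by rewrite /= (leq_ltn_trans _ im)// leqNgt; apply/negP => /jmin/(_ Ui).
  split => //; rewrite -(bigcup_mkord j U) => -[l /= lj].
  exact: jmin.
Qed.

(** The given decomposition proves that finite covers exist, so [xget] returns the sum of some
    cover, which agrees with this one by refinement. Continuity is asked on [O] only, since the
    cylinder forms are singular over [p]. *)
Lemma surface_integralE (O A : set S) (alpha : S -> 'M[R]_(1 + 1)) m d B :
  open O -> (forall s, (alpha s)^T = - alpha s) -> density_cont O (dens alpha) ->
  borelS A -> A `<=` O -> piecewise m d B ->
  surface_integral A alpha = (\sum_(j < m) chart_int (dens alpha) (d j) (A `&` B j))%E.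
Proof.
move=> oO asym cw bA AO P; have [aP dP bP tP cP] := P.
have dw : density O (dens alpha).
  by move=> c d' s ac ad _; exact: dens_density.
pose Q := [set I | exists (k : nat) (c : nat -> chartS),
    [/\ forall i, (i < k)%N -> atlas (c i),
        [set: S] `<=` \bigcup_(i in [set i | (i < k)%N]) dom (c i) &
        I = (\sum_(i < k)
               chart_integral (c i) (A `&` seqDU (fun i => dom (c i)) i)
                 alpha)%E]].
have : Q (surface_integral A alpha).
  apply: xgetPex; eexists; exists m, d; split => //.
  by move=> s /cP[j jm Bs]; exists j => //; exact: dP Bs.
move=> [k [c [ac cc ->]]].
apply: (@chart_int_piecewise O (dens alpha) A k c (seqDU (fun i => dom (c i)))) => //.
by apply: piecewise_seqDU => // [i|i _ s //]; exact: dom_open.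
Qed.

End Cover.

(** * Stokes' theorem on closed Riemann surfaces *)

Section SurfaceStokes.
Context {R : realType} {S : manifold R (1 + 1)}.
Hypothesis rS : riemann_surface S.
Local Notation E2 := 'rV[R]_(1 + 1).
Local Notation e0 := (delta_mx 0 ord0 : E2).
Local Notation e1 := (delta_mx 0 ord_max : E2).
Local Notation chartS := (chart R S (1 + 1)).

Definition CkS (k : nat) (O : set S) (f : S -> R) : Prop :=
  forall c : chartS, atlas c -> Ck_on k (c @` (O `&` dom c)) (f \o cinv c).

Lemma cimg_open (c : chartS) (O : set S) : open O -> open (c @` (O `&` dom c)).
Proof.
move=> oO; apply: chart_img_open; last by move=> ? [].
by apply: openI => //; exact: dom_open.
Qed.

Lemma CkS_sub k (O O' : set S) f : O' `<=` O -> CkS k O f -> CkS k O' f.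
Proof.
move=> OO h c ac; apply: Ck_on_sub (h c ac) => _ [s [Os cs] <-].
by exists s => //; split => //; exact: OO.
Qed.

Lemma CkS_local k (O : set S) f :
  (forall s, O s -> exists2 O', O' s & CkS k O' f) -> CkS k O f.
Proof.
move=> h c ac; apply: Ck_on_local => _ [s [Os cs] <-].
have [P Ps ck] := h s Os; exists (c @` (P `&` dom c)); last exact: ck.
by exists s.
Qed.

Lemma CkS_eq k (O : set S) f g : open O -> (forall s, O s -> f s = g s) ->
  CkS k O f -> CkS k O g.
Proof.
move=> oO fg h c ac; apply: Ck_on_eq (h c ac); first exact: cimg_open.
by move=> _ [s [Os cs] <-] /=; rewrite cmapK// fg.
Qed.

Lemma CkS_cst k (O : set S) (a : R) : CkS k O (cst a).
Proof. by move=> c ac; exact: Ck_on_cst. Qed.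

Lemma CkS_mul k (O : set S) f g : open O -> CkS k O f -> CkS k O g -> CkS k O (f \* g).
Proof. by move=> oO hf hg c ac; exact: (Ck_on_mul (cimg_open oO) (hf c ac) (hg c ac)). Qed.

Lemma CkS_sum k (O : set S) (I : Type) (s : seq I) (f : I -> S -> R) : open O ->
  (forall i, CkS k O (f i)) -> CkS k O (fun x => \sum_(i <- s) f i x).
Proof.
move=> oO h c ac.
exact: (@Ck_on_sum _ _ _ k _ I s (fun i => f i \o cinv c) (cimg_open oO) (fun i => h i c ac)).
Qed.

Lemma CkS_comp_real (O : set S) f (g g' : R -> R) : open O -> CkS 1 O f ->
  (forall s, O s -> is_derive (f s : R) (1 : R) g (g' (f s))) ->
  (forall s, O s -> {for f s, continuous g'}) -> CkS 1 O (g \o f).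
Proof.
move=> oO hf dg cg c ac.
apply: (@C1_comp_real _ _ _ (f \o cinv c) g g' (cimg_open oO) (hf c ac)) => _ [s [Os cs] <-] /=;
  by rewrite cmapK//; (exact: dg || exact: cg).
Qed.

Lemma CkS_chart k (d : chartS) (F : E2 -> R) : atlas d -> Ck_on k setT F ->
  CkS k (dom d) (F \o d).
Proof.
move=> ad hF c ac; rewrite setIC.
apply: (@Ck_on_comp _ _ _ k _ setT F (trans c d)) => //.
- exact: trans_dom_open.
- exact: trans_smooth.
Qed.

Lemma CkS_zero k (K : set S) f : closed K -> (forall s, ~ K s -> f s = 0) -> CkS k (~` K) f.
Proof.
move=> cK f0; apply: CkS_eq (CkS_cst k _ 0); first exact: closed_openC.
by move=> s Ks; rewrite f0.
Qed.

Lemma CkS_ext k (O K : set S) f : closed K -> K `<=` O -> (forall s, ~ K s -> f s = 0) ->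
  CkS k O f -> CkS k setT f.
Proof.
move=> cK KO f0 h; apply: CkS_local => s _; have [Ks|nKs] := pselect (K s).
  by exists O => //; exact: KO.
by exists (~` K) => //; exact: CkS_zero.
Qed.

Lemma CkS_diff (O : set S) f : CkS 1 O f -> chart_diff O f.
Proof. by move=> h c s ac Os cs; have [df _] := h c ac; apply: df; exists s. Qed.

Lemma wed_cont (O : set S) f g : CkS 1 O f -> CkS 1 O g -> density_cont O (wed f g).
Proof.
move=> hf hg c s ac Os cs; have [_ cf] := hf c ac; have [_ cg] := hg c ac.
have cs' : (c @` (O `&` dom c)) (c s) by exists s.
have h v : {for c s, continuous ('D_v (f \o cinv c))} by exact: cf.
have k v : {for c s, continuous ('D_v (g \o cinv c))} by exact: cg.
exact: (continuousB (continuousM (h e0) (k e1)) (continuousM (h e1) (k e0))).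
Qed.

Lemma derive_zero (c : chartS) (f : S -> R) (v : E2) (K : set S) s : closed K -> ~ K s -> dom c s ->
  (forall s, ~ K s -> f s = 0) -> \forall y \near c s, 'D_v (f \o cinv c) y = 0 :> R.
Proof.
move=> cK nK cs f0; have oK : open (~` K) by exact: closed_openC.
apply: (near_chart oK nK cs) => t nKt ct.
rewrite -(derive_cst (0 : R) (c t) v); apply: near_eq_derive.
by apply: (near_chart oK nKt ct) => r nKr cr /=; rewrite cmapK// f0.
Qed.

Section Support.
Variables (O K : set S) (f g : S -> R).
Hypotheses (cK : closed K) (KO : K `<=` O) (f0 : forall s, ~ K s -> f s = 0).

Lemma wed_zero (c : chartS) s : ~ K s -> dom c s -> wed f g c (c s) = 0.
Proof.
move=> nK cs; have h v : 'D_v (f \o cinv c) (c s) = 0 := nbhs_singleton (derive_zero v cK nK cs f0).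
by rewrite /wed !h !mul0r subrr.
Qed.

(** [g] is regular on [O] alone, but off [K] the form vanishes together with [f], so it is a density
    on the whole surface. *)
Lemma wed_density_ext : chart_diff O f -> chart_diff O g -> density setT (wed f g).
Proof.
move=> df dg c d s ac ad _ cs ds; have [/KO Os|nK] := pselect (K s).
  exact: (wed_density rS df dg).
by rewrite !wed_zero// mulr0.
Qed.

Lemma wed_cont_ext : CkS 1 O f -> CkS 1 O g -> density_cont setT (wed f g).
Proof.
move=> hf hg c s ac _ cs; have [/KO Os|nK] := pselect (K s).
  exact: wed_cont hf hg c s ac Os cs.
have h v := derive_zero v cK nK cs f0.
apply: (@near_eq_continuous _ _ _ (cst 0)); last exact: cst_continuous.
by near=> y; rewrite /wed/= (near (h e0) y)// (near (h e1) y)// !mul0r subrr.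
Unshelve. all: by end_near. Qed.

End Support.

Lemma compact_closed_surface (K : set S) : hausdorff_space S -> compact K -> closed K.
Proof. by move=> hS; exact: compact_closed. Qed.

Lemma chart_int_support w (c : chartS) (A K : set S) :
  measurable (cpre c A) -> measurable (cpre c (A `&` K)) ->
  (forall s, A s -> ~ K s -> w c (c s) = 0) -> chart_int w c A = chart_int w c (A `&` K).
Proof.
move=> mA mAK w0; rewrite /chart_int integral_mkcond [RHS]integral_mkcond.
apply: eq_integral => q _; rewrite !patchE; case: ifPn => [|/negP]; rewrite inE => qA.
  case: ifPn => [//|/negP]; rewrite inE => nq; case: qA => s As sq.
  by rewrite -sq w0// => Ks; apply: nq; exists s.
by rewrite ifF//; apply/negP; rewrite inE => -[s [As _] sq]; apply: qA; exists s.
Qed.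

Lemma stokes_chart (O K : set S) (f g : S -> R) (c : chartS) : hausdorff_space S ->
  open O -> compact K -> atlas c -> K `<=` O `&` dom c -> (forall s, ~ K s -> f s = 0) ->
  CkS 1 O f -> CkS 2 O g -> chart_int (wed f g) c (dom c) = 0%E.
Proof.
move=> hS oO cK ac KO f0 hf hg.
have clK : closed K by exact: compact_closed_surface.
(* Extension by zero: outside the image of the chart the values of [cinv c] are arbitrary. *)
pose F (y : E2) : R := if y \in c @` dom c then f (cinv c y) else 0.
have oI : open (c @` dom c) by exact: img_open.
have FE y : (c @` dom c) y -> F y = f (cinv c y) by move=> h; rewrite /F mem_set.
have cKc : compact (c @` K).
  apply: continuous_compact => //; apply: continuous_in_subspaceT => s.
  by rewrite inE => /KO[_ cs]; exact: cmap_cont.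
have [M [_ MK]] := compact_bounded cKc.
have F0 y : ~ (c @` K) y -> F y = 0.
  move=> nK; rewrite /F; case: ifPn => //; rewrite inE => /chart_imgP[cy ycy].
  by apply: f0 => Ky; apply: nK; exists (cinv c y).
have sub : c @` (O `&` dom c) `<=` c @` dom c by move=> _ [s [_ cs] <-]; exists s.
(* Boundedness holds for every constant above [M], in particular [|M| + 1]; one more unit makes the
   inequality strict. *)
rewrite -[RHS](@planar_stokes _ (c @` (O `&` dom c)) (c @` K) F (g \o cinv c) (`|M| + 2)).
- rewrite /chart_int integral_mkcond; apply: eq_integral => q _; rewrite patchE.
  case: ifPn => [|/negP]; rewrite inE; [move=> [s cs sq]|move=> nq].
    have E : {near c s, F =1 f \o cinv c}.
      apply: (near_chart (dom_open c) cs cs) => t ct _; rewrite /= FE//; by exists t.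
    have D v : 'D_v F (c s) = 'D_v (f \o cinv c) (c s) by exact: near_eq_derive.
    by rewrite -sq /wed !D.
  have z v : 'D_v F (plane q) = 0.
    rewrite -(derive_cst (0 : R) (plane q) v); apply: near_eq_derive.
    have oK : open (~` (c @` K)) by apply: closed_openC; apply: compact_closed => //; exact: norm_hausdorff.
    apply: (near_open oK) => [[s Ks sq]|y nKy]; last exact: F0.
    by apply: nq; exists s => //; case: (KO s Ks).
  by rewrite !z !mul0r subrr.
- by rewrite ltr_wpDl.
- exact: cimg_open.
- apply: compact_closed => //; exact: norm_hausdorff.
- by move=> _ [s Ks <-]; exists s => //; exact: KO.
- move=> y Ky; have h : `|y| <= `|M| + 1 by apply: MK => //; rewrite ltr_pwDr// ler_norm.
  by split; apply: (le_lt_trans (le_coord_norm _ _)); apply: (le_lt_trans h); rewrite ltrD2l ltr1n.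
- exact: F0.
- apply: Ck_on_eq (hf c ac); first exact: cimg_open.
  by move=> y /sub h; rewrite FE.
- exact: hg.
Qed.

(** The form lives in a single chart [c]. On each piece it may be restricted to [dom c] and moved to
    that chart, so the sum is the integral over [dom c]. *)
Lemma stokes_local (O K : set S) (f g : S -> R) (c : chartS) m d B : hausdorff_space S ->
  open O -> compact K -> atlas c -> K `<=` O `&` dom c -> (forall s, ~ K s -> f s = 0) ->
  CkS 1 O f -> CkS 2 O g -> piecewise m d B ->
  (\sum_(j < m) chart_int (wed f g) (d j) (B j) = 0)%E.
Proof.
move=> hS oO cK ac KO f0 hf hg P; have [aP dP bP _ _] := P.
have clK : closed K by exact: compact_closed_surface.
have KO' : K `<=` O by move=> s /KO[].
have hg1 : CkS 1 O g by move=> e ae; exact: Ck_on_pred (hg e ae).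
have dw := wed_density_ext clK KO' f0 (CkS_diff hf) (CkS_diff hg1).
have cw := wed_cont_ext clK KO' f0 hf hg1.
have bc : borelS (dom c) by apply: borel_open; exact: dom_open.
apply: etrans (stokes_chart hS oO cK ac KO f0 hf hg).
rewrite (chart_int_split openT ac cw bc _ P); last by move=> s cs; split.
apply: eq_bigr => j _; rewrite setIC.
have aj := aP j (ltn_ord j); have dj := dP j (ltn_ord j); have bj := bP j (ltn_ord j).
have mj : measurable (cpre (d j) (B j `&` dom c)).
  by apply: cpre_measurable => //; [exact: borelI|move=> s [/dj]].
transitivity (chart_int (wed f g) (d j) (B j `&` dom c)).
  have E : B j `&` dom c = B j `&` (dom c `&` dom (d j)).
    by apply/seteqP; split => s; [move=> [Bs cs]; split => //; split => //; exact: dj|move=> [? []]].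
  rewrite E; apply: chart_int_support => //.
  - exact: cpre_measurable.
  - by rewrite -E.
  - move=> s Bs ncs; apply: (wed_zero g clK f0); last exact: dj.
    by move=> /KO[_ cs]; apply: ncs; split => //; exact: dj.
apply: (chart_int_change rS openT) => //.
by move=> s [Bs cs]; split => //; split => //; exact: dj.
Qed.

End SurfaceStokes.

Section PosSquare.
Context {R : realType}.

(** A quadratic remainder gives the derivative at once, without treating the kink of a positive part
    as a separate point. *)
Lemma is_derive_quadratic (f : R -> R) (x l : R) :
  (forall y, `|f y - f x - l * (y - x)| <= (y - x) ^+ 2) -> is_derive x (1 : R) f l.
Proof.
move=> h.
have L : (fun t : R => t^-1 *: (f (t *: (1 : R) + x) - f x)) @ 0^' --> l.
  apply/cvgrPdist_le => e e0; near=> t.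
  have t0 : t != 0 by near: t; exact: nbhs_dnbhs_neq.
  have te : `|t| <= e.
    near: t; apply: nbhs_dnbhs; exists e => //= z; rewrite /ball/= sub0r normrN; exact: ltW.
  have := h (t + x); rewrite addrK => ht.
  rewrite [t *: 1]mulr1 -normrN opprB.
  have -> : t^-1 *: (f (t + x) - f x) - l = t^-1 * (f (t + x) - f x - l * t).
    by rewrite -[l in LHS](mulKf t0) -mulrBr [t * l]mulrC.
  rewrite normrM normfV ler_pdivrMl ?normr_gt0//.
  apply: (le_trans ht); rewrite -[t ^+ 2]ger0_norm ?sqr_ge0// normrX expr2.
  by rewrite ler_wpM2l.
by apply: DeriveDef; [exact: cvgP L|exact: cvg_lim L].
Unshelve. all: by end_near. Qed.

(** The building block of all bumps and cut-offs: C^1, and positive exactly on the positive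
    half-line. *)
Definition possq (x : R) : R := Num.max x 0 ^+ 2.

Lemma is_derive_possq (x : R) : is_derive x (1 : R) possq (2 * Num.max x 0).
Proof.
apply: is_derive_quadratic => y; rewrite /possq.
have h1 := sqr_ge0 (y - x); have h2 := sqr_ge0 x; have h3 := sqr_ge0 y.
case: (ltP x 0) => x0; case: (ltP y 0) => y0; rewrite ler_norml; apply/andP; split; nra.
Qed.

Lemma possq_deriv_continuous : continuous (fun x : R => 2 * Num.max x 0).
Proof.
move=> x; apply: cvgM; first exact: cvg_cst.
by apply: continuous_max; [exact: cvg_id|exact: cst_continuous].
Qed.

Lemma possq_ge0 (x : R) : 0 <= possq x. Proof. exact: sqr_ge0. Qed.

Lemma possq_neq0 (x : R) : possq x != 0 -> 0 < x.
Proof.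
rewrite /possq; case: (ltP x 0) => x0; first by rewrite expr0n eqxx.
by rewrite sqrf_eq0 lt_def x0 andbT.
Qed.

Lemma possq_gt0 (x : R) : 0 < x -> 0 < possq x.
Proof. by move=> x0; rewrite /possq (max_idPl (ltW x0)) exprn_gt0. Qed.

End PosSquare.

(** Without a finite subcover, the complements of finite unions generate a proper filter; at a
    cluster point [s] of it, the neighbourhood [U s] meets its own complement. *)
Lemma compact_seq_cover (T : topologicalType) (U : T -> set T) :
  compact [set: T] -> (forall p, open (U p)) -> (forall p, U p p) ->
  exists sq : seq T, forall s, exists2 p, p \in sq & U p s.
Proof.
move=> cT oU Up; apply: contrapT => /forallNP h.
pose F := filter_from [set: seq T] (fun sq => [set s | forall p, p \in sq -> ~ U p s]).
have FF : ProperFilter F.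
  apply: filter_from_proper; last first.
    move=> sq _; have /existsNP[s /forall2NP hs] := h sq.
    by exists s => p psq; case: (hs p).
  apply: filter_from_filter; first by exists [::].
  move=> i j _ _; exists (i ++ j) => // s hs; split => p pi; apply: hs;
    by rewrite mem_cat pi ?orbT.
have [s [_ cs]] := cT F FF filterT.
have FU : F (~` U s) by exists [:: s] => // t /(_ s (mem_head _ _)).
by have [t []] := cs _ _ FU (open_nbhs_nbhs (conj (oU s) (Up s))).
Qed.

(** * C^1 partitions of unity and Stokes on the closed surface *)

Section NiceCover.
Context {R : realType} {S : manifold R (1 + 1)}.
Hypothesis rS : riemann_surface S.
Hypothesis hS : hausdorff_space S.
Hypothesis cS : compact [set: S].
Local Notation E2 := 'rV[R]_(1 + 1).
Local Notation e0 := (delta_mx 0 ord0 : E2).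
Local Notation e1 := (delta_mx 0 ord_max : E2).
Local Notation chartS := (chart R S (1 + 1)).

Lemma CkS_continuous (f : S -> R) : CkS 0 setT f -> continuous f.
Proof.
move=> h s; pose c := chart_at s; have cs : dom c s by exact: chart_at_dom.
have hc : {for s, continuous ((f \o cinv c) \o c)}.
  apply: continuous_comp; first exact: cmap_cont.
  by apply: (h c (chart_at_atlas s)); exists s.
rewrite /prop_for /continuous_at/= cmapK// in hc.
apply: cvg_trans hc; apply: near_eq_cvg.
have : nbhs s (dom c) by apply: open_nbhs_nbhs; split => //; exact: dom_open.
by apply: filterS => t ct; rewrite /= cmapK.
Qed.

Lemma local_bump (p : S) : exists (K : set S) (b : S -> R),
  [/\ compact K, K `<=` dom (chart_at p), forall s, ~ K s -> b s = 0,
    CkS 1 setT b & (forall s, 0 <= b s) /\ 0 < b p].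
Proof.
pose c := chart_at p; have cp : dom c p by exact: chart_at_dom.
have : nbhs (c p) (c @` dom c).
  by apply: open_nbhs_nbhs; split; [exact: img_open|exists p].
move=> /nbhs_ballP[r /= r0 rc].
have r2 : 0 < r / 2 by rewrite divr_gt0.
pose K' := closed_ball (c p) (r / 2).
have K'c : K' `<=` c @` dom c.
  move=> y; rewrite /K' closed_ballE// /closed_ball_/= => h; apply: rc.
  by rewrite -ball_normE/=; apply: (le_lt_trans h); rewrite ltr_pdivrMr// ltr_pMr// ltr1n.
have cK' : compact K'.
  apply: bounded_closed_compact; last exact: closed_ball_closed.
  exists (`|c p| + r / 2); split; first exact: num_real.
  move=> x Mx y; rewrite /= /K' closed_ballE// /closed_ball_/= distrC => h.
  rewrite -[y](subrK (c p)); apply: (le_trans (ler_normD _ _)).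
  by rewrite addrC (le_trans _ (ltW Mx))// lerD2l.
(* Where [G] is positive each coordinate of the displacement is below [r / 4], so the norm is below
   [r / 2] and the point lies in the compact ball [K']. *)
pose G (y : E2) : R := (r / 4) ^+ 2 - \sum_i (y 0 i - c p 0 i) ^+ 2.
have CG : Ck_on 1 setT G.
  have CX i : Ck_on 1 setT (fun y : E2 => y 0 i - c p 0 i).
    apply: (@Ck_on_add _ _ _ 1 setT (fun y : E2 => y 0 i) (cst (- c p 0 i)) openT);
      last exact: Ck_on_cst.
    exact: Ck_on_coordinate.
  have -> : G = cst ((r / 4) ^+ 2) \+ (fun y => \sum_i (- 1) * ((y 0 i - c p 0 i) * (y 0 i - c p 0 i))).
    by apply/funext => y; rewrite /G/= -mulr_sumr mulN1r.
  apply: Ck_on_add; [exact: openT|exact: Ck_on_cst|].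
  apply: Ck_on_sum; first exact: openT.
  move=> i; apply: (@Ck_on_mul _ _ 1 setT (cst (-1))); [exact: openT|exact: Ck_on_cst|].
  exact: (@Ck_on_mul _ _ 1 setT _ _ openT (CX i) (CX i)).
have CF : Ck_on 1 setT (possq \o G).
  apply: (@C1_comp_real _ _ setT G possq (fun x => 2 * Num.max x 0)) => //.
  - exact: openT.
  - by move=> y _; exact: is_derive_possq.
  - by move=> y _; exact: possq_deriv_continuous.
have GK y : possq (G y) != 0 -> K' y.
  move=> /possq_neq0; rewrite /G sum2E subr_gt0 => h.
  rewrite /K' closed_ballE// /closed_ball_/= distrC; apply: (le_trans (norm_le_N1 _)).
  rewrite unplaneB /N1 /unplane/=.
  have : (0 < r / 4) by rewrite divr_gt0.
  move: (y 0 ord0 - _) (y 0 ord_max - _) h => a b h r4.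
  have ha : `|a| < r / 4.
    by rewrite -(ltr_pXn2r (n := 2))// ?nnegrE ?(ltW r4)// real_normK ?num_real//; nra.
  have hb : `|b| < r / 4.
    by rewrite -(ltr_pXn2r (n := 2))// ?nnegrE ?(ltW r4)// real_normK ?num_real//; nra.
  lra.
pose b s : R := if s \in dom c then possq (G (c s)) else 0.
have bE s : dom c s -> b s = possq (G (c s)) by move=> h; rewrite /b mem_set.
have cK : compact (cinv c @` K').
  apply: continuous_compact => //; apply: continuous_in_subspaceT => y.
  by rewrite inE => /K'c; exact: cinv_cont.
have Kd : cinv c @` K' `<=` dom c.
  by move=> _ [y /K'c[s cs <-] <-]; rewrite cmapK.
have b0 s : ~ (cinv c @` K') s -> b s = 0.
  move=> nK; rewrite /b; case: ifPn => //; rewrite inE => cs.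
  apply/eqP; apply: contra_notT nK => /GK h; exists (c s) => //; exact: cmapK.
exists (cinv c @` K'), b; split => //.
- apply: (CkS_ext (compact_closed_surface hS cK) Kd b0).
  apply: CkS_eq (CkS_chart (chart_at_atlas p) CF); first exact: dom_open.
  by move=> s cs; rewrite bE.
- split; first by move=> s; rewrite /b; case: ifP => // _; exact: possq_ge0.
  rewrite bE// possq_gt0// /G big1 ?subr0 ?exprn_gt0 ?divr_gt0//.
  by move=> i _; rewrite subrr expr0n.
Qed.

(** Pieces inside compact subsets of charts make continuous densities integrable, hence integrals
    additive; the partition of unity reduces Stokes' theorem to one chart. *)
Record nice_cover (m : nat) (d : nat -> chartS) (B : nat -> set S) (theta : nat -> S -> R)
  : Prop := NiceCover {
  nc_piecewise : piecewise m d B ;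
  nc_compact : forall j, (j < m)%N -> exists K, [/\ compact K, K `<=` dom (d j), B j `<=` K &
    forall s, ~ K s -> theta j s = 0] ;
  nc_C1 : forall j, CkS 1 setT (theta j) ;
  nc_sum : forall s, \sum_(j < m) theta j s = 1 }.

Lemma nice_cover_exists (s0 : S) : exists m d B theta, nice_cover m d B theta.
Proof.
have /choice[Kb Kbp] : forall p : S, exists Kb : set S * (S -> R),
  [/\ compact Kb.1, Kb.1 `<=` dom (chart_at p), forall s, ~ Kb.1 s -> Kb.2 s = 0,
    CkS 1 setT Kb.2 & (forall s, 0 <= Kb.2 s) /\ 0 < Kb.2 p].
  by move=> p; have [K [b h]] := local_bump p; exists (K, b).
pose K p := (Kb p).1; pose b p := (Kb p).2.
have oU p : open [set s | 0 < b p s].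
  apply: (open_comp (f := b p) (D := [set x | 0 < x])); last exact: open_gt.
  move=> s _; apply: CkS_continuous => c ac; apply: Ck_on_pred.
  by have [_ _ _ h _] := Kbp p; exact: h.
have Ub p : 0 < b p p by have [_ _ _ _ []] := Kbp p.
have [sq cov] := compact_seq_cover cS oU Ub.
(* [s0] is merely the default value of [nth]. *)
pose m := size sq; pose pt j := nth s0 sq j.
pose tot s : R := \sum_(j < m) b (pt j) s.
have b0 p s : 0 <= b p s by have [_ _ _ _ [h _]] := Kbp p; exact: h.
have UC : [set: S] `<=` \bigcup_(j in [set j | (j < m)%N]) [set s | 0 < b (pt j) s].
  move=> s _; have [p pD bp] := cov s; exists (index p sq); first by rewrite /= index_mem.
  by rewrite /= /pt nth_index.
have tot0 s : 0 < tot s.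
  have [j jm bj] := UC s I; rewrite /tot (bigD1 (Ordinal jm))//=.
  by rewrite ltr_pwDl// sumr_ge0.
have Cb p : CkS 1 setT (b p) by have [_ _ _ h _] := Kbp p.
have Ctot : CkS 1 setT tot by apply: CkS_sum => //; exact: openT.
(* The pieces are cut out of the sets where the bumps are positive, so each lies in the compact set
   carrying its bump. *)
exists m, (fun j => chart_at (pt j)), (seqDU (fun j => [set s | 0 < b (pt j) s])).
exists (fun j => (fun s => b (pt j) s * (tot s)^-1)); split.
- apply: piecewise_seqDU => //.
    by move=> j _; exact: chart_at_atlas.
  move=> j _ s /= bs; have [_ Kd b0' _ _] := Kbp (pt j).
  by apply: Kd; apply: contrapT => /b0' h; move: bs; rewrite /b h ltxx.
- move=> j _; have [cK Kd b0' _ _] := Kbp (pt j); exists (K (pt j)); split => //.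
    by move=> s [/= bs _]; apply: contrapT => /b0' h; move: bs; rewrite /b h ltxx.
  by move=> s /b0' h; rewrite /b h mul0r.
- move=> j; apply: (@CkS_mul _ _ 1 setT (b (pt j)) (fun s => (tot s)^-1));
    [exact: openT|exact: Cb|].
  apply: (@CkS_comp_real _ _ setT tot (fun x => x^-1) (fun x => - x ^- 2)).
  + exact: openT.
  + exact: Ctot.
  + move=> s _; have t0 : tot s != 0 by exact: lt0r_neq0.
    exact: is_derive_inv.
  + move=> s _; have t0 : tot s != 0 by exact: lt0r_neq0.
    apply: continuousN; apply: continuousV; first by rewrite expf_neq0.
    exact: exprn_continuous.
- by move=> s; rewrite -mulr_suml; exact: (divff (lt0r_neq0 (tot0 s))).
Qed.

Section Integrals.
Variables (m : nat) (d : nat -> chartS) (B : nat -> set S) (theta : nat -> S -> R).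
Hypothesis nc : nice_cover m d B theta.

Definition total (w : chartS -> E2 -> R) : \bar R := (\sum_(j < m) chart_int w (d j) (B j))%E.

Lemma piece_measurable (j : nat) A : (j < m)%N -> borelS A -> measurable (cpre (d j) (A `&` B j)).
Proof.
move=> jm bA; have [aP dP bP _ _] := nc_piecewise nc.
apply: cpre_measurable; [exact: aP|apply: borelI => //; exact: bP|].
by move=> s [_ /(dP _ jm)].
Qed.

(** The compact set around the piece has bounded coordinates and bounded density: a bounded function
    on a set of finite area. *)
Lemma piece_integrable (j : nat) (w : chartS -> E2 -> R) : (j < m)%N -> density_cont setT w ->
  (leb2 R).-integrable (cpre (d j) (B j)) (EFin \o (fun q : plane2 R => w (d j) (plane q))).
Proof.
move=> jm cw; have [aP dP bP _ _] := nc_piecewise nc; have aj := aP j jm.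
have [K [cK Kd BK _]] := nc_compact nc jm.
have mB : measurable (cpre (d j) (B j)) by apply: cpre_measurable => //; [exact: bP|exact: dP].
have cKc : compact (d j @` K).
  apply: continuous_compact => //; apply: continuous_in_subspaceT => s.
  by rewrite inE => /Kd cs; exact: cmap_cont.
have cwK : compact (w (d j) @` (d j @` K)).
  apply: continuous_compact => //; apply: continuous_in_subspaceT => y.
  by rewrite inE => -[s /Kd cs <-]; exact: cw.
have [M [_ MK]] := compact_bounded cKc; have [M' [_ MK']] := compact_bounded cwK.
apply: measurable_bounded_integrable => //.
- pose L := `|M| + 1; have L0 : 0 < L by rewrite ltr_wpDl.
  apply: (@le_lt_trans _ _ (leb2 R (box (- (L + 1)) (- (L + 1)) (2 * (L + 1)) (2 * (L + 1))))).
    apply: le_measure; rewrite ?inE//; first exact: measurable_box.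
    move=> q [s Bs sq]; have : `|d j s| <= L.
      by apply: MK; [rewrite /L ltr_pwDr// ler_norm|exists s => //; exact: BK].
    move=> h; have := le_trans (le_coord_norm _ ord0) h; have := le_trans (le_coord_norm _ ord_max) h.
    rewrite sq plane0 plane1 !ler_norml => /andP[? ?] /andP[? ?].
    by split; rewrite /= in_itv/=; apply/andP; split; lra.
  have L2 : 0 <= 2 * (L + 1) by rewrite mulr_ge0// addr_ge0// ltW.
  by rewrite leb2_box// ltry.
- by apply: (density_measurable openT aj cw) => // s Bs; split => //; exact: dP Bs.
- exists M'; split; first exact: num_real.
  move=> x Mx q [s Bs sq]; apply: (MK' x Mx); exists (d j s); last by rewrite sq.
  by exists s => //; exact: BK.
Qed.

Lemma total_sum n (w : 'I_n -> chartS -> E2 -> R) : (forall i, density_cont setT (w i)) ->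
  (total (fun c y => (\sum_(i < n) w i c y)%R) = \sum_(i < n) total (w i))%E.
Proof.
move=> cw; rewrite /total exchange_big; apply: eq_bigr => j _ /=.
have [aP dP bP _ _] := nc_piecewise nc.
rewrite /chart_int -integral_sum.
- by apply: eq_integral => q _; rewrite sumEFin.
- by apply: cpre_measurable => //; [exact: aP|exact: bP|exact: dP].
- by move=> i; exact: piece_integrable.
Qed.

Lemma total_eq (w w' : chartS -> E2 -> R) :
  (forall c s, atlas c -> dom c s -> w c (c s) = w' c (c s)) -> total w = total w'.
Proof.
move=> h; have [aP dP _ _ _] := nc_piecewise nc.
apply: eq_bigr => j _; apply: eq_integral => q; rewrite inE => -[s Bs sq].
by rewrite -sq h//; [exact: aP|exact: dP Bs].
Qed.

Lemma wed_sum (O : set S) n (f : 'I_n -> S -> R) g (c : chartS) s : atlas c -> O s -> dom c s ->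
  (forall i, CkS 1 O (f i)) ->
  wed (fun s => \sum_(i < n) f i s) g c (c s) = \sum_(i < n) wed (f i) g c (c s).
Proof.
move=> ac Os cs hf.
have D v : 'D_v ((fun s => \sum_(i < n) f i s) \o cinv c) (c s) =
    \sum_(i < n) 'D_v (f i \o cinv c) (c s).
  rewrite -derive_sum.
    by congr ('D_v _ _); apply/funext => y; rewrite fct_sumE.
  by move=> i; apply: diff_derivable; exact: CkS_diff (hf i) c s ac Os cs.
by rewrite /wed !D !mulr_suml -sumrB.
Qed.

Theorem surface_stokes (O K : set S) (f g : S -> R) : open O -> closed K -> K `<=` O ->
  (forall s, ~ K s -> f s = 0) -> CkS 1 O f -> CkS 2 O g -> total (wed f g) = 0%E.
Proof.
move=> oO cK KO f0 hf hg.
have hg1 : CkS 1 O g by move=> e ae; exact: Ck_on_pred (hg e ae).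
have [aP dP bP _ _] := nc_piecewise nc.
(* The pieces of [f] under the partition of unity; each is supported in a compact subset of one
   chart. *)
pose h (i : 'I_m) s := theta i s * f s.
have hC i : CkS 1 O (h i).
  by apply: (CkS_mul oO _ hf); apply: CkS_sub (nc_C1 nc i).
have h0 i s : ~ K s -> h i s = 0 by move=> /f0; rewrite /h => ->; rewrite mulr0.
have E : f = (fun s => \sum_(i < m) h i s).
  by apply/funext => s; rewrite -mulr_suml (nc_sum nc) mul1r.
rewrite (total_eq (w' := fun c y => \sum_(i < m) wed (h i) g c y)); last first.
  move=> c s ac cs; have [/KO Os|nK] := pselect (K s).
    by rewrite {1}E; exact: wed_sum Os cs hC.
  rewrite (wed_zero _ cK f0)// big1// => i _.
  exact: (wed_zero _ cK (h0 i)).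
rewrite total_sum; last by move=> i; exact: (wed_cont_ext cK KO (h0 i) (hC i) hg1).
apply: big1 => i _; have [Ki [cKi Kid _ t0]] := nc_compact nc (ltn_ord i).
have cl := compact_closed_surface hS cKi.
apply: (stokes_local rS hS oO _ (aP i (ltn_ord i)) _ _ (hC i) hg (nc_piecewise nc) (K := K `&` Ki)).
- apply: (subclosed_compact _ cKi) => //; first exact: closedI.
- by move=> s [/KO Os /Kid].
- move=> s nK; rewrite /h; have [Ks|nKs] := pselect (K s); last by rewrite f0// mulr0.
  by rewrite t0 ?mul0r// => Kis; apply: nK.
Qed.

End Integrals.

End NiceCover.

(** * The forms of the cylinder in linear coordinates *)

Section Dot.
Context {R : realType}.

Definition dot n (u w : 'rV[R]_n) : R := \sum_i u 0 i * w 0 i.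

Lemma dotE n (u w : 'rV[R]_n) : (u *m w^T) 0 0 = dot u w.
Proof. by rewrite mxE; apply: eq_bigr => i _; rewrite mxE. Qed.

Lemma dotC n (u w : 'rV[R]_n) : dot u w = dot w u.
Proof. by apply: eq_bigr => i _; rewrite mulrC. Qed.

Lemma dot_delta n (u : 'rV[R]_n) k : dot u (delta_mx 0 k) = u 0 k.
Proof.
rewrite /dot (bigD1 k)//= big1 ?addr0 => [|i ik]; first by rewrite mxE !eqxx mulr1.
by rewrite mxE (negbTE ik) andbF mulr0.
Qed.

Lemma mulmx_dot n (u : 'rV[R]_n) (A : 'M[R]_n) j : (u *m A) 0 j = dot u (col j A)^T.
Proof. by rewrite mxE; apply: eq_bigr => i _; rewrite !mxE. Qed.

Lemma dot_ge0 n (u : 'rV[R]_n) : 0 <= dot u u.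
Proof. by apply: sumr_ge0 => i _; rewrite -expr2 sqr_ge0. Qed.

Lemma dot_eq0 n (u : 'rV[R]_n) : dot u u = 0 -> u = 0.
Proof.
move=> /eqP; rewrite psumr_eq0 => [/allP h|i _]; last by rewrite -expr2 sqr_ge0.
apply/rowP => i; rewrite mxE; have := h i (mem_index_enum _).
by rewrite mulf_eq0 orbb => /eqP.
Qed.

Lemma stdJ_sqr N : stdJ N *m stdJ N = - 1%:M :> 'M[R]_(N + N).
Proof.
rewrite /stdJ mulmx_block !mulmx0 !mul0mx !mul1mx !mulNmx !mulmx1 ?addr0 ?add0r ?oppr0.
by rewrite -[1%:M in RHS]submxK [in RHS]opp_block_mx scalar_mx_block
  block_mxKul block_mxKur block_mxKdl block_mxKdr oppr0.
Qed.

Lemma stdJ_tr N : (stdJ N)^T = - stdJ N :> 'M[R]_(N + N).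
Proof. by rewrite /stdJ tr_block_mx opp_block_mx !trmx0 linearN /= !trmx1 !oppr0 opprK. Qed.

Lemma mulJJ N (u : 'rV[R]_(N + N)) : u *m stdJ N *m stdJ N = - u.
Proof. by rewrite -mulmxA stdJ_sqr mulmxN mulmx1. Qed.

Lemma dotNr n (u w : 'rV[R]_n) : dot u (- w) = - dot u w.
Proof. by rewrite -sumrN; apply: eq_bigr => i _; rewrite mxE mulrN. Qed.

Lemma dotNl n (u w : 'rV[R]_n) : dot (- u) w = - dot u w.
Proof. by rewrite dotC dotNr dotC. Qed.

Lemma dotJr N (u w : 'rV[R]_(N + N)) : dot u (w *m stdJ N) = - dot (u *m stdJ N) w.
Proof. by rewrite -dotE trmx_mul mulmxA stdJ_tr mulmxN dotE dotNl. Qed.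

Lemma dotJJ N (u w : 'rV[R]_(N + N)) : dot (u *m stdJ N) (w *m stdJ N) = dot u w.
Proof. by rewrite dotJr mulJJ dotNl opprK. Qed.

Lemma dotBl n (u u' w : 'rV[R]_n) : dot (u - u') w = dot u w - dot u' w.
Proof. by rewrite /dot -sumrB; apply: eq_bigr => i _; rewrite !mxE mulrBl. Qed.

Lemma dotZl n a (u w : 'rV[R]_n) : dot (a *: u) w = a * dot u w.
Proof. by rewrite /dot mulr_sumr; apply: eq_bigr => i _; rewrite !mxE mulrA. Qed.

Lemma dotzJz N (z : 'rV[R]_(N + N)) : dot z (z *m stdJ N) = 0.
Proof. by have := dotJr z z; rewrite [dot (_ *m _) z]dotC => h; lra. Qed.

(** The covector [sum x dy - y dx] at [w] is the vector [i w], so all forms of the cylinder can be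
    expressed by [dot] and [stdJ]. *)
Lemma lambda0E N (w : 'rV[R]_(N + N)) : lambda0 w = w *m stdJ N.
Proof.
apply/rowP => i; rewrite summxE; case: (split_ordP i) => k ->; have [El Er] := stdJ_mul w k.
  rewrite El (bigD1 k)//= big1 ?addr0.
    by rewrite !mxE !eqxx !eq_shift mulr0 mulr1 sub0r.
  by move=> l lk; rewrite !mxE !eqxx !eq_shift (eq_sym k) (negbTE lk) !mulr0 subr0.
rewrite Er (bigD1 k)//= big1 ?addr0.
  by rewrite !mxE !eqxx !eq_shift mulr0 mulr1 subr0.
by move=> l lk; rewrite !mxE !eqxx !eq_shift (eq_sym k) (negbTE lk) !mulr0 subr0.
Qed.

Lemma mul_trmx n (u a : 'rV[R]_n) : u *m a^T = (dot u a)%:M.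
Proof. by rewrite [LHS]mx11_scalar dotE. Qed.

Lemma mul_wedge n (u a b : 'rV[R]_n) : u *m wedge a b = dot u a *: b - dot u b *: a.
Proof. by rewrite /wedge mulmxBr !mulmxA !mul_trmx !mul_scalar_mx. Qed.

Lemma stdOmegaE N : stdOmega N = stdJ N :> 'M[R]_(N + N).
Proof.
apply/row_matrixP => i; rewrite !rowE -[RHS]lambda0E /stdOmega mulmx_sumr.
by apply: eq_bigr => k _; rewrite mul_wedge !dot_delta.
Qed.

End Dot.

Section Flat.
Context {R : realType} {N : nat}.
Local Notation E := 'rV[R]_(N + N).
Implicit Types z u : E.

Lemma derive_comp_real (V : normedModType R) (f : V -> R) (g : R -> R) (x v : V) (dg : R) :
  differentiable f x -> is_derive (f x : R) (1 : R) g dg ->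
  differentiable (g \o f) x /\ 'D_v (g \o f) x = dg * 'D_v f x.
Proof.
move=> df hg.
have dgx : differentiable g (f x) by apply/derivable1_diffP; exact: (@ex_derive _ _ _ _ _ _ _ hg).
have dc : differentiable (g \o f) x by exact: differentiable_comp.
split=> //; rewrite deriveE// (diff_comp df dgx) /= -(deriveE v df).
rewrite -[X in 'd g _ X]mulr1 [LHS]linearZ /= -deriveE//.
by rewrite (@derive_val _ _ _ _ _ _ _ hg) mulrC.
Qed.

Lemma is_derive_coord n (z u : 'rV[R]_n) i : is_derive z u (fun y => y 0 i) (u 0 i).
Proof.
apply: DeriveDef; first by apply: diff_derivable; exact: differentiable_coord.
by rewrite (@derive_coord _ _ _ id) ?derive_id.
Qed.

Lemma is_derive_dot n (w z u : 'rV[R]_n) : is_derive z u (fun y => dot y w) (dot u w).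
Proof.
have -> : (fun y => dot y w) = \sum_i (w 0 i \*: (fun y : 'rV[R]_n => y 0 i)).
  by apply/funext => y; rewrite fct_sumE; apply: eq_bigr => i _; rewrite mulrC.
apply: is_derive_eq.
  by apply: is_derive_sum => i; apply: is_deriveZ; exact: is_derive_coord.
by apply: eq_bigr => i _; exact: mulrC.
Qed.

(** The squared Euclidean norm is a polynomial, smooth at the origin, which [enorm] is not. *)
Definition rho z : R := dot z z.

Lemma enormE z : enorm z = Num.sqrt (rho z).
Proof. by rewrite /enorm; congr Num.sqrt; apply: eq_bigr => i _; rewrite expr2. Qed.

Lemma Ck_on_rho k : Ck_on k setT rho.
Proof.
apply: Ck_on_sum; first exact: openT.
by move=> i; apply: Ck_on_mul; [exact: openT|exact: Ck_on_coordinate|exact: Ck_on_coordinate].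
Qed.

Lemma differentiable_rho z : differentiable rho z.
Proof. exact: (Ck_onS_diff (Ck_on_rho 1)). Qed.

Lemma derive_rho z u : 'D_u rho z = 2 * dot z u.
Proof.
have -> : rho = \sum_i ((fun y : E => y 0 i) * (fun y : E => y 0 i)).
  by apply/funext => y; rewrite fct_sumE.
have di i : derivable (fun y : E => y 0 i) z u := @ex_derive _ _ _ _ _ _ _ (is_derive_coord z u i).
rewrite derive_sum => [|i]; last exact: derivableM.
rewrite mulr_sumr; apply: eq_bigr => i _.
rewrite deriveM// (@derive_val _ _ _ _ _ _ _ (is_derive_coord z u i)).
by rewrite /GRing.scale/=; ring.
Qed.

Lemma rho_neq0 z : rho z != 0 -> 0 < rho z.
Proof. by move=> h; rewrite lt_neqAle eq_sym h dot_ge0. Qed.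

Lemma derive_cyl_r z u : rho z != 0 -> 'D_u cyl_r z = (rho z)^-1 * dot z u.
Proof.
move=> z0; have r0 := rho_neq0 z0.
have s0 : 0 < Num.sqrt (rho z) by rewrite sqrtr_gt0.
have -> : cyl_r = (@ln R) \o (Num.sqrt \o rho).
  by apply/funext => y; rewrite /cyl_r enormE.
have [d1 e1] := derive_comp_real u (differentiable_rho z) (is_derive1_sqrt r0).
have [_ ->] := derive_comp_real u d1 (is_derive1_ln s0).
rewrite e1 derive_rho /= -{3}(sqr_sqrtr (ltW r0)).
by move: (Num.sqrt _) s0 => t t0; field; rewrite lt0r_neq0.
Qed.

Lemma differentiable_row (V : normedModType R) n (h : V -> 'rV[R]_n) (x : V) :
  (forall i, differentiable (fun y => h y 0 i) x) -> differentiable h x.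
Proof.
move=> dh; have -> : h = \sum_i (fun y => h y 0 i *: delta_mx 0 i).
  by apply/funext => y; rewrite fct_sumE -row_sum_delta.
by apply: differentiable_sum => i; exact: differentiableZl.
Qed.

(** [cyl_Theta] is [k z *: z] with [k = 1 / |z|]. The derivative of [k] contributes a multiple of
    [z], which [lambda0] annihilates as [z] is orthogonal to [iz]; what remains is [k z ^+ 2] times
    [lambda0]. *)
Lemma lambdaE z : rho z != 0 -> lambda z = (rho z)^-1 *: (z *m stdJ N).
Proof.
move=> z0; have r0 := rho_neq0 z0.
have s0 : 0 < Num.sqrt (rho z) by rewrite sqrtr_gt0.
pose k y : R := (Num.sqrt (rho y))^-1.
have dV := is_derive_inv (lt0r_neq0 s0).
have [d1 _] := derive_comp_real 0 (differentiable_rho z) (is_derive1_sqrt r0).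
have [dk _] := derive_comp_real 0 d1 dV.
have TE : cyl_Theta = fun y : E => k y *: y.
  by apply/funext => y; rewrite /cyl_Theta enormE.
have dkc i : differentiable (fun y : E => k y * y 0 i) z.
  by apply: (@differentiableM _ _ k (fun y : E => y 0 i)) => //; exact: differentiable_coord.
have Tc i : (fun y : E => cyl_Theta y 0 i) = (fun y : E => k y * y 0 i).
  by apply/funext => y; rewrite TE mxE.
have dT : differentiable (cyl_Theta : E -> E) z.
  by apply: differentiable_row => i; rewrite Tc.
have J0 i j : jacobian (cyl_Theta : E -> E) z i j = k z * (i == j)%:R + z 0 j * 'D_(delta_mx 0 i) k z.
  rewrite (jacobianE _ _ dT) -(derive_coord _ _ dT) Tc.
  have dc := is_derive_coord z (delta_mx 0 i) j.
  rewrite (@deriveM _ _ k (fun y : E => y 0 j)); last 2 first.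
  - exact: diff_derivable.
  - exact: (@ex_derive _ _ _ _ _ _ _ dc).
  rewrite (@derive_val _ _ _ _ _ _ _ dc) mxE eqxx /= [j == i]eq_sym.
  by congr (_ + _).
have kk : k z * k z = (rho z)^-1 by rewrite /k -invfM -expr2 sqr_sqrtr ?ltW.
have zJz : dot (z *m stdJ N) z = 0.
  by rewrite dotC dotzJz.
have {}TE : cyl_Theta z = k z *: z by rewrite TE.
rewrite /lambda lambda0E TE; move: (jacobian _ _) J0 => A J0.
apply/rowP => i.
have -> : (k z *: z *m stdJ N *m A^T) 0 i =
    k z * \sum_j (z *m stdJ N) 0 j * A i j.
  by rewrite -!scalemxAl mxE; congr (_ * _); rewrite mxE; apply: eq_bigr => j _; rewrite [A^T _ _]mxE.
move: zJz; rewrite /dot mxE; move: (z *m stdJ N) => w wz.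
under eq_bigr do rewrite J0 mulrDr.
rewrite big_split /= (bigD1 i)//= big1 => [|j ji]; last by rewrite eq_sym (negbTE ji) !mulr0.
rewrite eqxx mulr1 addr0; under eq_bigr do rewrite mulrA.
by rewrite -mulr_suml wz mul0r addr0 -kk; ring.
Qed.

Lemma near_rho z : rho z != 0 -> \forall y \near z, rho y != 0.
Proof.
move=> z0; have oU : open [set y | rho y != 0].
  apply: (open_comp (f := rho) (D := [set x : R | x != 0])).
    by move=> y _; exact: differentiable_continuous (differentiable_rho y).
  exact: open_neq.
exact: (near_open oU).
Qed.

Lemma derive_lambda z u j : rho z != 0 ->
  'D_u (fun y => lambda y 0 j) z =
  (rho z)^-1 * (u *m stdJ N) 0 j - 2 * (rho z) ^- 2 * dot z u * (z *m stdJ N) 0 j.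
Proof.
move=> z0; pose k y := (rho y)^-1; pose l (y : E) := (y *m stdJ N) 0 j.
have -> : 'D_u (fun y => lambda y 0 j) z = 'D_u (k * l) z.
  apply: near_eq_derive; apply: filterS (near_rho z0) => y y0.
  by rewrite lambdaE// mxE.
have dl : is_derive z u l ((u *m stdJ N) 0 j).
  by rewrite mulmx_dot /l; under eq_fun do rewrite mulmx_dot; exact: is_derive_dot.
have dV := is_derive_inv z0.
have [dk Dk] := derive_comp_real u (differentiable_rho z) dV.
rewrite deriveM; last 2 first.
- exact: diff_derivable.
- exact: (@ex_derive _ _ _ _ _ _ _ dl).
rewrite (@derive_val _ _ _ _ _ _ _ dl) (_ : 'D_u k z = - (rho z) ^- 2 * 'D_u rho z)// derive_rho.
by rewrite /k /l /GRing.scale/=; ring.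
Qed.

(** Leibniz' rule for [lambda0 / rho]: [d lambda0] is twice the symplectic form, and [d rho] at [z]
    is [2 z]. *)
Lemma dlambdaE z : rho z != 0 ->
  dlambda z = (2 * (rho z)^-1) *: stdJ N - (2 * (rho z) ^- 2) *: wedge z (z *m stdJ N).
Proof.
move=> z0; apply/matrixP => i j; rewrite /dlambda mxE !derive_lambda//.
have De (k l : 'I_(N + N)) : ((delta_mx 0 k : E) *m stdJ N) 0 l = stdJ N k l :> R.
  by rewrite -(rowE k (stdJ N : 'M[R]_(N + N))) mxE.
rewrite !De !dot_delta /wedge; have := @stdJ_tr R N.
move: (z *m stdJ N) (stdJ N) => w J JT.
have -> : J j i = - J i j by have /matrixP/(_ i j) := JT; rewrite !mxE.
rewrite !mxE !big_ord1 !mxE.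
move: (rho z)^-1 (rho z ^- 2) => a b; ring.
Qed.

Lemma phi_dr_lambdaE (f : R -> R) z : rho z != 0 ->
  phi_dr_lambda f z = (f (cyl_r z) * (rho z) ^- 2) *: wedge z (z *m stdJ N).
Proof.
move=> z0; rewrite /phi_dr_lambda -scalerA; congr (_ *: _).
have -> : dext0 cyl_r z = (rho z)^-1 *: z.
  by apply/rowP => i; rewrite !mxE derive_cyl_r// dot_delta.
rewrite lambdaE//; move: (z *m stdJ N) => w.
apply/matrixP => i j; rewrite /wedge !mxE !big_ord1 !mxE.
by rewrite -exprVn; ring.
Qed.

(** Forms are evaluated on the pair [u], [iu], which are the two partial derivatives of a
    holomorphic curve. *)
Lemma form_stdOmega u : (u *m stdOmega N *m (u *m stdJ N)^T) 0 0 = dot u u.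
Proof. by rewrite stdOmegaE dotE dotJJ. Qed.

Lemma form_wedge z u :
  (u *m wedge z (z *m stdJ N) *m (u *m stdJ N)^T) 0 0 =
  dot z u ^+ 2 + dot (z *m stdJ N) u ^+ 2.
Proof.
rewrite mul_wedge dotE; set w := z *m stdJ N; set u' := u *m stdJ N.
rewrite dotBl !dotZl dotJJ [dot z u']dotJr -/w (dotC u z) (dotC u w); ring.
Qed.

(** The relation [w = s (P + Q / 2)], solved for [Q]. *)
Lemma form_dlambda z u : rho z != 0 ->
  (u *m dlambda z *m (u *m stdJ N)^T) 0 0 =
  2 * dot u u / rho z - 2 * ((dot z u ^+ 2 + dot (z *m stdJ N) u ^+ 2) / rho z ^+ 2).
Proof.
move=> z0; rewrite dlambdaE// mulmxBr mulmxBl -!scalemxAr -!scalemxAl.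
have mB (A B : 'M[R]_1) : (A - B) 0 0 = A 0 0 - B 0 0 by rewrite !mxE.
have mZ a (A : 'M[R]_1) : (a *: A) 0 0 = a * A 0 0 by rewrite mxE.
rewrite mB !mZ form_wedge dotE dotJJ; ring.
Qed.

Lemma form_dr_lambda f z u : rho z != 0 ->
  (u *m phi_dr_lambda f z *m (u *m stdJ N)^T) 0 0 =
  f (cyl_r z) * ((dot z u ^+ 2 + dot (z *m stdJ N) u ^+ 2) / rho z ^+ 2).
Proof.
move=> z0; rewrite phi_dr_lambdaE// -scalemxAr -scalemxAl.
have mZ a (A : 'M[R]_1) : (a *: A) 0 0 = a * A 0 0 by rewrite mxE.
by rewrite mZ form_wedge -mulrA [_ ^- 2 * _]mulrC.
Qed.

(* Bessel's inequality for the orthogonal vectors z and zJ. *)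
Lemma bessel z u : rho z != 0 ->
  (dot z u ^+ 2 + dot (z *m stdJ N) u ^+ 2) / rho z <= dot u u.
Proof.
move=> z0; have r0 := rho_neq0 z0; set A := dot z u; set B := dot _ u.
set w := z *m stdJ N in B *.
have zw : dot z w = 0 by exact: dotzJz.
have ww : dot w w = rho z by rewrite dotJJ.
have := dot_ge0 (u - (A / rho z) *: z - (B / rho z) *: w).
have -> : dot (u - (A / rho z) *: z - (B / rho z) *: w) (u - (A / rho z) *: z - (B / rho z) *: w) =
   dot u u + (A / rho z) ^+ 2 * dot z z + (B / rho z) ^+ 2 * dot w w - 2 * (A / rho z) * dot z u
    - 2 * (B / rho z) * dot w u + 2 * (A / rho z) * (B / rho z) * dot z w.
  rewrite !(dotC _ (_ - _)) !(dotBl, dotZl) ![dot _ (_ - _)]dotC !(dotBl, dotZl).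
  rewrite (dotC u z) (dotC u w) (dotC w z); ring.
rewrite zw ww -/A -/B -/(rho z) mulr0 addr0 => h; rewrite -subr_ge0; apply: (le_trans h).
rewrite le_eqVlt; apply/orP; left; apply/eqP.
by move: (rho z) z0 => t t0; field.
Qed.

End Flat.

(** * Holomorphic curves *)

Lemma jacobian_comp_at (R : realType) l m n (f : 'rV[R]_l -> 'rV[R]_m)
    (g : 'rV[R]_m -> 'rV[R]_n) x y : f x = y ->
  differentiable f x -> differentiable g y ->
  differentiable (g \o f) x /\ jacobian (g \o f) x = jacobian f x *m jacobian g y.
Proof.
by move=> <- df dg; split; [exact: differentiable_comp|exact: jacobian_comp].
Qed.

Section Charts.
Context {R : realType} {n : nat} {M : manifold R n}.

Lemma atlas_smooth_chart (d : chart R M n) : atlas d -> smooth_chart d.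
Proof. by move=> ad e ae; split; exact: atlas_smooth. Qed.

Lemma smooth_trans_diff (c d : chart R M n) x : smooth_on (trans_dom c d) (trans c d) ->
  dom c x -> dom d x -> differentiable (trans c d) (c x).
Proof. by move=> h cx dx; apply: (Ck_onS_diff (h 1)); exact: trans_domP. Qed.

Lemma dchartK (d : chart R M n) x : smooth_chart d -> dom d x ->
  dchart d x *m dchart_inv d x = 1%:M.
Proof.
move=> sd dx; rewrite /dchart /dchart_inv; set e := chart_at x.
have ex : dom e x by exact: chart_at_dom.
have [h1 h2] := sd e (chart_at_atlas x).
have d1 := smooth_trans_diff h1 dx ex; have d2 := smooth_trans_diff h2 ex dx.
rewrite -[in X in _ *m X](transE d ex) -jacobian_comp ?transE//.
rewrite -(jacobian_id (e x)); apply/esym/near_eq_jacobian => //.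
apply: (near_chart (dom_open d) dx ex) => t dt et.
by rewrite /= transE// transE.
Qed.

End Charts.

Lemma row0_stdJ (R : realType) n (B : 'M[R]_(1 + 1, n)) :
  row ord0 (stdJ 1 *m B) = row ord_max B.
Proof.
rewrite row_mul (_ : row ord0 (stdJ 1) = delta_mx 0 ord_max) -?rowE//.
apply/rowP => j; have El : ord0 = lshift 1 0 :> 'I_(1 + 1) by apply/val_inj.
have Er : ord_max = rshift 1 0 :> 'I_(1 + 1) by apply/val_inj.
rewrite rowE; case: (split_ordP j) => k ->; have [Jl Jr] := stdJ_mul (delta_mx 0 ord0 : 'rV[R]_(1 + 1)) k.
  by rewrite Jl El Er ord1 !mxE -!val_eqE /= oppr0.
by rewrite Jr El Er ord1 !mxE -!val_eqE.
Qed.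

Lemma pull_rows (R : realType) n (B : 'M[R]_(1 + 1, n)) (A : 'M[R]_n) :
  pull B A ord0 ord_max = (row ord0 B *m A *m (row ord_max B)^T) 0 0.
Proof.
rewrite /pull -row_mul [LHS]mxE [RHS]mxE; apply: eq_bigr => k _.
by congr (_ * _); rewrite !mxE.
Qed.

Section Curve.
Context {R : realType} {S : manifold R (1 + 1)} {n : nat} {M : manifold R n}.
Hypothesis rS : riemann_surface S.
Variable v : S -> M.
Hypothesis vs : smooth_map v.
Local Notation E2 := 'rV[R]_(1 + 1).
Local Notation e0 := (delta_mx 0 ord0 : E2).
Local Notation e1 := (delta_mx 0 ord_max : E2).
Local Notation chartS := (chart R S (1 + 1)).
Local Notation chartM := (chart R M n).

Definition curve (phi : chartM) (c : chartS) : E2 -> 'rV[R]_n := phi \o v \o cinv c.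

Lemma curve_dom_open (phi : chartM) : open (v @^-1` dom phi).
Proof. by apply: open_comp; [move=> s _; exact: (vs.1 s)|exact: dom_open]. Qed.

(** [smooth_map] speaks of charts of the atlas, whereas [phi] belongs to the maximal one; locally
    the curve is composed with the transition from [chart_at (v s)] to [phi]. *)
Lemma curve_Ck k (phi : chartM) (c : chartS) i : smooth_chart phi -> atlas c ->
  Ck_on k (c @` (v @^-1` dom phi `&` dom c)) (fun y => curve phi c y 0 i).
Proof.
move=> sphi ac; apply: Ck_on_local => _ [s [ps cs] <-].
pose d : chartM := chart_at (v s); have ds : dom d (v s) by exact: chart_at_dom.
pose P := (v @^-1` dom phi `&` v @^-1` dom d) `&` dom c.
have oP : open (c @` P).
  apply: chart_img_open; last by move=> ? [].
  apply: openI; last exact: dom_open.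
  by apply: openI; exact: curve_dom_open.
exists (c @` P); first by exists s.
have [_ h] := sphi d (chart_at_atlas _).
apply: (@Ck_on_eq _ _ _ _ _ ((fun z => trans d phi z 0 i) \o curve d c)) => //.
  by move=> _ [t [[pt dt] ct] <-]; rewrite /curve /= cmapK// transE.
apply: (@Ck_on_comp _ _ _ k _ (trans_dom d phi) (fun z => trans d phi z 0 i) (curve d c)) => //.
- by move=> _ [t [[pt dt] ct] <-]; rewrite /curve /= cmapK//; exact: trans_domP.
- apply: Ck_on_sub (vs.2 c d ac (chart_at_atlas _) k) => _ [t [[pt dt] ct] <-].
  by exists t.
- by apply: Ck_on_coord; [exact: trans_dom_open|exact: h].
Qed.

Lemma curve_diff (phi : chartM) (c : chartS) s : smooth_chart phi -> atlas c ->
  dom phi (v s) -> dom c s -> differentiable (curve phi c) (c s).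
Proof.
move=> sphi ac ps cs; apply: differentiable_row => i.
by apply: (Ck_onS_diff (curve_Ck 1 i sphi ac)); exists s.
Qed.

Lemma curve_jacobian (phi : chartM) (c : chartS) s : smooth_chart phi -> atlas c ->
  dom phi (v s) -> dom c s ->
  jacobian (curve phi c) (c s) = dchart_inv c s *m tangent_map v s *m dchart phi (v s).
Proof.
move=> sphi ac ps cs; rewrite /dchart_inv /tangent_map /dchart.
set c0 := chart_at s; set d := chart_at (v s).
have a0 : atlas c0 by exact: chart_at_atlas.
have c0s : dom c0 s by exact: chart_at_dom.
have ad : atlas d by exact: chart_at_atlas.
have ds : dom d (v s) by exact: chart_at_dom.
have d1 : differentiable (trans c c0) (c s) by exact: trans_differentiable.
have d2 := curve_diff (atlas_smooth_chart ad) a0 ds c0s.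
have [_ h] := sphi d ad; have d3 := smooth_trans_diff h ds ps.
have e1 : trans c c0 (c s) = c0 s by rewrite transE.
have e2 : curve d c0 (c0 s) = d (v s) by rewrite /curve /= cmapK.
have [d12 E12] := jacobian_comp_at e1 d1 d2.
have e12 : (curve d c0 \o trans c c0) (c s) = d (v s) by rewrite /= e1.
have [d123 E123] := jacobian_comp_at e12 d12 d3.
apply: etrans (etrans _ E123) (congr1 (mulmx^~ _) E12).
apply/esym/near_eq_jacobian; last exact: d123.
have oU : open (v @^-1` dom phi `&` v @^-1` dom d `&` dom c0).
  apply: openI; last exact: dom_open.
  by apply: openI; exact: curve_dom_open.
apply: (near_chart oU _ cs) => // t [[pt dt] c0t] ct.
by rewrite /curve /= transE// !cmapK// transE.
Qed.

Lemma pullback_tr (alpha : M -> 'M[R]_n) s : (alpha (v s))^T = - alpha (v s) ->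
  (pullback v alpha s)^T = - pullback v alpha s.
Proof. by move=> h; rewrite /pullback /pull !trmx_mul trmxK h mulNmx mulmxN mulmxA. Qed.

Lemma dens_pullback (alpha : M -> 'M[R]_n) (c : chartS) s : dom c s ->
  dens (pullback v alpha) c (c s) =
  pull (dchart_inv c s *m tangent_map v s) (alpha (v s)) ord0 ord_max.
Proof. by move=> cs; rewrite /dens /local_form cmapK// /pullback pull_mul. Qed.

Lemma dens_chart_pullback (alpha : M -> 'M[R]_n) (beta : 'M[R]_n)
    (phi : chartM) (c : chartS) s : smooth_chart phi -> atlas c ->
  dom phi (v s) -> dom c s -> alpha (v s) = pull (dchart phi (v s)) beta ->
  dens (pullback v alpha) c (c s) = pull (jacobian (curve phi c) (c s)) beta ord0 ord_max.
Proof.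
move=> sphi ac ps cs E; rewrite dens_pullback// E pull_mul.
by rewrite (curve_jacobian sphi ac ps cs).
Qed.

(** [omega] and [tangent_map] are expressed in the preferred charts, which may jump from point to
    point. Near [s] everything is rewritten in the fixed chart [d], where the coefficients are
    visibly continuous. *)
Lemma dens_smooth_cont (omega : M -> 'M[R]_n) : smooth_form omega ->
  density_cont setT (dens (pullback v omega)).
Proof.
move=> [_ so] c s ac _ cs; pose d : chartM := chart_at (v s).
have ad : atlas d by exact: chart_at_atlas.
have ds : dom d (v s) by exact: chart_at_dom.
have sd := atlas_smooth_chart ad.
pose U := c @` (v @^-1` dom d `&` dom c).
have oU : open U.
  by apply: chart_img_open; [apply: openI; [exact: curve_dom_open|exact: dom_open]|move=> ? []].
have Us : U (c s) by exists s.
pose F y := \sum_k (\sum_l 'D_e0 (fun y => curve d c y 0 l) y * local_form omega d (curve d c y) l k) *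
   'D_e1 (fun y => curve d c y 0 k) y.
have hU : {for c s, continuous F}.
  have C1 i w : Ck_on 0 U ('D_w (fun y => curve d c y 0 i)).
    exact: Ck_onS_derive (curve_Ck 1 i sd ac).
  have C2 k l : Ck_on 0 U ((fun z => local_form omega d z l k) \o curve d c).
    move=> _ [t [dt ct] <-]; apply: continuous_comp.
      by apply: differentiable_continuous; exact: curve_diff.
    have hc := so d ad 0%N; have tE : curve d c (c t) = d (v t) by rewrite /curve /= cmapK.
    apply: (@continuous_comp _ _ _ (local_form omega d) (fun A : 'M[R]_n => A l k)).
      by rewrite tE; apply: hc; exists (v t).
    exact: coord_continuous.
  have h : Ck_on 0 U F.
    apply: Ck_on_sum => // k.
    apply: (@Ck_on_mul _ _ 0 U (fun y => \sum_l _) _ oU _ (C1 k e1)).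
    apply: Ck_on_sum => // l; exact: (@Ck_on_mul _ _ 0 U _ _ oU (C1 l e0) (C2 k l)).
  exact: h.
apply: near_eq_continuous hU.
have odd : open (v @^-1` dom d) by exact: curve_dom_open.
apply: (near_chart odd ds cs) => t dt ct.
have tE : curve d c (c t) = d (v t) by rewrite /curve /= cmapK.
rewrite (@dens_chart_pullback _ (local_form omega d (d (v t))) d)//; last first.
  by rewrite /local_form cmapK// pull_mul dchartK// /pull mul1mx trmx1 mulmx1.
have dc := curve_diff sd ac dt ct.
have J i k : jacobian (curve d c) (c t) i k = 'D_(delta_mx 0 i) (fun y => curve d c y 0 k) (c t).
  by rewrite (jacobianE _ _ dc) -(derive_coord _ _ dc).
rewrite /F tE; move: (jacobian _ _) J => A J; rewrite /pull !mxE.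
apply: eq_bigr => k _; rewrite [A^T _ _]mxE J mxE; congr (_ * _).
by apply: eq_bigr => l _; rewrite J.
Qed.

End Curve.

Lemma continuous_sum (R : realType) (V : normedModType R) (I : Type) (s : seq I)
    (F : I -> V -> R) (y : V) : (forall i, {for y, continuous (F i)}) ->
  {for y, continuous (fun x => \sum_(i <- s) F i x)}.
Proof.
move=> hF; elim: s => [|i s IH].
  rewrite (_ : (fun x => _) = cst 0); first exact: cst_continuous.
  by apply/funext => x; rewrite big_nil.
rewrite (_ : (fun x => _) = F i \+ (fun x => \sum_(j <- s) F j x)); last first.
  by apply/funext => x; rewrite big_cons.
exact: (continuousD (hF i) IH).
Qed.

Lemma continuous_dot (R : realType) (V : normedModType R) n (F G : V -> 'rV[R]_n) (y : V) :
  (forall i, {for y, continuous (fun x => F x 0 i)}) ->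
  (forall i, {for y, continuous (fun x => G x 0 i)}) ->
  {for y, continuous (fun x => dot (F x) (G x))}.
Proof.
by move=> hF hG; apply: continuous_sum => i; exact: (continuousM (hF i) (hG i)).
Qed.

Lemma continuous_mulmx (R : realType) (V : normedModType R) n (F : V -> 'rV[R]_n)
    (A : 'M[R]_n) (y : V) j : (forall i, {for y, continuous (fun x => F x 0 i)}) ->
  {for y, continuous (fun x => (F x *m A) 0 j)}.
Proof.
move=> hF; rewrite (_ : (fun x => _) = (fun x => dot (F x) (col j A)^T)).
  by apply: continuous_dot => // i; exact: cst_continuous.
by apply/funext => x; exact: mulmx_dot.
Qed.

Lemma derive_rho_comp (R : realType) (V : normedModType R) N (h : V -> 'rV[R]_(N + N)) (x w : V) :
  differentiable h x ->
  differentiable (rho \o h) x /\ 'D_w (rho \o h) x = 2 * dot (h x) ('D_w h x).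
Proof.
move=> dh; have dr := differentiable_rho (h x).
split; first exact: differentiable_comp.
rewrite (derive_comp_rV w dh dr) /dot mulr_sumr; apply: eq_bigr => i _.
by rewrite derive_rho mulrA dot_delta.
Qed.

Lemma derive_mul_comp (R : realType) (V : normedModType R) n (h : V -> 'rV[R]_n) (A : 'M[R]_n)
    j (x w : V) : differentiable h x ->
  differentiable (fun y => (h y *m A) 0 j) x /\
  'D_w (fun y => (h y *m A) 0 j) x = ('D_w h x *m A) 0 j.
Proof.
move=> dh; pose l (z : 'rV[R]_n) := dot z (col j A)^T.
have -> : (fun y => (h y *m A) 0 j) = l \o h by apply/funext => y; exact: mulmx_dot.
have dl : differentiable l (h x).
  rewrite /l (_ : (fun z => _) = \sum_i ((col j A)^T 0 i \*: (fun z : 'rV[R]_n => z 0 i))).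
    apply: differentiable_sum => i; apply: differentiableZ; exact: differentiable_coord.
  by apply/funext => z; rewrite fct_sumE; apply: eq_bigr => i _; rewrite mulrC.
split; first exact: differentiable_comp.
rewrite (derive_comp_rV w dh dl) mulmx_dot; apply: eq_bigr => i _.
rewrite (@derive_val _ _ _ _ _ _ _ (is_derive_dot (col j A)^T (h x) (delta_mx 0 i))).
by rewrite mulrC dotC dot_delta.
Qed.

Section Holomorphic.
Context {R : realType} {S : manifold R (1 + 1)} {N : nat} {M : manifold R (N + N)}.
Hypothesis rS : riemann_surface S.
Variables (omega J : M -> 'M[R]_(N + N)) (p : M) (eps : R) (phi : chart R M (N + N)).
Hypothesis comp : compatible omega J.
Hypothesis flat : flat_chart omega J p eps phi.
Variable v : S -> M.
Hypothesis hol : J_holomorphic J v.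
Local Notation E2 := 'rV[R]_(1 + 1).
Local Notation e0 := (delta_mx 0 ord0 : E2).
Local Notation e1 := (delta_mx 0 ord_max : E2).
Local Notation chartS := (chart R S (1 + 1)).
Local Notation V := (v @^-1` dom phi).

Let vs : smooth_map v := hol.1.
Let sphi : smooth_chart phi. Proof. by case: flat. Qed.

(** The change from [c] to [chart_at s] commutes with [stdJ 1], so holomorphy, formulated in the
    preferred chart, holds in every chart. *)
Lemma hol_rows (c : chartS) s : atlas c -> dom c s ->
  let B := dchart_inv c s *m tangent_map v s in
  row ord_max B = row ord0 B *m J (v s).
Proof.
move=> ac cs B; rewrite -row0_stdJ -row_mul; congr (row _ _).
have h : stdJ 1 *m dchart_inv c s = dchart_inv c s *m stdJ 1.
  by apply: rS => //; [exact: chart_at_atlas|apply: trans_domP => //; exact: chart_at_dom].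
by rewrite /B mulmxA h -!mulmxA; congr (_ *m _); rewrite hol.2.
Qed.

(** By holomorphy the density is [omega (u, J u)], and compatibility makes it nonnegative on all of
    [S]. *)
Lemma dens_omega_ge0 (c : chartS) s : atlas c -> dom c s ->
  0 <= dens (pullback v omega) c (c s).
Proof.
move=> ac cs; rewrite dens_pullback// pull_rows hol_rows//.
set u := row ord0 _; have [->|u0] := eqVneq u 0; first by rewrite !mul0mx mxE.
by apply: ltW; exact: comp.2.
Qed.

Definition vel (c : chartS) (y : E2) : 'rV[R]_(N + N) := 'D_e0 (curve v phi c) y.

Lemma curve_rows (c : chartS) s : atlas c -> V s -> dom c s ->
  let A := jacobian (curve v phi c) (c s) in
  row ord0 A = vel c (c s) /\ row ord_max A = vel c (c s) *m stdJ N.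
Proof.
move=> ac ps cs; have dc := curve_diff vs sphi ac ps cs.
have E0 := row_jacobian ord0 dc; split; first exact: E0.
have [_ _ _ hJ _] := flat.
rewrite /vel -E0 (curve_jacobian vs sphi ac ps cs).
by rewrite row_mul (hol_rows ac cs) [row ord0 (_ *m dchart _ _)]row_mul -!mulmxA hJ.
Qed.

Lemma derive1_curve (c : chartS) s : atlas c -> V s -> dom c s ->
  'D_e1 (curve v phi c) (c s) = vel c (c s) *m stdJ N.
Proof.
move=> ac ps cs; have [_ <-] := curve_rows ac ps cs.
by apply/esym/row_jacobian; exact: (curve_diff vs sphi ac ps cs).
Qed.

Lemma dens_flat (alpha : M -> 'M[R]_(N + N)) (beta : 'M[R]_(N + N)) (c : chartS) s :
  atlas c -> V s -> dom c s -> alpha (v s) = pull (dchart phi (v s)) beta ->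
  dens (pullback v alpha) c (c s) =
  (vel c (c s) *m beta *m (vel c (c s) *m stdJ N)^T) 0 0.
Proof.
move=> ac ps cs E; rewrite (dens_chart_pullback vs sphi ac ps cs E) pull_rows.
by have [-> ->] := curve_rows ac ps cs.
Qed.

(* The densities of [v^* omega], [v^* (dr /\ lambda)] and [v^* dlambda]. *)
Definition dens_w (c : chartS) y : R := dot (vel c y) (vel c y).
Definition dens_p (c : chartS) y : R :=
  let X := curve v phi c y in let u := vel c y in
  (dot X u ^+ 2 + dot (X *m stdJ N) u ^+ 2) / rho X ^+ 2.
Definition dens_q (c : chartS) y : R :=
  2 * dens_w c y / rho (curve v phi c y) - 2 * dens_p c y.

Lemma curveE (c : chartS) s : dom c s -> curve v phi c (c s) = phi (v s).
Proof. by move=> cs; rewrite /curve /= cmapK. Qed.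

Lemma dens_omega (c : chartS) s : atlas c -> V s -> dom c s ->
  dens (pullback v omega) c (c s) = dens_w c (c s).
Proof.
move=> ac ps cs; have [_ _ _ _ hw] := flat.
rewrite (dens_flat ac ps cs (beta := stdOmega N)) ?form_stdOmega//.
by rewrite -hw.
Qed.

Lemma dens_dlambda (c : chartS) s : atlas c -> V s -> dom c s -> rho (phi (v s)) != 0 ->
  dens (pullback v (chart_pullback phi dlambda)) c (c s) = dens_q c (c s).
Proof.
move=> ac ps cs r0; rewrite (dens_flat ac ps cs (beta := dlambda (phi (v s))))//.
by rewrite form_dlambda// /dens_q /dens_p curveE.
Qed.

Lemma dens_dr_lambda f (c : chartS) s : atlas c -> V s -> dom c s -> rho (phi (v s)) != 0 ->
  dens (pullback v (chart_pullback phi (phi_dr_lambda f))) c (c s) =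
  f (cyl_r (phi (v s))) * dens_p c (c s).
Proof.
move=> ac ps cs r0; rewrite (dens_flat ac ps cs (beta := phi_dr_lambda f (phi (v s))))//.
by rewrite form_dr_lambda// /dens_p curveE.
Qed.

Lemma dens_p_ge0 (c : chartS) y : 0 <= dens_p c y.
Proof. by rewrite /dens_p divr_ge0 ?addr_ge0 ?sqr_ge0. Qed.

(** Bessel's inequality is [P <= w / s], and [Q] is [2 (w / s - P)]. *)
Lemma dens_q_ge0 (c : chartS) y : rho (curve v phi c y) != 0 -> 0 <= dens_q c y.
Proof.
move=> r0; have := bessel (vel c y) r0; rewrite /dens_q /dens_p /dens_w.
have := rho_neq0 r0; move: (rho _) {r0} => t t0 h.
rewrite subr_ge0 -!mulrA ler_pM2l// expr2 invfM mulrA.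
by rewrite ler_pM2r ?invr_gt0.
Qed.

Lemma cyl_rho s : V s -> v s <> p -> rho (phi (v s)) != 0.
Proof.
have [_ [dp p0] _ _ _] := flat; move=> ps vp; apply/eqP => /dot_eq0 h; apply: vp.
by rewrite -(cmapK ps) h -p0 cmapK.
Qed.

Lemma curve_cont (c : chartS) s i : atlas c -> V s -> dom c s ->
  {for c s, continuous (fun y => curve v phi c y 0 i)}.
Proof.
move=> ac ps cs; apply: (@continuous_comp _ _ _ (curve v phi c) (fun z : 'rV[R]_(N + N) => z 0 i)).
  by apply: differentiable_continuous; exact: curve_diff.
exact: coord_continuous.
Qed.

Lemma vel_cont (c : chartS) s i : atlas c -> V s -> dom c s ->
  {for c s, continuous (fun y => vel c y 0 i)}.
Proof.
move=> ac ps cs; have oV := curve_dom_open vs phi.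
apply: (@near_eq_continuous _ _ _ (fun y => 'D_e0 (fun y => curve v phi c y 0 i) y)).
  apply: (near_chart oV ps cs) => t pt ct.
  by rewrite /vel derive_coord//; exact: curve_diff.
by have := Ck_onS_derive e0 (curve_Ck vs 1 i sphi ac); apply; exists s.
Qed.

Lemma dens_w_cont : density_cont V dens_w.
Proof. by move=> c s ac ps cs; apply: continuous_dot => i; exact: vel_cont. Qed.

Lemma rho_curve_cont (c : chartS) s : atlas c -> V s -> dom c s ->
  {for c s, continuous (rho \o curve v phi c)}.
Proof. by move=> ac ps cs; apply: continuous_dot => i; exact: curve_cont. Qed.

Local Notation W := (V `&` [set s | v s <> p]).

Lemma dens_p_cont : density_cont W dens_p.
Proof.
move=> c s ac [ps vp] cs.
have r0 : rho (curve v phi c (c s)) != 0 by rewrite curveE//; exact: cyl_rho.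
have hr := rho_curve_cont ac ps cs.
have h1 : {for c s, continuous (fun y => dot (curve v phi c y) (vel c y))}.
  by apply: continuous_dot => i; [exact: curve_cont|exact: vel_cont].
have h2 : {for c s, continuous (fun y => dot (curve v phi c y *m stdJ N) (vel c y))}.
  apply: continuous_dot => i; last exact: vel_cont.
  by apply: continuous_mulmx => j; exact: curve_cont.
have h3 : {for c s, continuous (fun y => (rho (curve v phi c y) ^+ 2)^-1)}.
  by apply: continuousV; [rewrite expf_neq0|exact: (continuousM hr hr)].
exact: (continuousM (continuousD (continuousM h1 h1) (continuousM h2 h2)) h3).
Qed.

Lemma dens_q_cont : density_cont W dens_q.
Proof.
move=> c s ac Ws cs; have [ps vp] := Ws.
have r0 : rho (curve v phi c (c s)) != 0 by rewrite curveE//; exact: cyl_rho.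
have h2 : {for c s, continuous (fun _ : E2 => 2 : R)} by exact: cst_continuous.
have hw : {for c s, continuous (dens_w c)} by exact: dens_w_cont.
have hp : {for c s, continuous (dens_p c)} by exact: dens_p_cont.
have hV : {for c s, continuous (fun y => (rho (curve v phi c y))^-1)}.
  by apply: continuousV => //; exact: rho_curve_cont.
exact: (continuousB (continuousM (continuousM h2 hw) hV) (continuousM h2 hp)).
Qed.

(* The 2-form [sum_k d (g x_k) /\ dy_k - d (g y_k) /\ dx_k], where [g] is the
   function [gamma] of [|z|^2]; its integral vanishes by Stokes' theorem. *)
Lemma stokes_density (gamma gamma' : R -> R) (f : 'I_(N + N) -> S -> R) (c : chartS) s :
  atlas c -> V s -> dom c s ->
  (forall i t, V t -> f i t = gamma (rho (phi (v t))) * (phi (v t) *m stdJ N) 0 i) ->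
  let X := phi (v s) in let u := vel c (c s) in
  is_derive (rho X) (1 : R) gamma (gamma' (rho X)) ->
  \sum_i wed (f i) (fun t => phi (v t) 0 i) c (c s) =
  2 * gamma' (rho X) * (dot X u ^+ 2 + dot (X *m stdJ N) u ^+ 2)
  + 2 * gamma (rho X) * dot u u.
Proof.
move=> ac ps cs fE X u dg; have oV := curve_dom_open vs phi.
have dh := curve_diff vs sphi ac ps cs; have hE := curveE cs.
have D1 := derive1_curve ac ps cs; have D0 : 'D_e0 (curve v phi c) (c s) = u by [].
have Dx w i : 'D_w ((fun t => phi (v t) 0 i) \o cinv c) (c s) = ('D_w (curve v phi c) (c s)) 0 i.
  exact: derive_coord dh.
have Df w i : 'D_w (f i \o cinv c) (c s) =
    2 * gamma' (rho X) * dot X ('D_w (curve v phi c) (c s)) * (X *m stdJ N) 0 i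
    + gamma (rho X) * ('D_w (curve v phi c) (c s) *m stdJ N) 0 i.
  have [d1 E1] := derive_rho_comp w dh.
  have dg' : is_derive ((rho \o curve v phi c) (c s) : R) (1 : R) gamma (gamma' (rho X)).
    by rewrite /= hE.
  have [d2 E2] := derive_comp_real w d1 dg'.
  have [d3 E3] := derive_mul_comp (stdJ N) i w dh.
  transitivity ('D_w ((gamma \o (rho \o curve v phi c)) * (fun y => (curve v phi c y *m stdJ N) 0 i)) (c s)).
    apply: near_eq_derive; apply: (near_chart oV ps cs) => t pt ct.
    by rewrite /= cmapK// fE// [in RHS]/GRing.mul/= curveE.
  rewrite deriveM; [|exact: diff_derivable|exact: diff_derivable].
  rewrite E2 E1 E3 /= hE -/X; move: ('D_w (curve v phi c) (c s)) => d.
  by rewrite /GRing.scale/=; ring.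
(* The second partial derivative is [iu]. Summing over [i] turns products of coordinates into scalar
   products, where [i] acts as an isometry with square [-1]. *)
under eq_bigr do rewrite /wed !Df !Dx D1 D0.
transitivity (\sum_i (2 * gamma' (rho X) * dot X u * ((X *m stdJ N) 0 i * (u *m stdJ N) 0 i)
   + gamma (rho X) * ((u *m stdJ N) 0 i * (u *m stdJ N) 0 i)
   - 2 * gamma' (rho X) * dot X (u *m stdJ N) * ((X *m stdJ N) 0 i * u 0 i)
   + gamma (rho X) * (u 0 i * u 0 i))).
  apply: eq_bigr => i _; rewrite mulJJ [(- u) 0 i]mxE; ring.
rewrite big_split /= sumrB big_split /= -!mulr_sumr.
rewrite -[\sum_i (X *m stdJ N) 0 i * (u *m stdJ N) 0 i]/(dot (X *m stdJ N) (u *m stdJ N)).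
rewrite -[\sum_i (u *m stdJ N) 0 i * (u *m stdJ N) 0 i]/(dot (u *m stdJ N) (u *m stdJ N)).
rewrite -[\sum_i (X *m stdJ N) 0 i * u 0 i]/(dot (X *m stdJ N) u).
rewrite -[\sum_i u 0 i * u 0 i]/(dot u u) !dotJJ dotJr; ring.
Qed.

End Holomorphic.

(** * The cut-off function *)

Section Cutoff.
Context {R : realType}.
Variables (a r0 r1 : R) (f Phi : R -> R).
Hypotheses (a0 : 0 < a) (dPhi : forall r : R, is_derive r (1 : R) Phi (f r)).
Hypotheses (fc : continuous f) (Phi0 : forall r, r <= r0 -> Phi r = 0).
Hypothesis (Phi1 : forall r, r1 <= r -> Phi r = 1).

(** The variable is [t = |z|^2], so that [ln t / 2] is the cylinder coordinate [r] and [F] below is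
    [(eta - Phi) / t]. *)
Let eta (t : R) : R := 1 - possq (1 - t / a).
Let eta' (t : R) : R := 2 * Num.max (1 - t / a) 0 / a.
Let F (t : R) : R := (eta t - Phi (ln t / 2)) / t.
Let F' (t : R) : R := (eta' t - f (ln t / 2) / (2 * t)) / t - (eta t - Phi (ln t / 2)) / t ^+ 2.
(** For [0 < t < delta] the positive part in [eta] is inactive and [Phi] is still 0, so [F t] is the
    affine function [2 / a - t / a^2]. *)
Let delta : R := Num.min a (expR (2 * r0)).

(** The affine formula continues [F] across [t = 0]; this is the C^1 extension over the
    punctures. *)
Definition cutoff (t : R) : R := if t < delta then 2 / a - t / a ^+ 2 else F t.
Definition cutoff' (t : R) : R := if t < delta then - (a ^+ 2)^-1 else F' t.

Let delta0 : 0 < delta.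
Proof. by rewrite lt_min a0 expR_gt0. Qed.

Let aN0 : a != 0. Proof. exact: lt0r_neq0. Qed.

Lemma is_derive_affine (b c t : R) : is_derive t (1 : R) (fun x => b + x * c) c.
Proof.
apply: is_derive_quadratic => y.
have -> : b + y * c - (b + t * c) - c * (y - t) = 0 by ring.
by rewrite normr0 sqr_ge0.
Qed.

Let is_derive_eta (t : R) : is_derive t (1 : R) eta (eta' t).
Proof.
have h1 : is_derive t (1 : R) (fun x => 1 + x * - a^-1) (- a^-1) by exact: is_derive_affine.
have h2 := @is_derive1_comp R possq (fun x => 1 + x * - a^-1) t _ _ (is_derive_possq _) h1.
have -> : eta = cst 1 - (possq \o (fun x => 1 + x * - a^-1)).
  apply/funext => x; transitivity (1 - possq (1 + x * - a^-1)); last by [].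
    by rewrite mulrN.
have h3 := is_deriveB (is_derive_cst (1 : R) (t : R) (1 : R)) h2.
apply: is_derive_eq h3 _.
by rewrite /eta' mulrN sub0r mulrN opprK.
Qed.

Let is_derive_F (t : R) : 0 < t -> is_derive t (1 : R) F (F' t).
Proof.
move=> t0; have tN0 : t != 0 by exact: lt0r_neq0.
have hl : is_derive t (1 : R) (fun x => ln x / 2) (t^-1 / 2).
  have -> : (fun x : R => ln x / 2) = 2^-1 \*: (@ln R).
    by apply/funext => x; rewrite [RHS]mulrC.
  by apply: is_derive_eq (is_deriveZ _ (is_derive1_ln t0)) _; rewrite [LHS]mulrC.
have hP := @is_derive1_comp R Phi (fun x => ln x / 2) t _ _ (dPhi _) hl.
have hB := is_deriveB (is_derive_eta t) hP.
have hV := is_derive_inv tN0.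
have -> : F = (eta - (Phi \o (fun x => ln x / 2))) * (fun x => x^-1) by [].
apply: is_derive_eq (is_deriveM hB hV) _.
rewrite /F' /GRing.scale/= !fctE/=; move: (eta t) (eta' t) (Phi _) (f _) => *; field.
exact: tN0.
Qed.

Let f0 r : r < r0 -> f r = 0.
Proof.
move=> rr; rewrite -(@derive_val _ _ _ _ _ _ _ (dPhi r)) -(derive_cst (0 : R) r 1).
apply: near_eq_derive; have := lt_nbhsl rr; apply: filterS => x xr.
by apply: Phi0; exact: ltW.
Qed.

Let small t : 0 < t -> t < delta -> [/\ ln t / 2 < r0, t < a & 1 - t / a = Num.max (1 - t / a) 0].
Proof.
move=> t0; rewrite lt_min => /andP[ta tr]; split => //.
  by rewrite ltr_pdivrMr// mulrC -[ltRHS]expRK ltr_ln ?posrE ?expR_gt0.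
by apply/esym/max_idPl; rewrite subr_ge0 ler_pdivrMr// mul1r ltW.
Qed.

Let FE t : 0 < t -> t < delta -> F t = 2 / a - t / a ^+ 2.
Proof.
move=> t0 td; have [lr ta m] := small t0 td.
rewrite /F /eta /possq -m (Phi0 (ltW lr)); field.
by rewrite aN0 lt0r_neq0.
Qed.

Let F'E t : 0 < t -> t < delta -> F' t = - (a ^+ 2)^-1.
Proof.
move=> t0 td; have [lr ta m] := small t0 td.
rewrite /F' /eta /eta' /possq -m (Phi0 (ltW lr)) (f0 lr); field.
by rewrite aN0 lt0r_neq0.
Qed.

Lemma cutoffE t : 0 < t -> cutoff t = F t.
Proof. by move=> t0; rewrite /cutoff; case: ltP => // td; rewrite FE. Qed.

Lemma cutoff'E t : 0 < t -> cutoff' t = F' t.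
Proof. by move=> t0; rewrite /cutoff'; case: ltP => // td; rewrite F'E. Qed.

Lemma cutoff0 : cutoff 0 = 2 / a.
Proof. by rewrite /cutoff delta0 mul0r subr0. Qed.

Lemma is_derive_near (g h : R -> R) (t l : R) : {near t, g =1 h} ->
  is_derive t (1 : R) g l -> is_derive t (1 : R) h l.
Proof.
move=> gh dg.
have dh : derivable g t 1 := @ex_derive _ _ _ _ _ _ _ dg.
apply: DeriveDef; first by apply: near_eq_derivable dh; rewrite ?oner_eq0.
by rewrite -(@derive_val _ _ _ _ _ _ _ dg); apply/esym; exact: near_eq_derive.
Qed.

Lemma is_derive_cutoff t : is_derive t (1 : R) cutoff (cutoff' t).
Proof.
have [td|td] := ltP t delta.
  have -> : cutoff' t = - (a ^+ 2)^-1 by rewrite /cutoff' td.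
  apply: is_derive_near (is_derive_affine (2 / a) _ t).
  have := lt_nbhsl td; apply: filterS => x xd.
  by rewrite /cutoff xd mulrN.
have t0 : 0 < t by exact: lt_le_trans td.
rewrite cutoff'E//; apply: is_derive_near (is_derive_F t0).
have := lt_nbhsr t0; apply: filterS => x x0.
by rewrite cutoffE.
Qed.

Lemma cutoff'_continuous : continuous cutoff'.
Proof.
move=> t; have [td|td] := ltP t delta.
  apply: (@near_eq_continuous _ _ _ (cst (- (a ^+ 2)^-1))); last exact: cst_continuous.
  by have := lt_nbhsl td; apply: filterS => x xd; rewrite /cutoff' xd.
have t0 : 0 < t by exact: lt_le_trans td.
apply: (@near_eq_continuous _ _ _ F').
  by have := lt_nbhsr t0; apply: filterS => x x0; rewrite cutoff'E.
have tN0 : t != 0 by exact: lt0r_neq0.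
have cl : {for t, continuous (fun x : R => ln x / 2)}.
  apply: (@continuousM _ _ (@ln R) (cst 2^-1)); last exact: cst_continuous.
  exact: continuous_ln.
have ci : {for t, continuous (fun x : R => x^-1)} by exact: inv_continuous.
have dc (g g' : R -> R) : (forall x : R, is_derive x (1 : R) g (g' x)) -> continuous g.
  move=> dg x; apply: differentiable_continuous; apply/derivable1_diffP.
  exact: (@ex_derive _ _ _ _ _ _ _ (dg x)).
have ce : {for t, continuous eta} by exact: (dc _ _ is_derive_eta).
have ca : {for t, continuous (fun x : R => 1 - x / a)}.
  rewrite (_ : (fun x => _) = (fun x => 1 + x * - a^-1)); last first.
    by apply/funext => x; rewrite mulrN.
  exact: (dc _ (fun=> - a^-1) (is_derive_affine 1 _)).
have ce' : {for t, continuous eta'}.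
  have h1 : {for t, continuous (fun x : R => 2 * Num.max (1 - x / a) 0)}.
    exact: (@continuous_comp _ _ _ (fun x : R => 1 - x / a) (fun x : R => 2 * Num.max x 0) t ca
      (@possq_deriv_continuous R _)).
  have h2 : {for t, continuous (fun _ : R => a^-1)} by exact: cst_continuous.
  exact: (continuousM h1 h2).
have cf : {for t, continuous (fun x : R => f (ln x / 2))}.
  by apply: (@continuous_comp _ _ _ _ f _ cl); exact: fc.
have cP : {for t, continuous (fun x : R => Phi (ln x / 2))}.
  by apply: (@continuous_comp _ _ _ _ Phi _ cl); exact: (dc _ _ dPhi).
have c2 : {for t, continuous (fun x : R => (2 * x)^-1)}.
  apply: continuousV; first by rewrite mulf_neq0.
  have h2 : {for t, continuous (fun _ : R => 2 : R)} by exact: cst_continuous.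
  have hid : {for t, continuous (fun x : R => x)} by exact: cvg_id.
  exact: (continuousM h2 hid).
have ci2 : {for t, continuous (fun x : R => (x ^+ 2)^-1)}.
  by apply: continuousV; [rewrite expf_neq0|exact: exprn_continuous].
exact: (continuousB (continuousM (continuousB ce' (continuousM cf c2)) ci)
  (continuousM (continuousB ce cP) ci2)).
Qed.

Lemma cutoff_eq0 t : a <= t -> expR (2 * r1) <= t -> cutoff t = 0.
Proof.
move=> ta tr; have t0 : 0 < t by exact: lt_le_trans ta.
rewrite cutoffE// /F Phi1; last first.
  by rewrite ler_pdivlMr// mulrC -[leLHS]expRK ler_ln ?posrE ?expR_gt0.
rewrite /eta /possq (max_idPr _) ?expr0n/= ?subr0 ?subrr ?mul0r//.
by rewrite subr_le0 ler_pdivlMr// mul1r.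
Qed.

(* [eta t <= 2 t / a] and [eta' t <= 2 / a]. *)
Lemma cutoff_le t P n : 0 < t -> 0 <= P -> 0 <= 2 * n / t - 2 * P ->
  Phi (ln t / 2) * (2 * n / t - 2 * P) + f (ln t / 2) * P <=
  4 / a * n - (2 * cutoff' t * (P * t ^+ 2) + 2 * cutoff t * n).
Proof.
move=> t0 P0; set Q := _ - _ => Q0.
have tN0 : t != 0 by exact: lt0r_neq0.
(* This is [w = s (P + Q / 2)] with [n] for [w] and [t] for [s]. *)
have -> : n = t * (Q + 2 * P) / 2 by rewrite /Q; field.
rewrite cutoffE// cutoff'E//.
have e1 : eta t <= 2 * (t / a).
  rewrite /eta /possq; have : 0 < t / a by rewrite divr_gt0.
  by move: (t / a) => x x0; case: (ltP (1 - x) 0) => h; nra.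
have e2 : t * eta' t <= 2 * (t / a).
  rewrite /eta'; have : 0 < t / a by rewrite divr_gt0.
  have -> : t * (2 * Num.max (1 - t / a) 0 / a) = 2 * (t / a * Num.max (1 - t / a) 0) by field.
  by move: (t / a) => x x0; case: (ltP (1 - x) 0) => h; nra.
(* The Stokes density is [G Q + G_r P] for [G = eta - Phi], where [2 * (t * eta' t)] is the
   derivative of [eta] in [r]. *)
have -> : 2 * F' t * (P * t ^+ 2) + 2 * F t * (t * (Q + 2 * P) / 2) =
    eta t * Q + 2 * (t * eta' t) * P - Phi (ln t / 2) * Q - f (ln t / 2) * P.
  by rewrite /F /F'; field.
have -> : 4 / a * (t * (Q + 2 * P) / 2) = 2 * (t / a) * Q + 2 * (2 * (t / a)) * P by field.
have h1 := ler_wpM2r Q0 e1; have h2 := ler_wpM2r P0 e2.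
move: h1 h2; move: (eta t * Q) (Phi _ * Q) (f _ * P) => x y z.
nra.
Qed.

End Cutoff.

(** * Energy bounds *)

Section Totals.
Context {R : realType} {S : manifold R (1 + 1)}.
Local Notation E2 := 'rV[R]_(1 + 1).
Local Notation chartS := (chart R S (1 + 1)).
Variables (m : nat) (d : nat -> chartS) (B : nat -> set S) (theta : nat -> S -> R).
Hypothesis nc : nice_cover m d B theta.
Implicit Types (w : chartS -> E2 -> R) (A O : set S).

Definition partial w A : \bar R := (\sum_(j < m) chart_int w (d j) (A `&` B j))%E.

Lemma partialT w : partial w setT = total m d B w.
Proof. by apply: eq_bigr => j _; rewrite setTI. Qed.

Lemma total_add w w' : density_cont setT w -> density_cont setT w' ->
  (total m d B (fun c y => (w c y + w' c y)%R) = total m d B w + total m d B w')%E.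
Proof.
move=> cw cw'; rewrite /total -big_split; apply: eq_bigr => j _ /=.
have mB : measurable (cpre (d j) (B j)).
  have [aP dP bP _ _] := nc_piecewise nc.
  by apply: cpre_measurable => //; [exact: aP|exact: bP|exact: dP].
rewrite /chart_int -(integralD mB (piece_integrable nc (ltn_ord j) cw)
  (piece_integrable nc (ltn_ord j) cw')).
by apply: eq_integral => q _; rewrite EFinD.
Qed.

Lemma total_scale (k : R) w : 0 <= k -> density_cont setT w ->
  (forall c s, atlas c -> dom c s -> 0 <= w c (c s)) ->
  (total m d B (fun c y => (k * w c y)%R) = k%:E * total m d B w)%E.
Proof.
move=> k0 cw w0; have [aP dP bP _ _] := nc_piecewise nc.
rewrite /total ge0_sume_distrr => [|j _]; last first.
  apply: integral_ge0 => q [s Bs sq]; rewrite lee_fin -sq.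
  by apply: w0; [exact: aP|exact: dP Bs].
apply: eq_bigr => j _.
have mB : measurable (cpre (d j) (B j)).
  by apply: cpre_measurable => //; [exact: aP|exact: bP|exact: dP].
rewrite /chart_int -(integralZl mB (piece_integrable nc (ltn_ord j) cw)).
by apply: eq_integral => q _; rewrite EFinM.
Qed.

Lemma piece_measurable_fun O A w (j : 'I_m) : open O -> density_cont O w -> borelS A ->
  A `<=` O -> measurable_fun (cpre (d j) (A `&` B j)) (fun q : plane2 R => (w (d j) (plane q))%:E).
Proof.
move=> oO cw bA AO; have [aP dP bP _ _] := nc_piecewise nc.
apply/measurable_EFinP; apply: (density_measurable oO (aP j (ltn_ord j)) cw).
  by move=> s [/AO Os /(dP j (ltn_ord j))].
exact: (piece_measurable nc (ltn_ord j) bA).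
Qed.

(** [w] is continuous off the punctures and [w'] everywhere; after comparing them on [A],
    nonnegativity of [w'] allows the domain to grow to [S]. *)
Lemma partial_le O A w w' : open O -> density_cont O w -> density_cont setT w' ->
  borelS A -> A `<=` O ->
  (forall c s, atlas c -> dom c s -> A s -> 0 <= w c (c s) <= w' c (c s)) ->
  (forall c s, atlas c -> dom c s -> 0 <= w' c (c s)) ->
  (partial w A <= total m d B w')%E.
Proof.
move=> oO cw cw' bA AO ww w0; have [aP dP bP _ _] := nc_piecewise nc.
apply: lee_sum => j _; have aj := aP j (ltn_ord j); have dj := dP j (ltn_ord j).
have bT : borelS [set: S] by apply: borel_open; exact: openT.
have mA := piece_measurable nc (ltn_ord j) bA.
have mB := piece_measurable nc (ltn_ord j) bT; rewrite setTI in mB.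
have mf' := @piece_measurable_fun setT setT w' j openT cw' bT (fun s h => h); rewrite setTI in mf'.
have sub : cpre (d j) (A `&` B j) `<=` cpre (d j) (B j) by move=> q [s [As Bs] sq]; exists s.
apply: (@le_trans _ _ (chart_int w' (d j) (A `&` B j))).
  apply: ge0_le_integral => //.
  - move=> q [s [As Bs] sq]; rewrite lee_fin -sq.
    by have /andP[] := ww _ _ aj (dj s Bs) As.
  - exact: piece_measurable_fun oO cw bA AO.
  - exact: measurable_funS mB sub mf'.
  - move=> q [s [As Bs] sq]; rewrite lee_fin -sq.
    by have /andP[] := ww _ _ aj (dj s Bs) As.
apply: ge0_subset_integral => //.
by move=> q [s Bs sq]; rewrite lee_fin -sq; exact: w0 _ _ aj (dj s Bs).
Qed.

Lemma partial_lim O w (A : nat -> set S) (C : \bar R) : open O -> density_cont O w ->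
  (forall n, borelS (A n)) -> (forall n, A n `<=` O) -> nondecreasing_seq A ->
  (forall c s, atlas c -> dom c s -> O s -> 0 <= w c (c s)) ->
  (forall n, (partial w (A n) <= C)%E) -> (partial w (\bigcup_n A n) <= C)%E.
Proof.
move=> oO cw bA AO ndA w0 AC; have [aP dP bP _ _] := nc_piecewise nc.
have pos n (j : 'I_m) q : cpre (d j) (A n `&` B j) q -> (0 <= (w (d j) (plane q))%:E)%E.
  move=> [s [As Bs] sq]; rewrite lee_fin -sq; apply: w0; [exact: aP|exact: dP Bs|exact: AO As].
have h : partial w (A n) @[n --> \oo] --> partial w (\bigcup_n A n).
  apply: cvg_nnesum => j _.
    by near=> n; apply: integral_ge0; exact: pos.
  rewrite (_ : chart_int w (d j) _ = \int[leb2 R]_(q in \bigcup_n cpre (d j) (A n `&` B j)) (w (d j) (plane q))%:E)%E.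
    apply: ge0_nondecreasing_set_cvg_integral.
    - move=> n n' nn; apply/subsetPset => q [s [As Bs] sq]; exists s => //; split => //.
      by have /subsetPset := ndA _ _ nn; apply.
    - by move=> n; exact: (piece_measurable nc (ltn_ord j) (bA n)).
    - by move=> n; exact: piece_measurable_fun oO cw (bA n) (@AO n).
    - by move=> n q; exact: pos.
  rewrite /chart_int; congr (integral _ _ _); apply/seteqP; split => q.
    by move=> [s [[n _ As] Bs] sq]; exists n => //; exists s.
  by move=> [n _ [s [As Bs] sq]]; exists s => //; split => //; exists n.
by apply: (cvge_to_le h); near=> n; exact: AC.
Unshelve. all: by end_near. Qed.

End Totals.

Section CurveFunctions.
Context {R : realType} {S : manifold R (1 + 1)} {n : nat} {M : manifold R n}.
Variables (v : S -> M) (phi : chart R M n).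
Hypotheses (vs : smooth_map v) (sphi : smooth_chart phi).
Local Notation V := (v @^-1` dom phi).

Lemma CkS_curve k i : CkS k V (fun t => phi (v t) 0 i).
Proof. by move=> c ac; exact: (curve_Ck vs k i sphi ac). Qed.

Lemma CkS_curve_dot k (w : 'rV[R]_n) : CkS k V (fun t => dot (phi (v t)) w).
Proof.
have oV := curve_dom_open vs phi; apply: CkS_sum => // i.
exact: (CkS_mul oV (CkS_curve k i) (CkS_cst k V (w 0 i))).
Qed.

Lemma CkS_curve_mul k (A : 'M[R]_n) j : CkS k V (fun t => (phi (v t) *m A) 0 j).
Proof.
apply: CkS_eq (CkS_curve_dot k (col j A)^T); first exact: curve_dom_open.
by move=> s _; rewrite mulmx_dot.
Qed.

End CurveFunctions.

Lemma CkS_curve_rho (R : realType) (S : manifold R (1 + 1)) N (M : manifold R (N + N))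
    (v : S -> M) (phi : chart R M (N + N)) k : smooth_map v -> smooth_chart phi ->
  CkS k (v @^-1` dom phi) (fun t => rho (phi (v t))).
Proof.
move=> vs sphi; have oV := curve_dom_open vs phi; apply: CkS_sum => // i.
exact: (CkS_mul oV (CkS_curve vs sphi k i) (CkS_curve vs sphi k i)).
Qed.

Lemma norm_sqr_le_rho (R : realType) N (z : 'rV[R]_(N + N)) : `|z| ^+ 2 <= rho z.
Proof.
have [->|z0] := eqVneq z 0; first by rewrite normr0 expr0n; exact: dot_ge0.
have : `|z| != 0 by rewrite normr_eq0.
rewrite {1}/Num.norm/= => /mx_norm_neq0[[i j]] /= E; rewrite {1}/Num.norm/= E ord1.
rewrite real_normK ?num_real// /rho /dot (bigD1 j)//= -expr2 lerDl.
by apply: sumr_ge0 => k _; rewrite -expr2 sqr_ge0.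
Qed.

Lemma compact_rho_le (R : realType) N (t : R) : compact [set z : 'rV[R]_(N + N) | rho z <= t].
Proof.
apply: bounded_closed_compact.
  exists (`|t| + 1); split; first exact: num_real.
  move=> x tx z /= zt; apply: (le_trans _ (ltW tx)).
  have := norm_sqr_le_rho z; have := ler_norm t; have := normr_ge0 z; have := normr_ge0 t.
  nra.
apply: (@closed_comp _ _ (@rho R N) [set x | x <= t]); last exact: closed_le.
by move=> z _; exact: differentiable_continuous (differentiable_rho z).
Qed.

Lemma cyl_rE (R : realType) N (z : 'rV[R]_(N + N)) : rho z != 0 -> cyl_r z = ln (rho z) / 2.
Proof.
move=> /rho_neq0 r0; rewrite /cyl_r enormE.
rewrite -{2}(sqr_sqrtr (ltW r0)) lnXn ?sqrtr_gt0// mulr2n.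
by move: (ln _) => l; field.
Qed.

(** * The estimate for a fixed curve *)

Section Bound.
Context {R : realType} {N : nat} {M : manifold R (N + N)}.
Variables (omega J : M -> 'M[R]_(N + N)) (p : M) (eps : R) (phi : chart R M (N + N)).
Hypotheses (hM : hausdorff_space M) (so : smooth_form omega).
Hypotheses (comp : compatible omega J) (eps0 : 0 < eps).
Hypothesis flat : flat_chart omega J p eps phi.
Context {S : manifold R (1 + 1)}.
Hypotheses (rS : riemann_surface S) (hS : hausdorff_space S).
Variable v : S -> M.
Hypothesis hol : J_holomorphic J v.
Local Notation E2 := 'rV[R]_(1 + 1).
Local Notation chartS := (chart R S (1 + 1)).
Local Notation V := (v @^-1` dom phi).
Local Notation W := (V `&` [set s | v s <> p]).
Variables (m : nat) (d : nat -> chartS) (B : nat -> set S) (theta : nat -> S -> R).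
Hypothesis nc : nice_cover m d B theta.

Let vs : smooth_map v := hol.1.
Let sphi : smooth_chart phi. Proof. by case: flat. Qed.
Let oV : open V. Proof. exact: curve_dom_open. Qed.

(** Half of [eps^2], so that [eta] is constant before the end of the chart. *)
Let a : R := eps ^+ 2 / 2.
Let a0 : 0 < a. Proof. by rewrite divr_gt0 ?exprn_gt0. Qed.

Lemma open_W : open W.
Proof.
apply: openI; first exact: oV.
apply: (@open_comp _ _ v (~` [set p])); first by move=> s _; exact: vs.1.
by apply: closed_openC; apply: accessible_closed_set1; exact: hausdorff_accessible.
Qed.

Section Test.
Variables (r0 r1 : R) (f Phi : R -> R).
Hypotheses (dPhi : forall r : R, is_derive r (1 : R) Phi (f r)) (fc : continuous f).
Hypotheses (f0 : forall r, 0 <= f r) (Phi_ge0 : forall r, 0 <= Phi r).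
Hypotheses (Phi0 : forall r, r <= r0 -> Phi r = 0) (Phi1 : forall r, r1 <= r -> Phi r = 1).
Hypothesis r1_eps : r1 < ln eps.

(** Negated, so that the Stokes density is added to [(4 / a) w] in [w2]. *)
Let gam t := - cutoff a r0 Phi t.
Let gam' t := - cutoff' a r0 f Phi t.
(** From this value of [rho] on, [eta] and [Phi] are both 1 and [gam] vanishes. *)
Let tm := Num.max a (expR (2 * r1)).

Let tm_eps : tm < eps ^+ 2.
Proof.
rewrite gt_max; apply/andP; split.
  by rewrite /a ltr_pdivrMr// ltr_pMr ?exprn_gt0// ltr1n.
rewrite expRM_natl ltr_pXn2r// ?nnegrE ?expR_ge0 ?(ltW eps0)//.
by rewrite -[ltRHS]lnK ?posrE// ltr_expR.
Qed.

(** Transported to [M], the closed ball is compact and hence closed in all of [M], so its preimage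
    in [S] is closed although [v] may leave the chart. *)
Let KM : set M := cinv phi @` [set z | rho z <= tm].
Let K : set S := v @^-1` KM.

Let Z_img : [set z | rho z <= tm] `<=` phi @` dom phi.
Proof.
have [_ _ im _ _] := flat; rewrite im => z /= zt; rewrite enormE.
rewrite -[ltRHS](ger0_norm (ltW eps0)) -sqrtr_sqr ltr_sqrt ?exprn_gt0//.
exact: le_lt_trans zt tm_eps.
Qed.

Let closed_K : closed K.
Proof.
apply: preimage_closed; first by move=> s _; exact: vs.1.
apply: compact_closed => //; apply: continuous_compact; last exact: compact_rho_le.
by apply: continuous_in_subspaceT => z; rewrite inE => /Z_img; exact: cinv_cont.
Qed.

Let K_V : K `<=` V.
Proof. by move=> s [z /Z_img[x dx <-] vx]; rewrite /= -vx cmapK. Qed.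

Let VK s : V s -> ~ K s -> tm <= rho (phi (v s)).
Proof.
move=> ps nK; rewrite leNgt; apply/negP => h; apply: nK.
by exists (phi (v s)); [exact: ltW|exact: cmapK].
Qed.

(** The coefficients of [gam *: lambda0] with respect to the coordinate differentials, pulled back
    to [S] and extended by zero outside the chart. *)
Let fi (i : 'I_(N + N)) (t : S) : R :=
  if t \in V then gam (rho (phi (v t))) * (phi (v t) *m stdJ N) 0 i else 0.

Let fiE i t : V t -> fi i t = gam (rho (phi (v t))) * (phi (v t) *m stdJ N) 0 i.
Proof. by move=> h; rewrite /fi mem_set. Qed.

Let fi0 i s : ~ K s -> fi i s = 0.
Proof.
move=> nK; rewrite /fi; case: ifPn => //; rewrite inE => ps.
have := VK ps nK; rewrite ge_max => /andP[h1 h2].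
by rewrite /gam (cutoff_eq0 (r1 := r1))// oppr0 mul0r.
Qed.

Let dgam (t : R) : is_derive t (1 : R) gam (gam' t).
Proof.
have h := is_derive_cutoff a0 dPhi Phi0 t; have := is_deriveN h; exact.
Qed.

Let fi_C1 i : CkS 1 V (fi i).
Proof.
apply: (@CkS_eq _ _ 1 V ((gam \o (fun t => rho (phi (v t)))) \* (fun t => (phi (v t) *m stdJ N) 0 i))) => //.
  by move=> s ps; rewrite fiE.
apply: CkS_mul => //; last exact: CkS_curve_mul.
apply: (@CkS_comp_real _ _ V _ gam gam' oV (CkS_curve_rho 1 vs sphi)) => s _; first exact: dgam.
by apply: continuousN; apply: (cutoff'_continuous (r0 := r0)).
Qed.

Let T (c : chartS) (y : E2) : R := \sum_i wed (fi i) (fun t => phi (v t) 0 i) c y.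

Let wi_cont i : density_cont setT (wed (fi i) (fun t => phi (v t) 0 i)).
Proof. exact: (wed_cont_ext closed_K K_V (fi0 i) (fi_C1 i) (CkS_curve vs sphi 1 i)). Qed.

Let T_cont : density_cont setT T.
Proof. by move=> c s ac Is cs; apply: continuous_sum => i; exact: wi_cont. Qed.

Let total_T : total m d B T = 0%E.
Proof.
rewrite (total_sum nc wi_cont); apply: big1 => i _.
exact: (surface_stokes rS hS nc oV closed_K K_V (fi0 i) (fi_C1 i) (CkS_curve vs sphi 2 i)).
Qed.

Local Notation Om := (dens (pullback v omega)).
(** It has the same integral as [(4 / a) w], as [T] integrates to 0, but unlike that density it
    dominates [f P + Phi Q] directly. *)
Let w2 (c : chartS) (y : E2) : R := 4 / a * Om c y + T c y.

Let ln_half s : rho (phi (v s)) != 0 -> ln (rho (phi (v s))) / 2 = cyl_r (phi (v s)).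
Proof. by move=> h; rewrite cyl_rE. Qed.

Let w2_W (c : chartS) s : atlas c -> dom c s -> W s ->
  Phi (cyl_r (phi (v s))) * dens_q phi v c (c s) + f (cyl_r (phi (v s))) * dens_p phi v c (c s)
  <= w2 c (c s).
Proof.
move=> ac cs [ps vp]; have r0' := cyl_rho flat ps vp.
have rp := rho_neq0 r0'; have hE := curveE phi v cs.
have P0 := dens_p_ge0 phi v c (c s).
have Q0 : 0 <= dens_q phi v c (c s) by apply: dens_q_ge0; rewrite hE.
have Pn : dot (phi (v s)) (vel phi v c (c s)) ^+ 2
    + dot (phi (v s) *m stdJ N) (vel phi v c (c s)) ^+ 2 =
    dens_p phi v c (c s) * rho (phi (v s)) ^+ 2.
  by rewrite /dens_p hE divfK// expf_neq0.
rewrite /w2 (dens_omega rS flat hol ac ps cs) /T.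
rewrite (stokes_density rS flat hol ac ps cs fiE (dgam _)) Pn.
have := cutoff_le a0 dPhi Phi0 rp P0 (n := dens_w phi v c (c s)).
rewrite ln_half// /dens_q hE => h; apply: le_trans (h _) _; first by rewrite /dens_q hE in Q0.
rewrite /gam /gam' /dens_w; move: (cutoff a r0 Phi _) (cutoff' a r0 f Phi _) (dens_p _ _ _ _) (dot _ _) => x y z n.
lra.
Qed.

(** Outside the chart [T] vanishes and compatibility decides; over the cylinder [w2_W] does. *)
Let w2_ge0 (c : chartS) s : atlas c -> dom c s -> 0 <= w2 c (c s).
Proof.
move=> ac cs; have [ps|nps] := pselect (V s); last first.
  rewrite /w2 /T big1 ?addr0 => [|i _].
    apply: mulr_ge0; last exact: (dens_omega_ge0 rS comp hol).
    by rewrite divr_ge0 ?(ltW a0).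
  by apply: (wed_zero _ closed_K (fi0 i)) => // /K_V.
(* At a puncture [gam 0 = - 2 / a], and the two terms of [w2] cancel exactly. *)
have [vp|vp] := pselect (v s = p).
  have [_ [_ p0] _ _ _] := flat.
  rewrite /w2 (dens_omega rS flat hol ac ps cs) /T.
  rewrite (stokes_density rS flat hol ac ps cs fiE (dgam _)) vp p0.
  have d0 (u : 'rV[R]_(N + N)) : dot 0 u = 0.
    by rewrite /dot big1// => i _; rewrite mxE mul0r.
  rewrite mul0mx !d0 /rho d0 /gam (cutoff0 _ _ a0) expr0n /= addr0 mulr0 add0r /dens_w.
  by rewrite le_eqVlt; apply/orP; left; apply/eqP; ring.
apply: le_trans (w2_W ac cs (conj ps vp)).
have r0' := cyl_rho flat ps vp.
rewrite addr_ge0// mulr_ge0 ?dens_p_ge0//.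
by apply: dens_q_ge0; rewrite curveE.
Qed.

(** The integrand is dominated by [w2] on [A]; the integral of [w2] over [S] is evaluated by Stokes'
    theorem. *)
Lemma partial_bound A w : borelS A -> A `<=` W -> density_cont W w ->
  (forall c s, atlas c -> dom c s -> A s -> 0 <= w c (c s) <=
     Phi (cyl_r (phi (v s))) * dens_q phi v c (c s)
     + f (cyl_r (phi (v s))) * dens_p phi v c (c s)) ->
  (partial m d B w A <= (4 / a)%:E * total m d B Om)%E.
Proof.
move=> bA AW cw hw; have cO := dens_smooth_cont vs so.
have k0 : 0 <= 4 / a by rewrite divr_ge0// ltW.
have cO' : density_cont setT (fun c y => 4 / a * Om c y).
  move=> c s ac Is cs; have h1 : {for c s, continuous (fun _ : E2 => 4 / a)} by exact: cst_continuous.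
  exact: (continuousM h1 (cO c s ac Is cs)).
have cw2 : density_cont setT w2.
  move=> c s ac Is cs; exact: (continuousD (cO' c s ac Is cs) (T_cont ac Is cs)).
apply: (@le_trans _ _ (total m d B w2)).
  apply: (partial_le nc open_W cw cw2 bA AW _ w2_ge0) => c s ac cs As.
  have /andP[h1 h2] := hw c s ac cs As; rewrite h1 /=; apply: (le_trans h2).
  by apply: w2_W => //; exact: AW.
rewrite (total_add nc cO' T_cont) total_T adde0 (total_scale nc k0 cO)//.
by move=> c s ac cs; exact: (dens_omega_ge0 rS comp hol).
Qed.

End Test.

Let cyl_pos s : W s -> 0 < rho (phi (v s)).
Proof. by move=> [ps vp]; exact: rho_neq0 (cyl_rho flat ps vp). Qed.

Lemma dens_dr_lambda_cont f : continuous f ->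
  density_cont W (dens (pullback v (chart_pullback phi (phi_dr_lambda f)))).
Proof.
move=> fc c s ac Ws cs; have [ps vp] := Ws.
apply: (@near_eq_continuous _ _ _ (fun y => f (ln (rho (curve v phi c y)) / 2) * dens_p phi v c y)).
  apply: (near_chart open_W Ws cs) => t Wt ct; have [pt vt] := Wt.
  have r0 : rho (phi (v t)) != 0 by exact: (cyl_rho flat pt vt).
  by rewrite (dens_dr_lambda rS flat hol) // curveE// cyl_rE.
have hr := rho_curve_cont flat hol ac ps cs.
have hl : {for c s, continuous (fun y => ln (rho (curve v phi c y)) / 2)}.
  have h1 : {for c s, continuous (fun y => ln (rho (curve v phi c y)))}.
    apply: (@continuous_comp _ _ _ (rho \o curve v phi c) (@ln R)); first exact: hr.
    by apply: continuous_ln; rewrite /= curveE//; exact: cyl_pos.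
  have h2 : {for c s, continuous (fun _ : E2 => 2^-1 : R)} by exact: cst_continuous.
  exact: (continuousM h1 h2).
have hf : {for c s, continuous (fun y => f (ln (rho (curve v phi c y)) / 2))}.
  exact: (@continuous_comp _ _ _ (fun y => ln (rho (curve v phi c y)) / 2) f _ hl (fc _)).
exact: (continuousM hf (dens_p_cont flat hol ac Ws cs)).
Qed.

Lemma dens_dlambda_cont : density_cont W (dens (pullback v (chart_pullback phi dlambda))).
Proof.
move=> c s ac Ws cs; apply: near_eq_continuous (dens_q_cont flat hol ac Ws cs).
apply: (near_chart open_W Ws cs) => t Wt ct; have [pt vt] := Wt.
by rewrite (dens_dlambda rS flat hol)//; exact: (cyl_rho flat pt vt).
Qed.

Lemma chart_pullback_tr (beta : 'rV[R]_(N + N) -> 'M[R]_(N + N)) s :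
  (forall z, (beta z)^T = - beta z) ->
  (pullback v (chart_pullback phi beta) s)^T = - pullback v (chart_pullback phi beta) s.
Proof.
move=> h; apply: pullback_tr.
by rewrite /chart_pullback /pull !trmx_mul trmxK h mulNmx mulmxN mulmxA.
Qed.

Lemma dlambda_tr (z : 'rV[R]_(N + N)) : (dlambda z)^T = - dlambda z.
Proof. by apply/matrixP => i j; rewrite !mxE opprB. Qed.

Lemma phi_dr_lambda_tr f (z : 'rV[R]_(N + N)) : (phi_dr_lambda f z)^T = - phi_dr_lambda f z.
Proof.
rewrite /phi_dr_lambda /wedge; move: (dext0 _ z) (lambda z) (f _) => x y k.
by apply/matrixP => i j; rewrite !mxE !big_ord1 !mxE; ring.
Qed.

Lemma dr_lambda_bound (r0 r1 : R) (f Phi : R -> R) :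
  (forall r : R, is_derive r (1 : R) Phi (f r)) -> continuous f ->
  (forall r, 0 <= f r) -> (forall r, 0 <= Phi r) ->
  (forall r, r <= r0 -> Phi r = 0) -> (forall r, r1 <= r -> Phi r = 1) -> r1 < ln eps ->
  (surface_integral W (pullback v (chart_pullback phi (phi_dr_lambda f)))
   <= (4 / a)%:E * total m d B (dens (pullback v omega)))%E.
Proof.
move=> dPhi fc f0 Phi_ge0 Phi0 Phi1 r1e.
have cd := dens_dr_lambda_cont fc; have bW : borelS W by apply: borel_open; exact: open_W.
rewrite (surface_integralE rS open_W _ cd bW _ (nc_piecewise nc))//; last first.
  by move=> s; apply: chart_pullback_tr; exact: phi_dr_lambda_tr.
apply: (partial_bound dPhi fc f0 Phi_ge0 Phi0 Phi1 r1e bW (fun s h => h) cd) => c s ac cs Ws.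
have [ps vp] := Ws; have r0' := cyl_rho flat ps vp.
rewrite (dens_dr_lambda rS flat hol)//.
have h1 : 0 <= dens_p phi v c (c s) by exact: dens_p_ge0.
have h2 : 0 <= dens_q phi v c (c s) by apply: dens_q_ge0; rewrite curveE.
by rewrite mulr_ge0//= lerDr mulr_ge0.
Qed.

Lemma chart_preimage_open (U : set 'rV[R]_(N + N)) : open U ->
  open (dom phi `&` phi @^-1` U).
Proof.
move=> oU; rewrite openE => x [dx Ux]; apply: filterI.
  by apply: open_nbhs_nbhs; split => //; exact: dom_open.
by apply: (cmap_cont dx); exact: open_nbhs_nbhs.
Qed.

(** A nondecreasing C^1 step from 0 at [x = 0] to 1 at [x = 1]. Its translates serve as [Phi] for
    the bound on [dlambda], where no test function is given. *)
Let kap (x : R) : R := 1 - possq (1 - possq x).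
Let kap' (x : R) : R := 2 * Num.max (1 - possq x) 0 * (2 * Num.max x 0).

Let dkap (c r : R) : is_derive r (1 : R) (fun r => kap (r - c)) (kap' (r - c)).
Proof.
have h1 : is_derive r (1 : R) (fun r => - c + r * 1) 1 by exact: is_derive_affine.
have h2 := @is_derive1_comp R possq (fun r => - c + r * 1) r _ _ (is_derive_possq _) h1.
have h3 := is_deriveB (is_derive_cst (1 : R) (r : R) (1 : R)) h2.
have h4 := @is_derive1_comp R possq _ r _ _ (is_derive_possq _) h3.
have h5 := is_deriveB (is_derive_cst (1 : R) (r : R) (1 : R)) h4.
have E x : - c + x * 1 = x - c by rewrite mulr1 addrC.
have -> : (fun r => kap (r - c)) = cst 1 - (possq \o (cst 1 - (possq \o (fun r => - c + r * 1)))).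
  by apply/funext => x; rewrite /kap -E.
apply: is_derive_eq h5 _.
rewrite /kap' -E mulr1 !sub0r.
have -> : (cst 1 - (possq \o (fun r => - c + r * 1))) r = 1 - possq (- c + r * 1) by [].
by rewrite mulrN opprK.
Qed.

Let kap'_cont (c : R) : continuous (fun r => kap' (r - c)).
Proof.
move=> r.
have ca : {for r, continuous (fun x : R => x - c)}.
  have h1 : {for r, continuous (fun x : R => x)} by exact: cvg_id.
  have h2 : {for r, continuous (fun _ : R => c)} by exact: cst_continuous.
  exact: (continuousB h1 h2).
have cp (x : R) : {for x, continuous (@possq R)}.
  apply: differentiable_continuous; apply/derivable1_diffP.
  exact: (@ex_derive _ _ _ _ _ _ _ (is_derive_possq x)).
have c1 : {for r, continuous (fun x : R => 1 - possq (x - c))}.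
  have h1 : {for r, continuous (fun _ : R => 1 : R)} by exact: cst_continuous.
  exact: (continuousB h1 (@continuous_comp _ _ _ (fun x : R => x - c) possq r ca (cp _))).
exact: (continuousM
  (@continuous_comp _ _ _ (fun x : R => 1 - possq (x - c)) (fun x : R => 2 * Num.max x 0) r c1
     (@possq_deriv_continuous R _))
  (@continuous_comp _ _ _ (fun x : R => x - c) (fun x : R => 2 * Num.max x 0) r ca
     (@possq_deriv_continuous R _))).
Qed.

Let kap0 x : x <= 0 -> kap x = 0.
Proof.
move=> x0; rewrite /kap {2}/possq (max_idPr x0) expr0n /= subr0 /possq.
by rewrite (max_idPl _) ?expr1n ?subrr// ler01.
Qed.

Let kap1 x : 1 <= x -> kap x = 1.
Proof.
move=> x1; rewrite /kap {2}/possq (max_idPl (le_trans ler01 x1)) /possq (max_idPr _) ?expr0n/= ?subr0//.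
by rewrite subr_le0 exprn_ege1.
Qed.

Let kap_ge0 x : 0 <= kap x.
Proof.
have h := sqr_ge0 (Num.max x 0); rewrite /kap /possq subr_ge0.
move: (Num.max x 0 ^+ 2) h => t t0; case: (ltP (1 - t) 0) => h.
  by rewrite expr0n ler01.
by rewrite exprn_ile1// gerBl.
Qed.

Let kap'_ge0 x : 0 <= kap' x.
Proof. by rewrite /kap' !mulr_ge0// le_max lexx orbT. Qed.

(** The exhaustion is by sets: on [A n] a translate of [kap] equals 1, so [Phi Q] is [Q] there, and
    the bound is uniform in [n]. *)
Lemma dlambda_bound :
  (surface_integral W (pullback v (chart_pullback phi dlambda))
   <= (4 / a)%:E * total m d B (dens (pullback v omega)))%E.
Proof.
have cd := dens_dlambda_cont; have bW : borelS W by apply: borel_open; exact: open_W.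
rewrite (surface_integralE rS open_W _ cd bW _ (nc_piecewise nc))//; last first.
  by move=> s; apply: chart_pullback_tr; exact: dlambda_tr.
(* The levels decrease to minus infinity; the offset 1 keeps them strictly below [ln eps]. *)
pose l (n : nat) : R := ln eps - 1 - n%:R.
pose A n := W `&` v @^-1` (dom phi `&` phi @^-1` [set z | expR (2 * l n) < rho z]).
have oA n : open (A n).
  apply: openI; first exact: open_W.
  apply: open_comp; first by move=> s _; exact: vs.1.
  apply: chart_preimage_open; apply: (@open_comp _ _ (@rho R N) [set x | expR (2 * l n) < x]).
    by move=> z _; exact: differentiable_continuous (differentiable_rho z).
  exact: open_gt.
have bA n : borelS (A n) by exact: borel_open.
have AW n : A n `<=` W by move=> s [].
have AU : W = \bigcup_n A n.
  apply/seteqP; split => [s Ws|s [n _ [Ws _]]//].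
  pose x := ln eps - 1 - ln (rho (phi (v s))) / 2.
  exists (Num.bound `|x|) => //; split => //; split; first by case: Ws.
  rewrite /= -[ltRHS]lnK ?posrE ?cyl_pos// ltr_expR.
  have := le_lt_trans (ler_norm x) (archi_boundP (normr_ge0 x)).
  by rewrite /l; set k := _%:R; rewrite /x; lra.
rewrite -/(partial m d B _ W) [X in partial _ _ _ _ X]AU.
apply: (partial_lim nc open_W cd bA AW).
- apply/nondecreasing_seqP => n; apply/subsetPset => s [Ws [ps /= h]]; split => //; split => //=.
  apply: le_lt_trans h; rewrite ler_expR ler_pM2l// /l lerD2l lerN2 ler_nat//.
- move=> c s ac cs [ps vp]; have r0 := cyl_rho flat ps vp.
  by rewrite (dens_dlambda rS flat hol)//; apply: dens_q_ge0; rewrite curveE.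
(* The step rises on the unit interval that ends at [l n], so it equals 1 on [A n]. *)
move=> n; pose c0 := l n - 1.
apply: (@partial_bound c0 (l n) (fun r => kap' (r - c0)) (fun r => kap (r - c0))) => //.
- by move=> r h; apply: kap0; rewrite subr_le0.
- by move=> r h; apply: kap1; rewrite /c0 opprB addrCA lerDl subr_ge0.
- by rewrite /l; have := ler0n R n; lra.
move=> c s ac cs [Ws [ps /= h]]; have r0 := cyl_rho flat ps Ws.2.
rewrite (dens_dlambda rS flat hol)//.
have h1 : 0 <= dens_p phi v c (c s) by exact: dens_p_ge0.
have h2 : 0 <= dens_q phi v c (c s) by apply: dens_q_ge0; rewrite curveE.
have h3 : 1 <= cyl_r (phi (v s)) - c0.
  rewrite cyl_rE// /c0.
  by move: h; rewrite -[X in _ < X -> _]lnK ?posrE ?cyl_pos// ltr_expR; lra.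
by rewrite (kap1 h3) mul1r h2 lerDl; exact: (mulr_ge0 (kap'_ge0 _) h1).
Qed.

Lemma symp_bound (A : set S) : borelS A ->
  (surface_integral A (pullback v omega) <= total m d B (dens (pullback v omega)))%E.
Proof.
move=> bA; have cO := dens_smooth_cont vs so.
rewrite (surface_integralE rS openT _ cO bA _ (nc_piecewise nc))//; last first.
  by move=> s; apply: pullback_tr; exact: so.1.
apply: (partial_le nc openT cO cO bA) => // c s ac cs; last exact: (dens_omega_ge0 rS comp hol).
by rewrite (dens_omega_ge0 rS comp hol)//=.
Qed.

Lemma symp_total :
  surface_integral setT (pullback v omega) = total m d B (dens (pullback v omega)).
Proof.
have cO := dens_smooth_cont vs so.
have bT : borelS [set: S] by apply: borel_open; exact: openT.
rewrite (surface_integralE rS openT _ cO bT _ (nc_piecewise nc))//.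
  by rewrite -partialT.
by move=> s; apply: pullback_tr; exact: so.1.
Qed.

End Bound.

(** The primitive from minus infinity is 0 below the support and 1 above it, the total integral
    being 1. Compactness of the support in the open half-line puts [r1] strictly below [ln eps]. *)
Lemma test_primitive (R : realType) (eps : R) (f : R -> R) : test_fun eps f ->
  exists r0 r1 Phi, [/\ forall r : R, is_derive r (1 : R) Phi (f r),
    forall r, 0 <= Phi r, forall r, r <= r0 -> Phi r = 0, forall r, r1 <= r -> Phi r = 1 &
    r1 < ln eps].
Proof.
move=> [sf cK Ksub f01 f1]; set K := closure _ in cK Ksub.
have fc : continuous f by move=> x; exact: (sf 0%N x I).
have f0 x : 0 <= f x by have /andP[] := f01 x.
have fK x : ~ K x -> f x = 0.
  move=> nK; apply/eqP; apply: contra_notT nK => fx; exact: subset_closure.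
have [M [_ MK]] := compact_bounded cK.
have Kl (x : R) : K x -> - (`|M| + 2) < x.
  move=> Kx; have : `|x| <= `|M| + 1 by apply: MK => //; rewrite ltr_pwDr// ler_norm.
  by rewrite ler_norml => /andP[+ _]; apply: lt_le_trans; rewrite ltrN2 ltrD2l ltr1n.
(* The midpoint between the largest point of the support and [ln eps], strictly separated from
   both. *)
have [b bL Kb] : exists2 b, b < ln eps & forall x, K x -> x < b.
  have [K0|/nonemptyPn K0] := pselect (K !=set0); last first.
    by exists (ln eps - 1); [lra|move=> x; rewrite K0].
  have hid : {within K, continuous (fun x : R => x)}.
    by apply: continuous_in_subspaceT => x _; exact: cvg_id.
  have [c /set_mem Kc cmax] := compact_EVT_max K0 cK hid.
  have := Ksub c Kc; rewrite /= in_itv/= => cL.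
  exists ((c + ln eps) / 2); first by lra.
  by move=> x Kx; have := cmax x (mem_set Kx); lra.
have mf (A : set R) : measurable (A : set (measurableTypeR R)) ->
    measurable_fun (A : set (measurableTypeR R)) (f : measurableTypeR R -> R).
  by move=> mA; apply: measurable_funTS; exact: continuous_measurable_fun.
have supp (A : set R) : (forall x, K x -> A x) ->
    (\int[leb R]_(x in A) (f x)%:E = \int[leb R]_x (f x)%:E)%E.
  move=> KA; rewrite integral_mkcond; apply: eq_integral => x _; rewrite patchE.
  by case: ifPn => // /negP; rewrite inE => nA; rewrite fK// => /KA.
have fT : (\int[leb R]_x (f x)%:E = 1)%E by rewrite -f1 supp.
have intf (A : set R) : measurable (A : set (measurableTypeR R)) ->
    (leb R).-integrable A (EFin \o f).
  move=> mA; apply/integrableP; split; first by apply/measurable_EFinP; exact: mf.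
  apply: (@le_lt_trans _ _ (\int[leb R]_x (f x)%:E)%E); last by rewrite fT ltry.
  under eq_integral do rewrite /= ger0_norm//.
  apply: ge0_subset_integral => //; first by apply/measurable_EFinP; exact: mf.
  by move=> x _; rewrite lee_fin.
pose Phi (r : R) : R := Rintegral (leb R) `]-oo, r] f.
exists (- (`|M| + 2)), b, Phi; split => //.
- move=> r; have r1 : r < r + 1 by rewrite ltrDl.
  case: (@continuous_FTC1 R f -oo%O r (r + 1) r1 (intf _ (measurable_itv _)) _ (fc r)) => [|dP PE]; first by rewrite ltNyr.
  by apply: DeriveDef; [exact: dP|rewrite -derive1E; exact: PE].
- move=> r; apply: fine_ge0; apply: integral_ge0 => x _; by rewrite lee_fin.
- move=> r rM; rewrite /Phi /Rintegral integral0_eq// => x /=; rewrite in_itv/= => xr.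
  by congr (_%:E); apply: fK => /Kl; rewrite ltNge (le_trans xr rM).
- move=> r br; rewrite /Phi /Rintegral supp ?fT// => x Kx.
  by rewrite /= in_itv/= (le_trans (ltW (Kb x Kx)) br).
Qed.

Theorem theorem7 (R : realType) (N : nat) (M : manifold R (N + N))
    (omega J : M -> 'M[R]_(N + N)) (p : M) (eps : R)
    (phi : chart R M (N + N)) :
  closed_manifold M ->
  symplectic omega ->
  almost_complex J ->
  compatible omega J ->
  0 < eps ->
  flat_chart omega J p eps phi ->
  exists C1 : R, 0 < C1 /\
    forall (S : manifold R (1 + 1)) (v : S -> M),
      closed_manifold S ->
      connected [set: S] ->
      riemann_surface S ->
      J_holomorphic J v ->
      ~ (exists q : M, forall s : S, v s = q) ->
      (E_symp omega [set: S] v < +oo)%E ->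
      (hofer_energy omega p eps phi (~` (v @^-1` [set p])) v
         <= C1%:E * E_symp omega [set: S] v)%E.
Proof.
move=> [hM _] [so _ _] _ comp eps0 flat.
pose k : R := 4 / (eps ^+ 2 / 2).
have k0 : 0 < k by rewrite !divr_gt0 ?exprn_gt0.
exists (1 + k + k); split; first by rewrite !addr_gt0.
move=> S v [hS cS] _ rS hol nconst fin.
(* On an empty surface [v] would be constant. *)
have [s0] : exists s : S, True.
  apply: contrapT => h; apply: nconst; exists p => s.
  by exfalso; apply: h; exists s.
move=> _; have [m [d [B [theta nc]]]] := nice_cover_exists hS cS s0.
have WE : cyl_part p phi (~` (v @^-1` [set p])) v = v @^-1` dom phi `&` [set s | v s <> p].
  apply/seteqP; split => [s [/= h1 [h2 h3]]|s [/= h1 h2]] //.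
have E := symp_total so rS hol nc.
(* Removing the punctures cannot increase the integral of a nonnegative density. *)
have b1 : (E_symp omega (~` (v @^-1` [set p])) v <= E_symp omega setT v)%E.
  rewrite /E_symp E; apply: (symp_bound so comp rS hol nc).
  apply: borel_open; apply: closed_openC; apply: preimage_closed; first by move=> s _; exact: hol.1.1.
  by apply: accessible_closed_set1; exact: hausdorff_accessible.
have b2 : (E_dlambda p phi (~` (v @^-1` [set p])) v <= k%:E * E_symp omega setT v)%E.
  by rewrite /E_dlambda WE /E_symp E; exact: (dlambda_bound hM so comp eps0 flat rS hS hol nc).
have b3 : (E_lambda p eps phi (~` (v @^-1` [set p])) v <= k%:E * E_symp omega setT v)%E.
  apply: ge_ereal_sup => _ [f tf <-]; rewrite WE /E_symp E.
  have [r0 [r1 [Phi [dPhi Phi_ge0 Phi0 Phi1 r1e]]]] := test_primitive tf.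
  have [sf _ _ f01 _] := tf.
  apply: (dr_lambda_bound hM so comp eps0 flat rS hS hol nc dPhi _ _ Phi_ge0 Phi0 Phi1 r1e).
    by move=> x; exact: (sf 0%N x I).
  by move=> x; have /andP[] := f01 x.
have E0 : (0 <= E_symp omega setT v)%E.
  rewrite /E_symp E; have [aP dP _ _ _] := nc_piecewise nc.
  apply: sume_ge0 => j _; apply: integral_ge0 => q [s Bs sq].
  by rewrite lee_fin -sq; apply: (dens_omega_ge0 rS comp hol); [exact: aP|exact: dP Bs].
(* Finiteness of the symplectic energy turns the final distribution of [1 + k + k] into real
   arithmetic. *)
move: fin E0 b1 b2 b3; case: (E_symp omega setT v) => [e| |]//= _ _ b1 b2 b3.
have -> : ((1 + k + k)%:E * e%:E = e%:E + k%:E * e%:E + k%:E * e%:E)%E.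
  by rewrite -!EFinM -!EFinD; congr (_%:E); ring.
by apply: leeD => //; exact: leeD.
Qed.
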